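(* Let $M$ be an irreducible improper affine hypersphere with parallel cubic form of dimension $n\le4$. If $n=1$, then $M$ is a quadric. If $n=2$ or $n=3$, then $M$ is isomorphic to the $n$-dimensional Cayley hypersurface. If $n=4$, then $M$ is isomorphic to exactly one of the hypersurfaces in $\mathbb R^5$ $$x_5=x_1x_2+x_3x_4-\tfrac13x_1x_3(x_1+x_3),$$ $$x_5=x_1x_2+x_3x_4-\tfrac13x_1x_3^2,$$ $$x_5=x_1x_4+x_2x_3-x_1^2x_3-x_1x_2^2+x_1^3x_2-\tfrac15x_1^5.$$
   Context: A graph immersion is a smooth hypersurface immersion $f$ of an $n$-manifold into affine space $\mathbb A^{n+1}$ equipped with a constant transversal vector field $\xi$. With $D$ the flat connection of $\mathbb A^{n+1}$, $D_X f_*Y=f_*(\nabla_XY)+h(X,Y)\xi$ defines the induced connection $\nabla$ and the affine fundamental form $h$, assumed non-degenerate; $\hat\nabla$ is the Levi-Civita connection of the affine metric $h$, $C=\nabla h$ the cubic form. ''Parallel cubic form'' means $\hat\nabla C=0$. An improper affine hypersphere is viewed as a graph immersion whose transversal field $\xi$ is its constant affine normal (determined up to sign); in local representation $x\mapsto(x,F(x))$, $\xi=(\mathbf 0,1)$, in coordinates with standard volume form, this means $\det F''\equiv\pm1$. The product of graph immersions $x_k\mapsto(x_k,F_k(x_k))$ over domains $\Omega_k\subset\mathbb R^{n_k}$ is the graph immersion over $\prod\Omega_k$ of $F(x_1,\dots,x_r)=\sum_kF_k(x_k)$. A graph immersion which can (locally, up to affine equivalence) be represented in a nontrivial way as such a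 product is called (locally) decomposable; otherwise it is irreducible. The $n$-dimensional Cayley hypersurface is the graph of $F(x_1,\dots,x_n)=\sum_{d=2}^{n+1}\frac{(-1)^d}{d}\sum_{i_1+\dots+i_d=n+1}\prod_{j=1}^dx_{i_j}$, the inner sum running over all ordered $d$-tuples of positive integers with sum $n+1$. ''Isomorphic'' means affinely equivalent as hypersurfaces. Every connected improper affine hypersphere with parallel cubic form extends to a complete one, given as a global graph of a polynomial; $M$ is understood to be connected and to be this maximal extension. *)

(* Defs.v *)
(* R^n and the affine space A^{n+1} are the row vector
   spaces 'rV[R]_n and 'rV[R]_(n + 1). *)
From HB Require Import structures.
From mathcomp Require Export all_boot all_order all_algebra.
From mathcomp Require Export all_classical all_reals all_analysis.
Export Order.TTheory GRing.Theory Num.Theory.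
Export numFieldNormedType.Exports.

Set Implicit Arguments.
Unset Strict Implicit.
Unset Printing Implicit Defensive.

Local Open Scope classical_set_scope.
Local Open Scope ring_scope.

Section Smooth.
Context {R : realType}.

Definition partial (n : nat) (W : normedModType R) (i : 'I_n)
    (f : 'rV[R]_n -> W) : 'rV[R]_n -> W :=
  fun x => 'D_(delta_mx 0 i) f x.

(* For U open this is C^infinity on U: every iterated partial derivative is
   (totally) differentiable, hence continuous, at every point of U. *)
Definition smooth_on (n : nat) (W : normedModType R) (U : set 'rV[R]_n)
    (f : 'rV[R]_n -> W) : Prop :=
  forall (s : seq 'I_n) (x : 'rV[R]_n), U x ->
    differentiable (foldr (fun i g => partial i g) f s) x.

Definition domain (n : nat) (U : set 'rV[R]_n) : Prop :=
  [/\ open U, connected U & U !=set0].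

End Smooth.

(* Hypersurface immersions f : U -> A^{n+1}, U a subset of R^n, with a constant
   transversal vector field xi.  All tensors and connections are given by their
   components in the coordinate frame d_0, ..., d_(n-1) of U. *)
Section GraphImmersion.
Context {R : realType} (n : nat).
Variables (f : 'rV[R]_n -> 'rV[R]_(n + 1)) (xi : 'rV[R]_(n + 1)).

(* Rows: f_* d_0, ..., f_* d_(n-1), xi. *)
Definition frame (x : 'rV[R]_n) : 'M[R]_(n + 1) :=
  col_mx (jacobian f x) xi.

(* Coordinates, in this frame, of D_{d_i} f_* d_j: by the Gauss formula
   D_X f_*Y = f_*(nabla_X Y) + h(X, Y) xi, the first n of them are the
   components of nabla_{d_i} d_j and the last one is h(d_i, d_j). *)
Definition gauss (i j : 'I_n) (x : 'rV[R]_n) : 'rV[R]_(n + 1) :=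
  partial i (partial j f) x *m invmx (frame x).

(* induced_conn i j k is the component along d_k of nabla_{d_i} d_j *)
Definition induced_conn (i j k : 'I_n) (x : 'rV[R]_n) : R :=
  gauss i j x 0 (lshift 1 k).

Definition affine_form (x : 'rV[R]_n) : 'M[R]_n :=
  \matrix_(i, j) gauss i j x 0 (rshift n 0).

Definition graph_immersion (U : set 'rV[R]_n) : Prop :=
  smooth_on U f /\
  forall x, U x -> frame x \in unitmx /\ affine_form x \in unitmx.

(* (nabla_{d_i} h)(d_j, d_k) *)
Definition cubic_form (i j k : 'I_n) (x : 'rV[R]_n) : R :=
  partial i (fun y => affine_form y j k : R^o) x
  - \sum_(m < n) induced_conn i j m x * affine_form x m k
  - \sum_(m < n) induced_conn i k m x * affine_form x j m.

(* Christoffel symbols of the Levi-Civita connection of h: the component along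
   d_k of hat-nabla_{d_i} d_j. *)
Definition levi_civita (i j k : 'I_n) (x : 'rV[R]_n) : R :=
  2^-1 * \sum_(l < n) invmx (affine_form x) k l *
    (partial i (fun y => affine_form y j l : R^o) x
     + partial j (fun y => affine_form y i l : R^o) x
     - partial l (fun y => affine_form y i j : R^o) x).

(* (hat-nabla_{d_l} C)(d_i, d_j, d_k) *)
Definition nabla_cubic_form (l i j k : 'I_n) (x : 'rV[R]_n) : R :=
  partial l (fun y => cubic_form i j k y : R^o) x
  - \sum_(m < n) levi_civita l i m x * cubic_form m j k x
  - \sum_(m < n) levi_civita l j m x * cubic_form i m k x
  - \sum_(m < n) levi_civita l k m x * cubic_form i j m x.

Definition parallel_cubic_form (U : set 'rV[R]_n) : Prop :=
  forall x, U x -> forall l i j k, nabla_cubic_form l i j k x = 0.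

(* xi is the affine normal of f: being constant it is equiaffine, and the
   induced volume form |det (f_* d_0, ..., f_* d_(n-1), xi)| equals the volume
   form |det h|^(1/2) of the affine metric.  For the graph of F with
   xi = (0, 1) this is |det F''| = 1. *)
Definition improper_affine_sphere (U : set 'rV[R]_n) : Prop :=
  graph_immersion U /\
  forall x, U x -> (\det (frame x)) ^+ 2 = `|\det (affine_form x)|.

End GraphImmersion.

Section Hypersurfaces.
Context {R : realType}.

Definition graph_map (n : nat) (F : 'rV[R]_n -> R) (x : 'rV[R]_n) :
    'rV[R]_(n + 1) := row_mx x (F x)%:M.

Definition graph (n : nat) (F : 'rV[R]_n -> R) : set 'rV[R]_(n + 1) :=
  range (graph_map F).

(* the transversal vector (0, 1) *)
Definition vertical (n : nat) : 'rV[R]_(n + 1) := row_mx 0 1%:M.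

Definition affine_map (p q : nat) (A : 'M[R]_(p, q)) (b : 'rV[R]_q)
    (y : 'rV[R]_p) : 'rV[R]_q := y *m A + b.

(* The two conditions force p = q; keeping A rectangular avoids transport along
   equalities of dimensions. *)
Definition linear_iso (p q : nat) (A : 'M[R]_(p, q)) : Prop :=
  row_free A /\ row_full A.

Definition affinely_equivalent (p q : nat) (M : set 'rV[R]_p)
    (N : set 'rV[R]_q) : Prop :=
  exists (A : 'M[R]_(p, q)) (b : 'rV[R]_q),
    linear_iso A /\ N = affine_map A b @` M.

(* The maximal (complete) connected improper affine hyperspheres with parallel
   cubic form: in suitable affine coordinates, in which xi = (0, 1), M is the
   graph of a function on the whole of R^n. *)
Definition parallel_improper_affine_sphere (n : nat)
    (M : set 'rV[R]_(n + 1)) (xi : 'rV[R]_(n + 1)) : Prop :=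
  exists (F : 'rV[R]_n -> R) (A : 'M[R]_(n + 1)) (b : 'rV[R]_(n + 1)),
    let f := affine_map A b \o graph_map F in
    [/\ linear_iso A, vertical n *m A = xi, M = range f,
        improper_affine_sphere f xi setT & parallel_cubic_form f xi setT].

(* A point of R^(m_0 + ... + m_(r-1)) is written (x_0, ..., x_(r-1)) with
   x_k = submxrow x k. *)
Definition product_domain (r : nat) (m : 'I_r -> nat)
    (Omega : forall k, set 'rV[R]_(m k)) : set 'rV[R]_(\sum_k m k) :=
  [set x | forall k, Omega k (submxrow x k)].

Definition product_fun (r : nat) (m : 'I_r -> nat)
    (F : forall k, 'rV[R]_(m k) -> R) (x : 'rV[R]_(\sum_k m k)) : R :=
  \sum_k F k (submxrow x k).

(* Near each of its points, M is affinely equivalent, with matching transversal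
   fields, to a product of at least two graph immersions of positive
   dimension. *)
Definition locally_decomposable (n : nat) (M : set 'rV[R]_(n + 1))
    (xi : 'rV[R]_(n + 1)) : Prop :=
  forall p, M p ->
  exists V : set 'rV[R]_(n + 1), [/\ open V, V p &
  exists (r : nat) (m : 'I_r -> nat) (Omega : forall k, set 'rV[R]_(m k))
         (F : forall k, 'rV[R]_(m k) -> R),
    [/\ (1 < r)%N, forall k, (0 < m k)%N, forall k, domain (Omega k),
        forall k, graph_immersion (graph_map (F k)) (vertical (m k)) (Omega k) &
        exists (A : 'M[R]_(\sum_k m k + 1, n + 1)) (b : 'rV[R]_(n + 1)),
          [/\ linear_iso A, vertical (\sum_k m k) *m A = xi &
              M `&` V = (affine_map A b \o graph_map (product_fun F)) @`
                        product_domain Omega]]].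

Definition irreducible_hypersurface (n : nat) (M : set 'rV[R]_(n + 1))
    (xi : 'rV[R]_(n + 1)) : Prop := ~ locally_decomposable M xi.

Definition quadric (p : nat) (M : set 'rV[R]_p) : Prop :=
  exists (Q : 'M[R]_p) (l : 'cV[R]_p) (c : R),
    [/\ Q^T = Q, Q != 0 &
        M = [set y | (y *m Q *m y^T + y *m l) 0 0 + c = 0]].

(* The index t j : 'I_n stands for i_j = (t j).+1, between 1 and n; ordered
   d-tuples of positive integers with sum n + 1 and d >= 2 have such entries. *)
Definition cayley (n : nat) (x : 'rV[R]_n) : R :=
  \sum_(2 <= d < n.+2) (-1) ^+ d / d%:R *
    \sum_(t : {ffun 'I_d -> 'I_n} | (\sum_j (t j).+1 == n.+1)%N)
      \prod_j x 0 (t j).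

Definition model4 (k : 'I_3) (x : 'rV[R]_4) : R :=
  let x1 := x 0 (@inord 3 0) in let x2 := x 0 (@inord 3 1) in
  let x3 := x 0 (@inord 3 2) in let x4 := x 0 (@inord 3 3) in
  nth 0 [:: x1 * x2 + x3 * x4 - 3^-1 * x1 * x3 * (x1 + x3);
            x1 * x2 + x3 * x4 - 3^-1 * x1 * x3 ^+ 2;
            x1 * x4 + x2 * x3 - x1 ^+ 2 * x3 - x1 * x2 ^+ 2 + x1 ^+ 3 * x2
              - 5^-1 * x1 ^+ 5] k.

End Hypersurfaces.

(* Main.v *)
(* In suitable affine coordinates M is the graph of a smooth F on R^n with xi =
   (0, 1), and C is the third derivative of F.  At each point, h = F'' and C =
   h(u v, w) define a commutative product on R^n.  Parallelism of C becomes
   D_w D_a D_b D_c F = 1/2 (h(wa, bc) + h(wb, ac) + h(wc, ab)), symmetry of the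
   fifth derivative becomes an identity of degree four in this algebra, and
   constancy of det F'' says that all multiplications are trace-free.  Hence
   there are no nonzero idempotents, every element is nilpotent, and for n <= 4 the
   sixth derivative of F vanishes on the diagonal, so that up to an affine function
   F(x) = 1/2 h(x, x) + 1/6 h(x^2, x) + 1/16 h(x^2, x^2) + 1/40 h(x^2, x^3)
   in the algebra at the origin.

   An annihilating vector z with h(z, z) <> 0 splits F, so irreducibility makes
   the annihilator isotropic.  If some x^n is nonzero, a suitable basis of powers
   turns F into the Cayley polynomial.  Otherwise n = 4 and all cubes vanish, the
   annihilator is Lagrangian and F is a pairing plus a binary cubic form, which has a
   real root; the three normal forms of such cubics give the two cubic models and a
   decomposable hypersurface.  Affine equivalences between the models preserve the
   vertical direction, so the models are told apart by the degree and by the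
   multiplicities of the roots of the binary cubic. *)

(* The algebra is not power-associative by definition, and nilpotent elements need not have
   nilpotent multiplications; both facts are drawn from the identity of degree four. All
   multiplications [L_u] are self-adjoint for [h], which forces [L_x] and [L_(x^2)] to commute, so
   the algebra is Jordan and its powers behave. Fitting's lemma then turns the absence of
   idempotents into nilpotency of each element. Nilpotency of the operators [L_x] uses [x^6 = 0]; it
   forbids eigenvectors with nonzero eigenvalue, and this is the contradiction that closes the hard
   cases. That all cubes vanish once no [x^n] survives hides two exclusions. For n = 3 a Lagrangian
   annihilator would make the dimension even. For n = 4 the intermediate case [s^4 = 0], [s^3 <> 0]
   must be refuted separately. The factor 1/2 in the equation for the fourth derivative is that of
   the Christoffel symbols: in graph coordinates the induced connection is flat, and the Levi-Civita
   connection differs from it by half the product. The models are compared through values of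
   polynomials at a few integers, which reduces each comparison of coefficients to linear
   arithmetic. *)
From HB Require Import structures.
Require Import Defs.
From mathcomp Require Import perm ring lra zify.

Set Implicit Arguments.
Unset Strict Implicit.
Unset Printing Implicit Defensive.
Local Open Scope classical_set_scope.
Local Open Scope ring_scope.

(** * Smooth functions and directional derivatives *)

Section Smoothness.
Context {R : realType} {n : nat}.
Implicit Types (i : 'I_n) (s : seq 'I_n) (u v x : 'rV[R]_n).

Notation iter_partial f s := (foldr (fun i g => partial i g) f s).

Section Codomain.
Context {W : normedModType R}.
Implicit Types (f g : 'rV[R]_n -> W).

Lemma smooth_differentiable f x : smooth_on setT f -> differentiable f x.
Proof. by move=> /(_ [::] x I). Qed.

Lemma smooth_partial f i : smooth_on setT f -> smooth_on setT (partial i f).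
Proof. by move=> sf s x _; move: (sf (rcons s i) x I); rewrite foldr_rcons. Qed.

Lemma smooth_cst (c : W) : smooth_on setT (fun _ : 'rV[R]_n => c).
Proof.
move=> s x _.
have [d Ed] : exists d : W, iter_partial (fun _ : 'rV[R]_n => c) s = cst d.
  elim: s => [|i s [d /= Ed]]; first by exists c.
  by exists 0; apply/funext => y; rewrite /= Ed /partial derive_cst.
by rewrite Ed; exact: differentiable_cst.
Qed.

Lemma smooth_by_partial f : (forall x, differentiable f x) ->
  (forall i, smooth_on setT (partial i f)) -> smooth_on setT f.
Proof.
move=> df sf s; elim/last_ind: s => [|s i _] x _ /=; first exact: df.
by rewrite foldr_rcons; apply: sf.
Qed.

Lemma smoothD f g : smooth_on setT f -> smooth_on setT g ->
  smooth_on setT (fun x => f x + g x).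
Proof.
move=> sf sg s x _.
suff -> : iter_partial (fun x => f x + g x) s
    = iter_partial f s + iter_partial g s.
  by apply: differentiableD; [exact: sf|exact: sg].
elim: s => [//|i s /= ->]; apply/funext => y.
rewrite /partial deriveD//; apply: diff_derivable; [exact: sf|exact: sg].
Qed.

End Codomain.

Lemma smooth_comp_linear (W W' : normedModType R) (f : 'rV[R]_n -> W)
    (p : {linear W -> W'}) :
  continuous p -> smooth_on setT f -> smooth_on setT (p \o f).
Proof.
move=> cp sf s x _.
have dp y : differentiable p y by exact: linear_differentiable.
suff -> : iter_partial (p \o f) s = p \o iter_partial f s.
  by apply: differentiable_comp; [exact: sf|exact: dp].
elim: s => [//|i s /= ->]; apply/funext => y.
rewrite /partial deriveE; last first.
  by apply: differentiable_comp; [exact: sf|exact: dp].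
rewrite diff_comp; [|exact: sf|exact: dp].
by rewrite /= diff_lin// -deriveE//; exact: sf.
Qed.

Lemma smoothZ (F : 'rV[R]_n -> R) (c : R) : smooth_on setT (F : _ -> R^o) ->
  smooth_on setT ((fun x => c * F x) : _ -> R^o).
Proof.
apply: (@smooth_comp_linear R^o R^o F (GRing.scale c : {linear R^o -> R^o})).
exact: scaler_continuous.
Qed.

Lemma smooth_scalel (W : normedModType R) (F : 'rV[R]_n -> R) (w : W) :
  smooth_on setT (F : _ -> R^o) -> smooth_on setT (fun x => F x *: w).
Proof.
have sw_lin : linear (fun a : R^o => a *: w).
  by move=> /= a b c; rewrite scalerDl scalerA.
pose swM := GRing.isLinear.Build _ _ _ _ _ sw_lin.
pose sw : {linear R^o -> W} := HB.pack (fun a : R^o => a *: w) swM.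
by apply: (@smooth_comp_linear _ _ _ sw); exact: scalel_continuous.
Qed.

End Smoothness.

Section Directional.
Context {R : realType} {n : nat}.
Implicit Types (u v x y : 'rV[R]_n) (F G : 'rV[R]_n -> R).

Definition smooth F : Prop := smooth_on setT (F : _ -> R^o).

(* Sealed behind an opaque proof: conversion must never unfold the limit. *)
Fact dd_subproof : {d : 'rV[R]_n -> ('rV[R]_n -> R) -> 'rV[R]_n -> R |
  forall u F x, d u F x = 'D_u (F : _ -> R^o) x}.
Proof. by eexists => u F x; reflexivity. Qed.

Definition dd := sval dd_subproof.

Lemma ddE u F x : dd u F x = 'D_u (F : _ -> R^o) x.
Proof. exact: (svalP dd_subproof). Qed.

Lemma smooth_is_derive F u x :
  smooth F -> is_derive x u (F : _ -> R^o) (dd u F x).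
Proof.
move=> sF; rewrite ddE; apply/derivableP/diff_derivable.
exact: smooth_differentiable.
Qed.

Lemma ddDl F (a : R) u v x : smooth F ->
  dd (a *: u + v) F x = a * dd u F x + dd v F x.
Proof.
move=> sF; have dF := @smooth_differentiable _ _ R^o F x sF.
by rewrite !ddE !deriveE// linearP.
Qed.

Lemma dd0 F x : dd 0 F x = 0.
Proof. by rewrite ddE derive0. Qed.

Lemma dd_sum F (I : Type) (r : seq I) (P : pred I) (a : I -> R)
    (e : I -> 'rV[R]_n) x : smooth F ->
  dd (\sum_(i <- r | P i) a i *: e i) F x = \sum_(i <- r | P i) a i * dd (e i) F x.
Proof.
move=> sF; elim: r => [|i r IH]; first by rewrite !big_nil dd0.
by rewrite !big_cons; case: ifP => _; rewrite ?ddDl// IH.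
Qed.

Lemma dd_basis F u x : smooth F ->
  dd u F x = \sum_i u 0 i * dd (delta_mx 0 i) F x.
Proof. by move=> sF; rewrite {1}[u]row_sum_delta dd_sum. Qed.

Lemma smooth_sum (I : Type) (r : seq I) (P : pred I) (f : I -> 'rV[R]_n -> R) :
  (forall i, smooth (f i)) -> smooth (fun x => \sum_(i <- r | P i) f i x).
Proof.
move=> sf; elim: r => [|i r IH].
  by under eq_fun do rewrite big_nil; exact: smooth_cst.
under eq_fun do rewrite big_cons.
by case: (P i) => //; exact: (@smoothD _ _ R^o _ _ (sf i) IH).
Qed.

Lemma smooth_dd F u : smooth F -> smooth (dd u F).
Proof.
move=> sF; have -> : dd u F = fun x => \sum_i u 0 i * dd (delta_mx 0 i) F x.
  by apply/funext => x; exact: dd_basis.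
apply: smooth_sum => i; apply: smoothZ.
rewrite (_ : dd _ F = partial i (F : _ -> R^o)); last first.
  by apply/funext => x; rewrite ddE.
exact: (@smooth_partial _ _ R^o).
Qed.

Lemma smooth_line F u x : smooth F ->
  forall t : R, is_derive t (1:R) (fun s => F (x + s *: u)) (dd u F (x + t *: u)).
Proof.
move=> sF t; have [df Df] := smooth_is_derive u (x + t *: u) sF.
have E : (fun h : R => h^-1 *: ((((fun s => F (x + s *: u)) : R -> R^o) \o shift t)
      (h *: (1 : R)) - F (x + t *: u)))
    = (fun h : R => h^-1 *: (((F : _ -> R^o) \o shift (x + t *: u)) (h *: u)
        - F (x + t *: u))).
  apply/funext => h /=; congr (_ *: (F _ - _)).
  by rewrite [h *: 1]mulr1 scalerDl addrCA.
by split; [rewrite /derivable E; exact: df|rewrite -Df /derive E].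
Qed.

Lemma smooth_continuous F : smooth F -> continuous F.
Proof.
by move=> sF x; exact/differentiable_continuous/(@smooth_differentiable _ _ R^o).
Qed.

Lemma smooth_line_continuous F u x : smooth F ->
  continuous (fun s : R => F (x + s *: u)).
Proof.
move=> sF t; apply: differentiable_continuous.
by apply/derivable1_diffP; case: (smooth_line u x sF t).
Qed.

End Directional.

(** * Symmetry of the second derivatives *)

Section Schwarz.
Context {R : realType} {n : nat}.
Implicit Types (u v x y : 'rV[R]_n) (F G : 'rV[R]_n -> R).

(** The mean value theorem twice: along [u] for the difference of [F] between two parallel lines,
    then along [v] for the derivative so obtained. The left-hand side is symmetric in [u] and [v],
    which is its use. *)
Lemma second_difference F u v x (s : R) : smooth F -> 0 < s ->
  exists a b : R, [/\ `|a| <= s, `|b| <= s &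
    F (x + s *: v + s *: u) - F (x + s *: u) - (F (x + s *: v) - F x)
    = s * s * dd v (dd u F) (x + a *: u + b *: v)].
Proof.
move=> sF s0.
pose f (r : R) := F (x + s *: v + r *: u) - F (x + r *: u).
pose df (r : R) := dd u F (x + s *: v + r *: u) - dd u F (x + r *: u).
have Df (r : R) : is_derive r (1 : R) f (df r).
  by apply: is_deriveB; exact: smooth_line.
have cf : continuous f.
  by move=> r; apply: cvgB; exact: smooth_line_continuous.
have [a /andP[a0 a1] Ea] : exists2 c, c \in `]0, s[%R & f s - f 0 = df c * (s - 0).
  by apply: MVT => //; exact: continuous_subspaceT.
pose g (r : R) := dd u F (x + a *: u + r *: v).
have sdF := smooth_dd u sF.
have [b /andP[b0 b1] Eb] : exists2 c, c \in `]0, s[%R &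
    g s - g 0 = dd v (dd u F) (x + a *: u + c *: v) * (s - 0).
  apply: (MVT s0) => [r _|]; first exact: smooth_line.
  by apply: continuous_subspaceT; exact: smooth_line_continuous.
exists a, b; split; rewrite ?ger0_norm ?ltW//.
move: Ea; rewrite /f !scale0r !addr0 => ->.
have -> : df a = g s - g 0 by rewrite /df /g scale0r addr0 addrAC.
by rewrite Eb; ring.
Qed.

(** The symmetric second difference equates the two mixed derivatives at two points arbitrarily
    close to [x]; continuity of both carries the equality to [x]. *)
Lemma ddC F u v x : smooth F -> dd u (dd v F) x = dd v (dd u F) x.
Proof.
move=> sF; apply/eqP; rewrite -subr_eq0 -normr_le0; apply/ler_addgt0Pl => e e0.
have near_x G : smooth G -> exists2 d : R, 0 < d & forall y, `|x - y| < d -> `|G x - G y| < e / 2.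
  move=> /smooth_continuous/(_ x)/cvgrPdist_lt/(_ (e / 2)).
  have e20 : 0 < e / 2 by rewrite divr_gt0.
  by move=> /(_ e20)/nbhs_normP[d /= d0 Hd]; exists d => // y yd; exact: Hd.
have [d1 d10 H1] := near_x _ (smooth_dd u (smooth_dd v sF)).
have [d2 d20 H2] := near_x _ (smooth_dd v (smooth_dd u sF)).
pose m := Num.min d1 d2.
have m0 : 0 < m by rewrite lt_min d10.
(* The summand 1 keeps [k] positive when [u = v = 0], and with [s = m / k] both intermediate points
   lie strictly within [m] of [x]. *)
pose k := `|u| + `|v| + 1.
have k0 : 0 < k by rewrite ltr_wpDl// addr_ge0.
pose s := m / k.
have s0 : 0 < s by rewrite divr_gt0.
have small (a b : R) w z : `|a| <= s -> `|b| <= s -> `|w| + `|z| = `|u| + `|v| ->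
    `|x - (x + a *: w + b *: z)| < m.
  move=> ha hb hwz; rewrite opprD opprD !addrA subrr add0r -opprD normrN.
  apply: (le_lt_trans (ler_normD _ _)); rewrite !normrZ.
  apply: (@le_lt_trans _ _ (s * (`|w| + `|z|))).
    by rewrite mulrDr lerD// ler_wpM2r.
  rewrite hwz -[ltRHS](divfK (lt0r_neq0 k0)) ltr_pM2l//.
  by rewrite /k ltrDl.
have [a [b [ha hb E]]] := second_difference u v x sF s0.
have [a' [b' [ha' hb' E']]] := second_difference v u x sF s0.
have ss : s * s != 0 by rewrite mulf_neq0// lt0r_neq0.
have EE : dd v (dd u F) (x + a *: u + b *: v)
    = dd u (dd v F) (x + a' *: v + b' *: u).
  move: E E'; rewrite (addrAC x (s *: u)).
  move: (F _) (F _) (F _) (F _) (dd _ _ _) (dd _ _ _) => f1 f2 f3 f4 p q E E'.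
  apply: (mulfI ss); rewrite -E -E'; ring.
have := H2 (x + a *: u + b *: v); have := H1 (x + a' *: v + b' *: u).
have S1 : `|x - (x + a' *: v + b' *: u)| < m by exact: (small _ _ _ _ ha' hb' (addrC _ _)).
have S2 : `|x - (x + a *: u + b *: v)| < m by exact: (small _ _ _ _ ha hb erefl).
move: S1 S2; rewrite lt_min => /andP[S1 _]; rewrite lt_min => /andP[_ S2].
move=> /(_ S1) K1 /(_ S2) K2; rewrite EE in K2.
rewrite addr0; move: K1 K2.
move: (dd u (dd v F) x) (dd v (dd u F) x) (dd u (dd v F) (_ + _)) => p q r K1 K2.
rewrite (_ : p - q = (p - r) - (q - r)); last by ring.
apply: ltW; apply: (le_lt_trans (ler_normB _ _)); rewrite (splitr e).
apply: ltrD; [exact: K1|exact: K2].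
Qed.

End Schwarz.

(** * Derivatives of matrix-valued functions *)

Section MatrixDerivative.
Context {R : realType} {V : normedModType R}.
Implicit Types (x v : V).

Lemma is_derive_bigsum (I : Type) (r : seq I) (P : pred I) (h : I -> V -> R)
    (dh : I -> R) x v :
  (forall i, is_derive x v (h i : _ -> R^o) (dh i)) ->
  is_derive x v ((fun y => \sum_(i <- r | P i) h i y) : _ -> R^o)
    (\sum_(i <- r | P i) dh i).
Proof.
move=> H; elim: r => [|i r IH].
  by rewrite big_nil; under eq_fun do rewrite big_nil; exact: is_derive_cst.
rewrite big_cons; under eq_fun do rewrite big_cons.
by case: (P i) => //; exact: (is_deriveD (H i) IH).
Qed.

Lemma is_derive_mul (f g : V -> R) (df dg : R) x v :
  is_derive x v (f : _ -> R^o) df -> is_derive x v (g : _ -> R^o) dg ->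
  is_derive x v ((fun y => f y * g y) : _ -> R^o) (df * g x + f x * dg).
Proof.
move=> Hf Hg; apply: (is_derive_eq (is_deriveM Hf Hg)).
by rewrite addrC [_ *: df]mulrC.
Qed.

Lemma is_derive_prod (I : finType) (h : I -> V -> R) (dh : I -> R) x v :
  (forall i, is_derive x v (h i : _ -> R^o) (dh i)) ->
  is_derive x v ((fun y => \prod_i h i y) : _ -> R^o)
    (\sum_i dh i * \prod_(j | j != i) h j x).
Proof.
move=> H.
suff G : forall r : seq I, uniq r ->
    is_derive x v ((fun y => \prod_(i <- r) h i y) : _ -> R^o)
      (\sum_(i <- r) dh i * \prod_(j <- r | j != i) h j x).
  exact: G (index_enum_uniq I).
elim=> [_|i r IH /= /andP[ir ur]].
  by rewrite big_nil; under eq_fun do rewrite big_nil; exact: is_derive_cst.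
under eq_fun do rewrite big_cons.
apply: (is_derive_eq (is_derive_mul (H i) (IH ur))).
rewrite big_cons big_cons eqxx /=; congr (_ * _ + _).
  rewrite [RHS]big_seq_cond [LHS]big_seq_cond; apply: eq_bigl => j.
  by rewrite andbT; case jr: (j \in r) => //=; apply/esym; apply: contraNneq ir => <-.
rewrite mulr_sumr big_seq [RHS]big_seq; apply: eq_bigr => j jr.
rewrite big_cons (_ : i != j) 1?mulrCA//.
by apply: contraNneq ir => ->.
Qed.

(** Entrywise, so that products, transposes, determinants and inverses reduce to the rules for
    scalar functions. *)
Definition mderive (p q : nat) x v (A : V -> 'M[R]_(p, q)) (dA : 'M[R]_(p, q)) :=
  forall i j, is_derive x v ((fun y => A y i j) : _ -> R^o) (dA i j).

Lemma mderive_mul (p q r : nat) x v (A : V -> 'M[R]_(p, q)) (B : V -> 'M[R]_(q, r)) dA dB :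
  mderive x v A dA -> mderive x v B dB ->
  mderive x v (fun y => A y *m B y) (dA *m B x + A x *m dB).
Proof.
move=> HA HB i j; under eq_fun do rewrite mxE.
rewrite !mxE -big_split; apply: is_derive_bigsum => k.
exact: is_derive_mul.
Qed.

Lemma mderive_tr (p q : nat) x v (A : V -> 'M[R]_(p, q)) dA :
  mderive x v A dA -> mderive x v (fun y => (A y)^T) dA^T.
Proof. by move=> HA i j; under eq_fun do rewrite mxE; rewrite mxE. Qed.

Lemma mderive_unique (p q : nat) x v (A : V -> 'M[R]_(p, q)) dA dA' :
  mderive x v A dA -> mderive x v A dA' -> dA = dA'.
Proof.
move=> H H'; apply/matrixP => i j.
by have [_ <-] := H i j; have [_ <-] := H' i j.
Qed.

Lemma mderive_cst (p q : nat) x v (A : 'M[R]_(p, q)) :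
  mderive x v (fun=> A) 0.
Proof. by move=> i j; rewrite mxE; exact: is_derive_cst. Qed.

(** Jacobi's formula. *)
Lemma is_derive_det (p : nat) x v (A : V -> 'M[R]_p) dA :
  mderive x v A dA ->
  is_derive x v ((fun y => \det (A y)) : _ -> R^o) (\tr (dA *m \adj (A x))).
Proof.
move=> HA; rewrite /determinant.
have D (s : {perm 'I_p}) : is_derive x v
    ((fun y => (-1) ^+ s * \prod_i A y i (s i)) : _ -> R^o)
    ((-1) ^+ s * \sum_i dA i (s i) * \prod_(j | j != i) A x j (s j)).
  apply: is_deriveZ; apply: is_derive_prod => i; exact: HA.
apply: (is_derive_eq (is_derive_bigsum _ _ D)).
(* Differentiating only the factor of row [i] in the Leibniz formula gives the determinant with row
   [i] of [A x] replaced by that of [dA]; its Laplace expansion along this row is a diagonal entry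
   of [dA *m \adj (A x)]. *)
pose Ai (i : 'I_p) := \matrix_(k, j) if k == i then dA i j else A x k j.
transitivity (\sum_i \det (Ai i)).
  rewrite /determinant exchange_big; apply: eq_bigr => s _.
  rewrite -mulr_sumr; congr (_ * _); apply: eq_bigr => i _.
  rewrite [RHS](bigD1 i)//= mxE eqxx; congr (_ * _); apply: eq_bigr => j ji.
  by rewrite mxE (negbTE ji).
apply: eq_bigr => i _; rewrite (expand_det_row _ i) mxE; apply: eq_bigr => j _.
rewrite !mxE eqxx; congr (_ * _); rewrite /cofactor; congr (_ * \det _).
by apply/matrixP => k l; rewrite !mxE; case: eqP => // /eqP; rewrite lift_eqF.
Qed.

(** Cramer's rule: the entries are cofactors divided by the determinant. The value of the derivative
    is then found in [mderive_inv] by differentiating the product of the matrix and its inverse. *)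
Lemma derivable_inv (p : nat) x v (A : V -> 'M[R]_p) dA :
  (forall y, A y \in unitmx) -> mderive x v A dA ->
  exists dB, mderive x v (fun y => invmx (A y)) dB.
Proof.
move=> uA HA.
have nz : \det (A x) != 0 by move: (uA x); rewrite unitmxE unitfE.
have Hadj i j : exists d, is_derive x v ((fun y => (\adj (A y)) i j) : _ -> R^o) d.
  eexists; under eq_fun do rewrite mxE.
  apply: is_deriveZ; apply: is_derive_det => k l.
  under eq_fun do rewrite !mxE.
  instantiate (1 := row' j (col' i dA)); rewrite !mxE; exact: HA.
exists (\matrix_(i, j) 'D_v ((fun y => invmx (A y) i j) : _ -> R^o) x) => i j.
rewrite mxE; apply: derivableP.
have -> : (fun y => invmx (A y) i j) = (fun y => (\det (A y))^-1 * (\adj (A y)) i j).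
  by apply/funext => y; rewrite /invmx uA mxE.
have [d [Hd _]] := Hadj i j.
apply: derivableM => //; apply: derivableV => //.
by have [] := is_derive_det HA.
Qed.

Lemma mderive_inv (p : nat) x v (A : V -> 'M[R]_p) dA :
  (forall y, A y \in unitmx) -> mderive x v A dA ->
  mderive x v (fun y => invmx (A y)) (- (invmx (A x) *m dA *m invmx (A x))).
Proof.
move=> uA HA; have [dB HB] := derivable_inv uA HA.
suff -> : - (invmx (A x) *m dA *m invmx (A x)) = dB by [].
have := mderive_mul HA HB.
under [X in mderive _ _ X]eq_fun do rewrite mulmxV//.
move=> /mderive_unique/(_ (mderive_cst _ _ _))/eqP.
rewrite addr_eq0 => /eqP E; rewrite -mulmxA E mulmxN opprK.
by rewrite mulKmx.
Qed.

End MatrixDerivative.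

(** * The algebra of third derivatives *)

Section MetrisedAlgebra.
Context {R : realType} {n : nat}.
Implicit Types (H : 'M[R]_n) (u v w : 'rV[R]_n).

Definition form H u v : R := (u *m H *m v^T) 0 0.

(* For the Hessian of F, [met_lie] is the symmetry of the fifth derivative in its
   first two arguments, and [met_trace] the constancy of the Hessian determinant. *)
Record metrised H (mul : 'rV[R]_n -> 'rV[R]_n -> 'rV[R]_n) : Prop := Metrised {
  met_sym : H^T = H;
  met_unit : H \in unitmx;
  met_comm : commutative mul;
  met_linear : forall u, linear (mul u);
  met_inv : forall u v w, form H (mul u v) w = form H u (mul v w);
  met_lie : forall v w a b c,
    form H (mul v a) (mul w (mul b c)) + form H (mul v b) (mul w (mul a c))
      + form H (mul v c) (mul w (mul a b))
    = form H (mul w a) (mul v (mul b c)) + form H (mul w b) (mul v (mul a c))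
      + form H (mul w c) (mul v (mul a b));
  met_trace : forall u, \tr (lin1_mx (mul u)) = 0
}.

Lemma formDl H u v w : form H (u + v) w = form H u w + form H v w.
Proof. by rewrite /form !mulmxDl mxE. Qed.

Lemma formDr H u v w : form H u (v + w) = form H u v + form H u w.
Proof. by rewrite /form linearD mulmxDr mxE. Qed.

Lemma formZl H (a : R) u v : form H (a *: u) v = a * form H u v.
Proof. by rewrite /form -!scalemxAl mxE. Qed.

Lemma formZr H (a : R) u v : form H u (a *: v) = a * form H u v.
Proof. by rewrite /form linearZ /= -scalemxAr mxE. Qed.

Lemma formC H u v : H^T = H -> form H u v = form H v u.
Proof.
by move=> sH; rewrite /form -[u *m H *m _]trmxK [LHS]mxE !trmx_mul trmxK sH mulmxA.
Qed.

End MetrisedAlgebra.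

(** * The Hessian, its derivatives, and the product they define *)

Section Hessian.
Context {R : realType} {n : nat}.
Variable F : 'rV[R]_n -> R.
Hypothesis sF : smooth F.
Implicit Types (u v w a b c x : 'rV[R]_n).

Local Notation e i := (delta_mx 0 i : 'rV[R]_n).

Definition hess x : 'M[R]_n := \matrix_(i, j) dd (e i) (dd (e j) F) x.
Definition hess3 u x : 'M[R]_n := \matrix_(i, j) dd u (dd (e i) (dd (e j) F)) x.
Definition hessr u v x : 'rV[R]_n := \row_i dd (e i) (dd u (dd v F)) x.
Definition prod_at x u v : 'rV[R]_n := hessr u v x *m invmx (hess x).

Let sdd u : smooth (dd u F) := smooth_dd u sF.
Let sdd2 u v : smooth (dd u (dd v F)) := smooth_dd u (sdd v).
Let sdd3 u v w : smooth (dd u (dd v (dd w F))) := smooth_dd u (sdd2 v w).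

Lemma ddCf u v G : smooth G -> dd u (dd v G) = dd v (dd u G).
Proof. by move=> sG; apply/funext => x; exact: ddC. Qed.

Lemma hess_sym x : (hess x)^T = hess x.
Proof. by apply/matrixP => i j; rewrite !mxE (ddC (e i) (e j) x sF). Qed.

Lemma hess3_sym u x : (hess3 u x)^T = hess3 u x.
Proof. by apply/matrixP => i j; rewrite !mxE (ddCf (e i) (e j) sF). Qed.

Lemma hessrC u v x : hessr u v x = hessr v u x.
Proof. by apply/rowP => i; rewrite !mxE (ddCf u v sF). Qed.

Lemma hessE u v x : form (hess x) u v = dd u (dd v F) x.
Proof.
rewrite /form -mulmxA mxE dd_basis//; apply: eq_bigr => i _; congr (_ * _).
rewrite mxE ddC// dd_basis//; apply: eq_bigr => j _.
by rewrite !mxE mulrC ddC.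
Qed.

Lemma hess3E u v w x : form (hess3 u x) v w = dd u (dd v (dd w F)) x.
Proof.
have D (G : 'rV[R]_n -> R) : smooth G -> forall p, dd p G x = \sum_i p 0 i * dd (e i) G x.
  by move=> sG p; rewrite dd_basis.
rewrite /form -mulmxA mxE (ddC _ _ _ (sdd _)) D//; apply: eq_bigr => i _; congr (_ * _).
rewrite mxE (ddC _ _ _ (sdd _)) (ddCf (e i))// (ddC _ _ _ (sdd _)) D//; apply: eq_bigr => j _.
by rewrite !mxE mulrC (ddC (e j) u x (sdd _)) (ddCf (e j) (e i) sF).
Qed.

Lemma hessrE u v w x : (hessr u v x *m w^T) 0 0 = dd w (dd u (dd v F)) x.
Proof.
rewrite mxE dd_basis//; apply: eq_bigr => i _; by rewrite !mxE mulrC.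
Qed.

Lemma hessr_mul u v x : hessr u v x = v *m hess3 u x.
Proof.
apply/rowP => i; have := hess3E u v (e i) x; rewrite /form trmx_delta -colE mxE => ->.
by rewrite mxE (ddC (e i) u x (sdd v)) (ddCf (e i) v sF).
Qed.

Lemma hess_derive v x : mderive x v hess (hess3 v x).
Proof.
move=> i j; under eq_fun do rewrite mxE.
by rewrite mxE; apply: (smooth_is_derive v x (sdd2 _ _)).
Qed.

Definition hess4 u v x : 'M[R]_n :=
  \matrix_(i, j) dd u (dd v (dd (e i) (dd (e j) F))) x.

Lemma hess4E u v w z x : form (hess4 u v x) w z = dd u (dd v (dd w (dd z F))) x.
Proof.
have D (G : 'rV[R]_n -> R) : smooth G -> forall p, dd p G x = \sum_i p 0 i * dd (e i) G x.
  by move=> sG p; rewrite dd_basis.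
have perm a b : dd u (dd v (dd a (dd b F))) x = dd a (dd u (dd v (dd b F))) x.
  by rewrite (ddCf v a (sdd b)) (ddC u a x (sdd2 v b)).
rewrite /form -mulmxA mxE perm D//; apply: eq_bigr => i _; congr (_ * _).
rewrite mxE -perm (ddCf (e i) z sF) perm D//; apply: eq_bigr => j _.
by rewrite !mxE mulrC -perm (ddCf (e j) (e i) sF).
Qed.

Lemma hess3_derive u v x : mderive x v (hess3 u) (hess4 v u x).
Proof.
move=> i j; under eq_fun do rewrite mxE.
by rewrite mxE; apply: (smooth_is_derive v x (sdd3 _ _ _)).
Qed.

Definition hessr4 u v w x : 'rV[R]_n := \row_i dd (e i) (dd u (dd v (dd w F))) x.

Lemma hessr4E u v w p x : (hessr4 u v w x *m p^T) 0 0 = dd p (dd u (dd v (dd w F))) x.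
Proof.
by rewrite mxE dd_basis//; apply: eq_bigr => i _; rewrite !mxE mulrC.
Qed.

Lemma hessr_derive a b v x : mderive x v (hessr a b) (hessr4 v a b x).
Proof.
move=> i j; under eq_fun do rewrite mxE.
rewrite mxE (ddC _ _ _ (sdd2 _ _)); apply: (smooth_is_derive v x (sdd3 _ _ _)).
Qed.

End Hessian.

Lemma linear_basis_ext (R : realType) (n : nat) (f g : 'rV[R]_n -> R) :
  (forall a u v, f (a *: u + v) = a * f u + f v) ->
  (forall a u v, g (a *: u + v) = a * g u + g v) ->
  (forall i, f (delta_mx 0 i) = g (delta_mx 0 i)) -> f =1 g.
Proof.
have exp (h : 'rV[R]_n -> R) : (forall a u v, h (a *: u + v) = a * h u + h v) ->
    forall u, h u = \sum_i u 0 i * h (delta_mx 0 i).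
  move=> hl u; rewrite {1}[u]row_sum_delta.
  have h0 : h 0 = 0 by have := hl 1 0 0; rewrite scale1r addr0 mul1r; lra.
  elim: (index_enum _) => [|i r IH]; first by rewrite !big_nil.
  by rewrite !big_cons hl IH.
by move=> lf lg E u; rewrite (exp f)// (exp g)//; apply: eq_bigr => i _; rewrite E.
Qed.

(** Linearity in the first argument is enough, since the transpositions bring each argument to the
    front in turn. It carries the equation for the fourth derivative from the coordinate frame to
    all vectors. *)
Lemma symmetric4_basis_ext (R : realType) (n : nat)
    (f g : 'rV[R]_n -> 'rV[R]_n -> 'rV[R]_n -> 'rV[R]_n -> R) :
  let multi h := [/\ (forall v w z a s t,
      h (a *: s + t) v w z = a * h s v w z + h t v w z :> R),
    (forall u v w z, h u v w z = h v u w z), (forall u v w z, h u v w z = h u w v z)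
    & (forall u v w z, h u v w z = h u v z w)] in
  multi f -> multi g ->
  (forall i j k l, f (delta_mx 0 i) (delta_mx 0 j) (delta_mx 0 k) (delta_mx 0 l)
                 = g (delta_mx 0 i) (delta_mx 0 j) (delta_mx 0 k) (delta_mx 0 l)) ->
  forall u v w z, f u v w z = g u v w z.
Proof.
move=> multi [f1 f12 f23 f34] [g1 g12 g23 g34] E u v w z.
move: u; apply: linear_basis_ext => [a s t|a s t|i]; [exact: f1|exact: g1|].
rewrite f12 g12.
move: v; apply: linear_basis_ext => [a s t|a s t|j]; [exact: f1|exact: g1|].
rewrite f23 f12 g23 g12.
move: w; apply: linear_basis_ext => [a s t|a s t|k]; [exact: f1|exact: g1|].
rewrite f34 f23 f12 g34 g23 g12.
by move: z; apply: linear_basis_ext => [a s t|a s t|l]; [exact: f1|exact: g1|].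
Qed.

(** * From a parallel cubic form to the algebraic identities *)

Section ParallelCubicForm.
Context {R : realType} {n : nat}.
Variable F : 'rV[R]_n -> R.
Implicit Types (u v w a b c d p x : 'rV[R]_n).

Local Notation e i := (delta_mx 0 i : 'rV[R]_n).
Local Notation "<< u , v >>_ x" := (form (hess F x) u v) (format "<< u ,  v >>_ x").
Local Notation mul x := (prod_at F x).

Hypothesis sF : smooth F.
Hypothesis uH : forall x, hess F x \in unitmx.
Hypothesis pde : forall x l i j k,
  dd (e l) (dd (e i) (dd (e j) (dd (e k) F))) x
  = 2^-1 * (<<mul x (e l) (e i), mul x (e j) (e k)>>_x
          + <<mul x (e l) (e j), mul x (e i) (e k)>>_x
          + <<mul x (e l) (e k), mul x (e i) (e j)>>_x).

Let sdd u : smooth (dd u F) := smooth_dd u sF.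
Let sdd2 u v : smooth (dd u (dd v F)) := smooth_dd u (sdd v).
Let sdd3 u v w : smooth (dd u (dd v (dd w F))) := smooth_dd u (sdd2 v w).

Lemma prod_atC x u v : mul x u v = mul x v u.
Proof. by rewrite /prod_at hessrC. Qed.

Lemma prod_at_linear x u : linear (mul x u).
Proof.
by move=> a v w; rewrite /prod_at !hessr_mul// mulmxDl -scalemxAl mulmxDl -scalemxAl.
Qed.

Lemma prod_at_linearl x v (k : R) u w : mul x (k *: u + w) v = k *: mul x u v + mul x w v.
Proof. by rewrite 3!(prod_atC x _ v) prod_at_linear. Qed.

Lemma form_hessC x u v : <<u, v>>_x = <<v, u>>_x.
Proof. by apply: formC; exact: hess_sym. Qed.

Lemma form_prod x u v w : <<mul x u v, w>>_x = dd w (dd u (dd v F)) x.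
Proof. by rewrite /form /prod_at mulmxKV// hessrE. Qed.

Lemma form_prodr x u v w : <<u, mul x v w>>_x = dd u (dd v (dd w F)) x.
Proof. by rewrite form_hessC form_prod. Qed.

Lemma pde_vec x u v w z :
  dd u (dd v (dd w (dd z F))) x
  = 2^-1 * (<<mul x u v, mul x w z>>_x + <<mul x u w, mul x v z>>_x
          + <<mul x u z, mul x v w>>_x).
Proof.
pose f u v w z := dd u (dd v (dd w (dd z F))) x.
pose g u v w z := 2^-1 * (<<mul x u v, mul x w z>>_x + <<mul x u w, mul x v z>>_x
          + <<mul x u z, mul x v w>>_x).
apply: (@symmetric4_basis_ext _ _ f g); last exact: pde.
  split=> [v' w' z' a s t|u' v' w' z'|u' v' w' z'|u' v' w' z'].
  - exact: ddDl.
  - exact: ddC.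
  - by rewrite /f (ddCf v').
  - by rewrite /f (ddCf w').
split=> [v' w' z' a s t|u' v' w' z'|u' v' w' z'|u' v' w' z']; rewrite /g.
- by rewrite !prod_at_linearl !formDl !formZl; ring.
- rewrite (prod_atC x u' v') (form_hessC x (mul x v' w')) (form_hessC x (mul x v' z')); ring.
- by rewrite (prod_atC x v' w'); ring.
- by rewrite (prod_atC x w' z'); ring.
Qed.

Definition form5 x u v w a b : R := <<mul x u v, mul x w (mul x a b)>>_x.

(** The pairing is [r K s^T] with [K] the inverse Hessian and [r], [s] rows of third derivatives.
    The rows contribute the two fourth derivatives, and the derivative of [K] the negative third
    one. *)
Lemma form_prod_derive x v a b c d :
  is_derive x v ((fun y => <<mul y a b, mul y c d>>_y) : _ -> R^o)
    (dd v (dd (mul x c d) (dd a (dd b F))) x + dd v (dd (mul x a b) (dd c (dd d F))) x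
     - dd v (dd (mul x a b) (dd (mul x c d) F)) x).
Proof.
have -> : (fun y => <<mul y a b, mul y c d>>_y)
    = fun y => (hessr F a b y *m invmx (hess F y) *m (hessr F c d y)^T) 0 0.
  apply/funext => y; rewrite /form /prod_at mulmxKV// trmx_mul trmx_inv.
  by rewrite hess_sym// mulmxA.
have hd a' b' := hessr_derive sF a' b' v x.
have D := mderive_mul (mderive_mul (hd a b) (mderive_inv uH (hess_derive sF v x)))
  (mderive_tr (hd c d)).
apply: (is_derive_eq (D 0 0)).
have tr_prod u' w' : (mul x u' w')^T = invmx (hess F x) *m (hessr F u' w' x)^T.
  by rewrite /prod_at trmx_mul trmx_inv hess_sym.
have row_trace (r s : 'rV[R]_n) : (r *m s^T) 0 0 = (s *m r^T) 0 0.
  by rewrite -[s *m r^T]trmxK trmx_mul trmxK [RHS]mxE.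
rewrite mxE mulmxDl mxE -[_ *m invmx _ *m (hessr F c d x)^T]mulmxA -tr_prod.
rewrite (hessr4E sF v a b (mul x c d) x).
rewrite -/(prod_at F x a b) (row_trace (mul x a b)) (hessr4E sF v c d (mul x a b) x) addrAC.
rewrite (ddC v _ _ (sdd2 _ _)) (ddC v (mul x a b) _ (sdd2 _ _)); congr (_ + _).
rewrite mulmxN mulNmx mxE -hess3E// /form; congr (- _).
by rewrite tr_prod /prod_at !mulmxA.
Qed.

(** The two fourth derivatives expand into six terms with factor 1/2. Two of them are equal and
    cancel the negative third derivative; the other four remain. *)
Lemma dd_form_prod x v w a b c :
  is_derive x v ((fun y => <<mul y w a, mul y b c>>_y) : _ -> R^o)
    (2^-1 * (form5 x v w a b c + form5 x v a w b c
           + form5 x v b c w a + form5 x v c b w a)).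
Proof.
apply: (is_derive_eq (form_prod_derive x v w a b c)).
rewrite !pde_vec /form5.
rewrite (form_hessC x (mul x v (mul x b c))).
have E1 : dd v (dd (mul x w a) (dd (mul x b c) F)) x
    = <<mul x b c, mul x v (mul x w a)>>_x.
  by rewrite form_prodr (ddCf (mul x w a) _ sF) (ddC v _ _ (sdd _)).
have E2 : <<mul x w a, mul x v (mul x b c)>>_x = <<mul x b c, mul x v (mul x w a)>>_x.
  by rewrite -E1 form_prodr (ddC (mul x w a) _ _ (sdd _)).
rewrite E1 E2 (form_hessC x (mul x v (mul x w a)) (mul x b c)).
rewrite (prod_atC x (mul x b c) a) (prod_atC x (mul x b c) w).
rewrite (prod_atC x (mul x w a) b) (prod_atC x (mul x w a) c); lra.
Qed.

(** A term [h(pq, r(st))] is determined by its middle argument [r] and a pairing of the other four,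
    hence there are fifteen of them. The sum contains once each of the twelve whose middle argument
    is not [v], the last direction of differentiation. *)
Lemma dd5 x v w a b c :
  dd v (dd w (dd a (dd b (dd c F)))) x
  = 4^-1 * (form5 x v w a b c + form5 x v a w b c + form5 x v b c w a + form5 x v c b w a
          + (form5 x v w b a c + form5 x v b w a c + form5 x v a c w b + form5 x v c a w b)
          + (form5 x v w c a b + form5 x v c w a b + form5 x v a b w c + form5 x v b a w c)).
Proof.
have E : dd w (dd a (dd b (dd c F))) = fun y => 2^-1 *
    (<<mul y w a, mul y b c>>_y + <<mul y w b, mul y a c>>_y + <<mul y w c, mul y a b>>_y).
  by apply/funext => y; exact: pde_vec.
rewrite ddE E.
have D := is_deriveZ 2^-1 (is_deriveD (is_deriveD (dd_form_prod x v w a b c)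
  (dd_form_prod x v w b a c)) (dd_form_prod x v w c a b)).
have [_ ->] := D.
rewrite /GRing.scale /=.
lra.
Qed.

Hypothesis hdet : forall x, \det (hess F x) ^+ 2 = \det (hess F 0) ^+ 2.

(** Jacobi's formula for the constant squared determinant. The square appears because the
    normalisation of the affine normal fixes the Hessian determinant only up to sign. *)
Lemma trace_hess3 x u : \tr (hess3 F u x *m invmx (hess F x)) = 0.
Proof.
have D := is_derive_det (hess_derive sF u x).
have [_ E] := is_derive_mul D D.
have := is_derive_cst (\det (hess F 0) ^+ 2 : R^o) x u.
rewrite (_ : cst _ = fun y => \det (hess F y) * \det (hess F y)); last first.
  by apply/funext => y; rewrite -expr2 hdet.
move=> [_]; rewrite E => /eqP; rewrite [_ * \det _]mulrC -mulrDr mulf_eq0.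
have nz : \det (hess F x) != 0 by move: (uH x); rewrite unitmxE unitfE.
rewrite (negbTE nz) /= -mulr2n mulrn_eq0 /= => /eqP t0.
by rewrite /invmx uH -scalemxAr mxtraceZ t0 mulr0.
Qed.

Lemma metrised_prod_at x : metrised (hess F x) (mul x).
Proof.
split=> [||u v|u|u v w|v w a b c|u].
- exact: hess_sym.
- exact: uH.
- exact: prod_atC.
- exact: prod_at_linear.
- by rewrite form_prod form_prodr (ddC w u _ (sdd _)) (ddCf w v sF).
- have S1 p q r s t : form5 x p q r s t = form5 x q p r s t.
    by rewrite /form5 (prod_atC x p).
  (* The nine terms with [a], [b] or [c] in the middle agree on both sides up to [S1] and [S2]. What
     is left is three terms with [w] in the middle against three with [v], which is [met_lie]. *)
  have E := ddC v w x (sdd3 a b c); rewrite !dd5 in E.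
  rewrite -/(form5 x v a w b c) -/(form5 x v b w a c) -/(form5 x v c w a b).
  rewrite -/(form5 x w a v b c) -/(form5 x w b v a c) -/(form5 x w c v a b).
  have S2 p q r s t : form5 x p q r s t = form5 x s t r p q.
    rewrite /form5 2!form_prodr (ddC (mul x p q) r _ (sdd _)).
    by rewrite (ddCf (mul x p q) _ sF) (ddC r _ _ (sdd _)).
  move: E; rewrite !(S1 w v) (S2 w b c v a) (S2 w a c v b) (S2 w a b v c).
  rewrite (S2 w c b v a) (S2 w c a v b) (S2 w b a v c).
  lra.
- rewrite -(trace_hess3 x u); congr (\tr _); apply/matrixP => i j.
  by rewrite mxE /prod_at hessr_mul// -mulmxA -rowE [LHS]mxE.
Qed.

End ParallelCubicForm.

(** * Nilpotency in metrised algebras *)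

(** A full rank factorisation [P = C B] of an idempotent satisfies [B C = 1], and the trace is
    cyclic. *)
Lemma mxtrace_idempotent (K : fieldType) (n : nat) (P : 'M[K]_n) :
  P *m P = P -> \tr P = (\rank P)%:R.
Proof.
move=> PP; have E : row_base P *m col_base P = 1%:M.
  apply: (row_free_inj (row_base_free P)).
  apply: (row_full_inj (col_base_full P)).
  rewrite mul1mx mulmx_base -(mulmxA (row_base P)) mulmx_base.
  by rewrite (mulmxA (col_base P)) mulmx_base PP.
by rewrite -{1}(mulmx_base P) mxtrace_mulC E mxtrace1.
Qed.

Section MetrisedTheory.
Context {R : realType} {m : nat}.
Local Notation n := m.+1.
Variables (H : 'M[R]_n) (mul : 'rV[R]_n -> 'rV[R]_n -> 'rV[R]_n).
Hypothesis M : metrised H mul.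
Implicit Types (u v w x y z p q : 'rV[R]_n).

Local Notation "u ** v" := (mul u v) (at level 40, left associativity).
Local Notation "<< u , v >>" := (form H u v).

Lemma form_sym u v : <<u, v>> = <<v, u>>.
Proof. exact/formC/met_sym/M. Qed.

Lemma form_nondeg u v : (forall p, <<p, u>> = <<p, v>>) -> u = v.
Proof.
move=> E; have : H *m u^T = H *m v^T.
  apply/colP => i; have := E (delta_mx 0 i); rewrite /form -!mulmxA -!rowE.
  by rewrite mxE [RHS]mxE.
by move=> /(can_inj (mulKmx (met_unit M)))/trmx_inj.
Qed.

Lemma prodC u v : u ** v = v ** u. Proof. exact: met_comm M u v. Qed.

Lemma prodDr u v w : u ** (v + w) = u ** v + u ** w.
Proof. by have := met_linear M u 1 v w; rewrite !scale1r. Qed.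

Lemma prod0r u : u ** 0 = 0.
Proof. by apply: (@addIr _ (u ** 0)); rewrite -prodDr !add0r. Qed.

Lemma prodZr u (a : R) v : u ** (a *: v) = a *: (u ** v).
Proof. by have := met_linear M u a v 0; rewrite prod0r !addr0. Qed.

Lemma prodDl u v w : (u + v) ** w = u ** w + v ** w.
Proof. by rewrite !(prodC _ w) prodDr. Qed.

Lemma prodZl (a : R) u v : (a *: u) ** v = a *: (u ** v).
Proof. by rewrite !(prodC _ v) prodZr. Qed.

Lemma prod0l u : 0 ** u = 0. Proof. by rewrite prodC prod0r. Qed.

Lemma prodNr u v : u ** (- v) = - (u ** v).
Proof. by rewrite -scaleN1r prodZr scaleN1r. Qed.

Lemma prodNl u v : (- u) ** v = - (u ** v).
Proof. by rewrite !(prodC _ v) prodNr. Qed.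

Lemma form_inv u v w : <<u ** v, w>> = <<u, v ** w>>.
Proof. exact: met_inv M u v w. Qed.

Lemma form_adj u v w : <<u, v ** w>> = <<v ** u, w>>.
Proof. by rewrite -form_inv prodC. Qed.

(** This is [met_lie] at [p, x, x, y, q], with [p] moved to one side by invariance and removed by
    non-degeneracy. *)
Lemma quad_identity x y q :
  x ** (x ** (y ** q)) + y ** (x ** (x ** q)) + (x ** (x ** y)) ** q
  = (x ** x) ** (y ** q) + 2 *: ((x ** y) ** (x ** q)).
Proof.
apply: form_nondeg => p.
have sw a b : <<a, p ** b>> = <<p, a ** b>> by rewrite form_adj form_inv.
have := met_lie M p x x y q.
rewrite !sw (form_inv p x) (form_inv p y) (form_inv p q) (prodC q) (prodC (x ** q)).
by rewrite !formDr formZr => ->; ring.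
Qed.

(** As operators, [2 L_x^3 + L_(x^3) = 3 L_(x^2) L_x]: it governs the spectrum of idempotents, the
    nilpotency of [L_x] and the algebras with vanishing cubes. *)
Lemma cube_identity x z :
  2 *: (x ** (x ** (x ** z))) + (x ** (x ** x)) ** z = 3 *: ((x ** x) ** (x ** z)).
Proof.
have := quad_identity x x z.
rewrite -[X in _ = X + _]scale1r -scalerDl -[X in X + X]scale1r -scalerDl => E.
by rewrite -[1 + 1]/(2 : R) in E; rewrite E; congr (_ *: _); ring.
Qed.

(** The Jordan identity. By [cube_identity] the operator [L_(x^2) L_x] is a combination of
    self-adjoint operators, hence self-adjoint; as both factors are self-adjoint, they commute. *)
Lemma square_comm x z : x ** ((x ** x) ** z) = (x ** x) ** (x ** z).
Proof.
apply: (scalerI (_ : 3 != 0 :> R)); first by rewrite pnatr_eq0.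
apply: form_nondeg => p.
rewrite formZr (form_adj p x) (form_adj (x ** p)) -formZl -!cube_identity.
rewrite formDl formZl formDr formZr (form_adj p x) (form_adj (x ** p) x).
by rewrite (form_adj (x ** (x ** p))) (form_adj p).
Qed.

Definition Lmx u : 'M[R]_n := lin1_mx (mul u).

Lemma mul_Lmx u v : v *m Lmx u = u ** v.
Proof.
have lu : linear (mul u) by exact: met_linear M u.
pose f : {linear 'rV[R]_n -> 'rV[R]_n} :=
  HB.pack (mul u) (GRing.isLinear.Build _ _ _ _ _ lu).
exact: (mul_rV_lin1 f).
Qed.

Lemma Lmx_ext u (A : 'M[R]_n) : (forall v, u ** v = v *m A) -> Lmx u = A.
Proof.
by move=> E; apply/row_matrixP => i; rewrite !rowE mul_Lmx E.
Qed.

Lemma LmxD u v : Lmx (u + v) = Lmx u + Lmx v.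
Proof. by apply: Lmx_ext => w; rewrite prodDl mulmxDr !mul_Lmx. Qed.

Lemma LmxZ a u : Lmx (a *: u) = a *: Lmx u.
Proof. by apply: Lmx_ext => w; rewrite prodZl -scalemxAr mul_Lmx. Qed.

Lemma Lmx0 : Lmx 0 = 0.
Proof. by apply: Lmx_ext => w; rewrite prod0l mulmx0. Qed.

Lemma Lmx_sum I (r : seq I) (P : pred I) (f : I -> 'rV[R]_n) :
  Lmx (\sum_(i <- r | P i) f i) = \sum_(i <- r | P i) Lmx (f i).
Proof. exact: (big_morph _ LmxD Lmx0). Qed.

Lemma Lmx_trace u : \tr (Lmx u) = 0.
Proof. exact: met_trace M u. Qed.

(* The power x^(k+1). *)
Definition pw x k := x *m (Lmx x) ^+ k.

Lemma pwS x k : pw x k.+1 = x ** pw x k.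
Proof. by rewrite /pw exprSr -mul_Lmx mulmxA. Qed.

Lemma pw0 x : pw x 0 = x.
Proof. by rewrite /pw expr0 mulmx1. Qed.

(** Induction over two consecutive powers: [quad_identity] with [y := pw x j] writes multiplication
    by [pw x j.+2] as a polynomial in the multiplications by [x], [x ** x], [pw x j] and
    [pw x j.+1]. *)
Lemma pw_comm x k : comm_mx (Lmx (pw x k)) (Lmx x) /\ comm_mx (Lmx (pw x k)) (Lmx (x ** x)).
Proof.
have TL : comm_mx (Lmx (x ** x)) (Lmx x).
  apply/row_matrixP => i; rewrite !rowE !mulmxA !mul_Lmx.
  exact: square_comm.
suff: forall k, (comm_mx (Lmx (pw x k)) (Lmx x) /\ comm_mx (Lmx (pw x k)) (Lmx (x ** x)))
    /\ (comm_mx (Lmx (pw x k.+1)) (Lmx x) /\ comm_mx (Lmx (pw x k.+1)) (Lmx (x ** x))).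
  by move=> /(_ k)[].
elim=> [|j [IH1 IH2]].
  rewrite pwS pw0; have L := comm_mx_sym TL.
  by split; split; rewrite ?TL ?L //; exact: comm_mx_refl.
split=> //.
have -> : Lmx (pw x j.+2) = Lmx (pw x j) *m Lmx (x ** x)
    + (Lmx x *m Lmx (pw x j.+1) + Lmx x *m Lmx (pw x j.+1))
    - Lmx (pw x j) *m Lmx x *m Lmx x - Lmx x *m Lmx x *m Lmx (pw x j).
  apply: Lmx_ext => q.
  rewrite !mulmxBr !mulmxDr !mulmxA !mul_Lmx !pwS -mulr2n -scaler_nat.
  rewrite -quad_identity; apply/esym/eqP.
  by rewrite subr_eq subr_eq; apply/eqP; rewrite addrC addrA addrAC.
have [[c1 c2] [d1 d2]] := (IH1, IH2).
have cpoly A : comm_mx A (Lmx x) -> comm_mx A (Lmx (x ** x)) ->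
    comm_mx A (Lmx (pw x j)) -> comm_mx A (Lmx (pw x j.+1)) ->
    comm_mx A (Lmx (pw x j) *m Lmx (x ** x)
    + (Lmx x *m Lmx (pw x j.+1) + Lmx x *m Lmx (pw x j.+1))
    - Lmx (pw x j) *m Lmx x *m Lmx x - Lmx x *m Lmx x *m Lmx (pw x j)).
  move=> a1 a2 a3 a4.
  by apply: comm_mxB; [apply: comm_mxB; [apply: comm_mxD; [|apply: comm_mxD]|]|];
    repeat (apply: comm_mxM).
by split; apply/comm_mx_sym/cpoly; first [exact: comm_mx_refl|exact: TL
  |exact: comm_mx_sym TL|exact: comm_mx_sym c1|exact: comm_mx_sym c2
  |exact: comm_mx_sym d1|exact: comm_mx_sym d2].
Qed.

Lemma pwM x j k : pw x j ** pw x k = pw x (j + k).+1.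
Proof.
elim: k => [|k IH]; first by rewrite pw0 prodC -pwS addn0.
have /(congr1 (mulmx (pw x k))) := (pw_comm x j).1.
by rewrite !mulmxA !mul_Lmx -!pwS IH -pwS addnS.
Qed.

(** The value at [x] of the polynomial ['X * r]: the algebra has no unit, so only polynomials
    without constant term can be evaluated. This explains the extra ['X] in [evpM]. *)
Definition evp x (r : {poly R}) := x *m horner_mx (Lmx x) r.

Lemma evpE x r : evp x r = \sum_(i < size r) r`_i *: pw x i.
Proof.
rewrite /evp -{1}[r]coefK poly_def rmorph_sum mulmx_sumr; apply: eq_bigr => i _.
by rewrite /= horner_mxZ rmorphXn /= horner_mx_X -scalemxAr.
Qed.

Lemma evp_comm x r : comm_mx (Lmx (evp x r)) (Lmx x).
Proof.
rewrite evpE Lmx_sum; apply/comm_mx_sym/comm_mx_sum => i _.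
by rewrite LmxZ /comm_mx -scalemxAl -scalemxAr (pw_comm x i).1.
Qed.

Lemma evpM x r s : evp x r ** evp x s = evp x (r * 'X * s).
Proof.
have c : comm_mx (Lmx (evp x r)) (horner_mx (Lmx x) s).
  exact/comm_mx_horner/evp_comm.
rewrite -mul_Lmx [X in X *m Lmx (evp x r)]/evp -mulmxA -c mulmxA mul_Lmx prodC -mul_Lmx.
by rewrite /evp !rmorphM /= horner_mx_X -!mulmxE !mulmxA.
Qed.

(* L_u is annihilated by X (2 X - 1) (X - 1), and r and s evaluate at L_u to the
   projectors onto its eigenspaces for 1 and 1/2: so the trace of L_u is the sum of
   the rank of the former and half the rank of the latter. *)
Lemma idempotent_eq0 u : u ** u = u -> u = 0.
Proof.
move=> uu; pose L := Lmx u; pose r : {poly R} := 2 *: 'X^2 - 'X; pose s : {poly R} := 4 *: ('X - 'X^2).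
have L0 : horner_mx L (2 *: 'X^3 - 3 *: 'X^2 + 'X) = 0.
  apply/row_matrixP => i; rewrite !rowE mulmx0; move: (delta_mx 0 i) => z.
  have := cube_identity u z; rewrite !uu => E.
  rewrite rmorphD rmorphB /= !horner_mxZ !rmorphXn /= horner_mx_X.
  rewrite mulmxDr mulmxBr -!scalemxAr !exprS expr0 mulr1 -!mulmxE !mulmxA !mul_Lmx -E.
  by rewrite opprD addNKr addrC subrr.
have idem (p c : {poly R}) : p * p - p = c * (2 *: 'X^3 - 3 *: 'X^2 + 'X) ->
    horner_mx L p *m horner_mx L p = horner_mx L p.
  move=> E; apply/eqP; rewrite -subr_eq0 mulmxE -rmorphM -rmorphB E rmorphM.
  by rewrite /= L0 mulr0.
have Ir : r * r - r = (2 *: 'X + 1) * (2 *: 'X^3 - 3 *: 'X^2 + 'X).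
  rewrite /r -!mul_polyC; ring.
have Is : s * s - s = (8 *: 'X - 4%:P) * (2 *: 'X^3 - 3 *: 'X^2 + 'X).
  rewrite /s -!mul_polyC; ring.
have Pr := idem _ _ Ir; have Ps := idem _ _ Is.
have tr0 : \tr (horner_mx L r) + 2^-1 * \tr (horner_mx L s) = 0.
  rewrite -(Lmx_trace u) -mxtraceZ -mxtraceD; congr (\tr _).
  rewrite -horner_mxZ -rmorphD /= -[RHS]horner_mx_X; congr (horner_mx L _).
  rewrite /r /s scalerA (_ : 2^-1 * 4 = 2 :> R); last by field.
  by rewrite -!mul_polyC; ring.
move: tr0; rewrite !mxtrace_idempotent// => tr0.
have rr : (0 : R) <= (\rank (horner_mx L r))%:R by [].
have rs : (0 : R) <= (\rank (horner_mx L s))%:R by [].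
have /eqP : (\rank (horner_mx L r))%:R = 0 :> R by lra.
rewrite pnatr_eq0 mxrank_eq0 => /eqP r0.
(* On [u] the operator [L] is the identity, so [r] acts there as 2 - 1 = 1 and its vanishing kills
   [u]. *)
have := congr1 (mulmx u) r0; rewrite mulmx0 /r rmorphB /= horner_mxZ rmorphXn /= horner_mx_X.
rewrite mulmxBr -scalemxAr expr2 -mulmxE mulmxA !mul_Lmx !uu => /eqP.
by rewrite scaler_nat mulr2n addrK => /eqP.
Qed.

(* Fitting: write char_poly L_x = X^r g with g.[0] != 0.  A polynomial d in x with
   X d equal to 1 modulo g and to 0 modulo X^r yields an idempotent. *)
Lemma pw_eq0 x : pw x n = 0.
Proof.
pose L := Lmx x.
have [r [g g0 E]] := multiplicity_XsubC (char_poly L) 0.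
have c0 : char_poly L != 0 := monic_neq0 (char_poly_monic L).
rewrite c0 /= subr0 in g0 E.
have gn0 : g != 0 by apply: contraNneq c0 => g00; rewrite E g00 mul0r.
have rn : (r <= n)%N.
  have := size_char_poly L; rewrite E size_mulXn// => /eqP.
  by rewrite -(prednK (_ : 0 < size g)%N) ?size_poly_gt0// addnS eqSS => /eqP <-; exact: leq_addr.
pose c := g.[0].
have cn0 : c != 0 by exact: g0.
have /factor_theorem[g1 Eg] : root (g - c%:P) 0 by rewrite /root !hornerE subrr.
(* From [g = g1 * 'X + c] one gets [k * 'X = 1 - c^-1 g], so [k] inverts ['X] modulo [g]. *)
pose k := - (c^-1 *: g1).
have HL : horner_mx L ('X^r * (k * 'X)) = horner_mx L 'X^r.
  apply/eqP; rewrite -subr_eq0 -rmorphB.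
  have -> : 'X^r * (k * 'X) - 'X^r = - (c^-1)%:P * char_poly L.
    rewrite E -[g](subrK c%:P) Eg subr0 /k -mul_polyC.
    have DC : (c^-1)%:P * c%:P = 1 by rewrite -polyCM mulVf.
    apply/eqP; rewrite -subr_eq0; apply/eqP.
    rewrite -[RHS](mul0r 'X^r) -(subrr 1) -{1}DC; ring.
  by rewrite rmorphM /= Cayley_Hamilton mulr0.
have HLj j : horner_mx L ('X^r * (k * 'X) ^+ j) = horner_mx L 'X^r.
  elim: j => [|j IH]; first by rewrite expr0 mulr1.
  by rewrite exprSr (mulrA 'X^r) rmorphM /= IH -rmorphM.
pose d : {poly R} := k ^+ r.+1 * 'X^r.
have Ed : 'X * d = (k * 'X) ^+ r.+1 by rewrite /d exprMn (exprS 'X) mulrCA.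
have Hd : horner_mx L (d * 'X * d) = horner_mx L d.
  rewrite -mulrA Ed /d -mulrA rmorphM [in RHS]rmorphM /=; congr (_ * _); exact: HLj.
have /idempotent_eq0 e0 : evp x d ** evp x d = evp x d by rewrite evpM /evp Hd.
(* Multiplying ['X^r] by powers of [k * 'X] does not change its value at [L], so a factor [d] can be
   inserted, and [d] evaluates at [x] to the vanishing idempotent. *)
have xr : x *m horner_mx L 'X^r = 0.
  rewrite -(HLj r.+1) -Ed mulrA mulrC rmorphM -mulmxE mulmxA.
  by rewrite -/(evp x d) e0 mul0mx.
have pwE (j : nat) : (r <= j)%N -> pw x j = 0.
  move=> rj; rewrite /pw -(subnKC rj) exprD -mulmxE mulmxA.
  by move: xr; rewrite rmorphXn /= horner_mx_X => ->; rewrite mul0mx.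
exact: pwE.
Qed.

Lemma pw_nil x k : (n <= k)%N -> pw x k = 0.
Proof.
elim: k => [//|k IH]; rewrite leq_eqVlt => /orP[/eqP <-|]; first exact: pw_eq0.
by rewrite ltnS => /IH; rewrite pwS => ->; rewrite prod0r.
Qed.

(** By [cube_identity], [L_x^3] is a combination of [L_x L_(x^2)] and [L_(x^3)]. These commute and
    are nilpotent, so the binomial formula bounds the order of nilpotency. *)
Lemma Lmx_nil_step x j k : Lmx (x ** x) ^+ j = 0 -> Lmx (x ** (x ** x)) ^+ k = 0 ->
  exists l, Lmx x ^+ l = 0.
Proof.
have -> : x ** x = pw x 1 by rewrite pwS pw0.
rewrite -pwS => T0 N0.
have [[TL _] [NL NT]] := (pw_comm x 1, pw_comm x 2).
have E : Lmx x ^+ 3 = 2^-1 *: (3 *: (Lmx x * Lmx (pw x 1))) + (- 2^-1 *: Lmx (pw x 2)).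
  apply/row_matrixP => i; rewrite !rowE; move: (delta_mx 0 i) => z.
  rewrite mulmxDr -!scalemxAr !exprS expr0 mulr1 -!mulmxE !mulmxA !mul_Lmx !pwS pw0.
  rewrite -cube_identity scalerDr scalerA mulVf ?pnatr_eq0// scale1r scaleNr.
  by rewrite addrK.
exists (3 * (j + k))%N; rewrite exprM E.
have c1 : GRing.comm (2^-1 *: (3 *: (Lmx x * Lmx (pw x 1)))) (- 2^-1 *: Lmx (pw x 2)).
  have cZ (A B : 'M[R]_n) (a b : R) : GRing.comm A B -> GRing.comm (a *: A) (b *: B).
    by move=> AB; rewrite /GRing.comm -!scalerAl -!scalerAr AB !scalerA mulrC.
  rewrite scalerA; apply: cZ; apply/commr_sym/commrM; first exact: NL.
  by move: NT; have -> : x ** x = pw x 1 by rewrite pwS pw0.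
have nil_le (A : 'M[R]_n) a b : (a <= b)%N -> A ^+ a = 0 -> A ^+ b = 0.
  by move=> ab A0; rewrite -(subnKC ab) exprD A0 mul0r.
rewrite exprDn_comm// big1// => i _.
have [ki|ik] := leqP k i.
  by rewrite [X in _ * X *+ _]exprZn (nil_le _ _ _ ki N0) scaler0 mulr0 mul0rn.
have ji : (j <= j + k - i)%N by rewrite -addnBA ?leq_addr// ltnW.
rewrite !exprZn exprMn_comm; last exact/esym/TL.
by rewrite (nil_le _ _ _ ji T0) mulr0 !scaler0 mul0r mul0rn.
Qed.

(** Nilpotency of the multiplication spreads from elements of zero square to those of zero cube and
    then to all [x]: since [x^6 = 0], the element [x^2] has zero cube and [x^3] has zero square. *)
Lemma Lmx_nil x : (n <= 4)%N -> exists k, Lmx x ^+ k = 0.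
Proof.
move=> n4.
have step2 z : z ** z = 0 -> exists k, Lmx z ^+ k = 0.
  by move=> zz; apply: (@Lmx_nil_step z 1 1); rewrite zz ?prod0r Lmx0 expr1.
have step3 p : p ** (p ** p) = 0 -> exists k, Lmx p ^+ k = 0.
  move=> p3; have /step2[k pk] : (p ** p) ** (p ** p) = 0.
    have := pwM p 1 1; rewrite !pwS pw0 => ->.
    by rewrite p3 prod0r.
  by apply: (@Lmx_nil_step p k 1) => //; rewrite p3 Lmx0 expr1.
have pw2 : x ** x = pw x 1 by rewrite pwS pw0.
have pw3 : x ** (x ** x) = pw x 2 by rewrite pwS -pw2.
have [j Tj] : exists k, Lmx (x ** x) ^+ k = 0.
  by apply: step3; rewrite pw2 !pwM pw_nil// ltnW.
have [k Nk] : exists k, Lmx (x ** (x ** x)) ^+ k = 0.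
  by apply: step2; rewrite pw3 pwM pw_nil// ltnW.
exact: Lmx_nil_step Tj Nk.
Qed.

Lemma no_eigenvector x (a : R) u : (n <= 4)%N -> x ** u = a *: u -> u != 0 -> a = 0.
Proof.
move=> n4 xu un0; have [k Lk] := Lmx_nil x n4.
have E j : u *m Lmx x ^+ j = a ^+ j *: u.
  elim: j => [|j IH]; first by rewrite !expr0 mulmx1 scale1r.
  by rewrite exprSr -mulmxE mulmxA IH -scalemxAl mul_Lmx xu scalerA -exprSr.
have := E k; rewrite Lk mulmx0 => /esym/eqP.
by rewrite scaler_eq0 (negbTE un0) orbF expf_eq0 => /andP[_ /eqP].
Qed.

End MetrisedTheory.

(** * The Taylor polynomial *)

Section Taylor.
Context {R : realType}.

(** Taylor's formula without remainder. By induction the first derivative is a polynomial, and the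
    difference from its antiderivative has zero derivative and vanishes at 0. *)
Lemma taylor_finite (k : nat) (g : nat -> R -> R) :
  (forall i t, is_derive t (1 : R) (g i) (g i.+1 t)) -> (forall t, g k t = 0) ->
  forall t, g 0%N t = \sum_(i < k) g i 0 * (t ^+ i / i`!%:R).
Proof.
elim: k g => [|k IH] g Dg gk t; first by rewrite big_ord0.
pose p (s : R) := \sum_(i < k.+1) g i 0 * (s ^+ i / i`!%:R).
have Dp (s : R) : is_derive s (1 : R) p (g 1%N s).
  rewrite (IH (fun i => g i.+1) (fun i => Dg i.+1) gk).
  have D (i : 'I_k.+1) : is_derive s (1 : R) ((fun y => g i 0 * (y ^+ i / i`!%:R)) : R -> R)
      (g i 0 * (s ^+ i.-1 *+ i / i`!%:R)).
    have Di : is_derive s (1 : R) (@GRing.exp R ^~ i) (i%:R *: s ^+ i.-1 *: (1 : R)).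
      by split; [exact: exprn_derivable|exact: exp_derive].
    have -> : (fun y : R => g i 0 * (y ^+ i / i`!%:R)) = (g i 0 / i`!%:R) *: (@GRing.exp R ^~ i).
      by apply/funext => y; rewrite /GRing.scale /= mulrCA mulrC.
    apply: (is_derive_eq (is_deriveZ (g i 0 / i`!%:R) Di)).
    rewrite /GRing.scale /= mulr1 -mulr_natl.
    by move: (_ ^-1) (s ^+ _) => c d; ring.
  apply: (is_derive_eq (is_derive_bigsum _ _ D)).
  rewrite big_ord_recl /= mulr0n mul0r mulr0 add0r; apply: eq_bigr => i _.
  rewrite /bump /= add1n; congr (_ * _).
  by rewrite factS natrM -mulr_natr invfM mulrA mulfK// pnatr_eq0.
have := @is_derive_0_is_cst R (g 0%N - p) t 0
  (fun s => is_derive_eq (is_deriveB (Dg 0%N s) (Dp s)) (subrr _)).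
have -> : (g 0%N - p) 0 = 0.
  rewrite (_ : (g 0%N - p) 0 = g 0%N 0 - p 0)// /p big_ord_recl big1 => [|i _]; last first.
    by rewrite exprS mul0r mul0r mulr0.
  by rewrite expr0 fact0 divr1 mulr1 addr0 subrr.
by rewrite -[(_ - p) t]/(g 0%N t - p t) => /eqP; rewrite subr_eq0 => /eqP.
Qed.


Lemma taylor_smooth (n k : nat) (F : 'rV[R]_n -> R) (x u : 'rV[R]_n) : smooth F ->
  (forall y, iter k (dd u) F y = 0) ->
  F (x + u) = \sum_(i < k) iter i (dd u) F x / i`!%:R.
Proof.
move=> sF Fk.
have si i : smooth (iter i (dd u) F) by elim: i => //= i; exact: smooth_dd.
have := taylor_finite (fun i t => smooth_line u x (si i) t) (fun t => Fk (x + t *: u)) 1.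
rewrite scale1r -[iter 0 _ _ _]/(F (x + u)) => ->; apply: eq_bigr => i _.
by rewrite scale0r addr0 expr1n div1r.
Qed.

End Taylor.

(** * Vanishing of the sixth derivative on the diagonal *)

Section SixthDerivative.
Context {R : realType} {m : nat}.
Local Notation n := m.+1.
Variable F : 'rV[R]_n -> R.
Implicit Types (u v w a b c d p x : 'rV[R]_n).

Local Notation e i := (delta_mx 0 i : 'rV[R]_n).
Local Notation "<< u , v >>_ x" := (form (hess F x) u v) (format "<< u ,  v >>_ x").
Local Notation mul x := (prod_at F x).

Hypothesis sF : smooth F.
Hypothesis uH : forall x, hess F x \in unitmx.
Hypothesis pde : forall x l i j k,
  dd (e l) (dd (e i) (dd (e j) (dd (e k) F))) x
  = 2^-1 * (<<mul x (e l) (e i), mul x (e j) (e k)>>_x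
          + <<mul x (e l) (e j), mul x (e i) (e k)>>_x
          + <<mul x (e l) (e k), mul x (e i) (e j)>>_x).
Hypothesis hdet : forall x, \det (hess F x) ^+ 2 = \det (hess F 0) ^+ 2.
Hypothesis n4 : (n <= 4)%N.

Let sdd u : smooth (dd u F) := smooth_dd u sF.
Let met x := metrised_prod_at sF uH pde hdet x.

Lemma dd4_diag x u : dd u (dd u (dd u (dd u F))) x
  = 3 / 2 * <<mul x u u, mul x u u>>_x.
Proof. by rewrite (pde_vec sF pde); lra. Qed.

Lemma dd5_diag x u : dd u (dd u (dd u (dd u (dd u F)))) x
  = 3 * <<mul x u u, mul x u (mul x u u)>>_x.
Proof. by rewrite (dd5 sF uH pde) /form5; lra. Qed.

(** The fifth derivative is a product of five matrix factors. Differentiating them in turn gives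
    3/2, -1, 3/2, -1 and 3/2 times [h(u^3, u^3)], which equals [h(u, u^5)] and vanishes because
    [u^5 = 0] for n at most 4. *)
Lemma dd6_diag x u : dd u (dd u (dd u (dd u (dd u (dd u F))))) x = 0.
Proof.
pose q := mul x u u; pose r := mul x u q.
have tr_prod y : (mul y u u)^T = invmx (hess F y) *m (hessr F u u y)^T.
  by rewrite /prod_at trmx_mul trmx_inv hess_sym.
have E5 : dd u (dd u (dd u (dd u (dd u F)))) = fun y => 3 * (hessr F u u y *m invmx (hess F y)
    *m hess3 F u y *m invmx (hess F y) *m (hessr F u u y)^T) 0 0.
  apply/funext => y; rewrite dd5_diag form_prodr// (ddC _ u _ (sdd _)) -hess3E// /form.
  by rewrite tr_prod /prod_at !mulmxA.
have hc := hessr_derive sF u u u x.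
have hK := mderive_inv uH (hess_derive sF u x).
have hT := hess3_derive sF u u x.
have D := mderive_mul (mderive_mul (mderive_mul (mderive_mul hc hK) hT) hK) (mderive_tr hc).
rewrite ddE E5.
have [_ ->] := is_deriveZ 3 (D 0 0).
rewrite -/(prod_at F x u u) -/q.
have Er : q *m hess3 F u x *m invmx (hess F x) = r.
  by rewrite /r /prod_at hessr_mul.
have trK : (invmx (hess F x))^T = invmx (hess F x) by rewrite trmx_inv hess_sym.
have Er' : r^T = invmx (hess F x) *m hess3 F u x *m invmx (hess F x) *m (hessr F u u x)^T.
  by rewrite -Er /q /prod_at !trmx_mul trK hess3_sym// !mulmxA.
have add00 (A B : 'M[R]_1) : (A + B) 0 0 = A 0 0 + B 0 0 by rewrite mxE.
have tr00 (a b : 'rV[R]_n) : (a *m b^T) 0 0 = (b *m a^T) 0 0.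
  by rewrite -[b *m a^T]trmxK trmx_mul trmxK [RHS]mxE.
have rr : (q *m hess3 F u x *m r^T) 0 0 = form (hess F x) r r.
  by rewrite -Er {3}Er /form mulmxKV// Er.
have T1 : (hessr4 F u u u x *m invmx (hess F x) *m hess3 F u x *m invmx (hess F x)
    *m (hessr F u u x)^T) 0 0 = 3 / 2 * form (hess F x) r r.
  transitivity ((hessr4 F u u u x *m r^T) 0 0); first by rewrite Er' !mulmxA.
  rewrite (hessr4E sF u u u r x) (pde_vec sF pde) (prod_atC sF) -/q -/(prod_at F x u q).
  rewrite (prod_atC sF) (met_inv (met x)) -/r; lra.
have T2 : (hessr F u u x *m - (invmx (hess F x) *m hess3 F u x *m invmx (hess F x))
    *m hess3 F u x *m invmx (hess F x) *m (hessr F u u x)^T) 0 0 = - form (hess F x) r r.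
  transitivity (- (q *m hess3 F u x *m r^T) 0 0); last by rewrite rr.
  by rewrite Er' mulmxN !mulNmx mxE !mulmxA.
have T3 : (q *m hess4 F u u x *m invmx (hess F x) *m (hessr F u u x)^T) 0 0 = 3 / 2 * form (hess F x) r r.
  have -> : q *m hess4 F u u x *m invmx (hess F x) *m (hessr F u u x)^T
      = q *m hess4 F u u x *m q^T by rewrite /q tr_prod !mulmxA.
  rewrite -[LHS]/(form (hess4 F u u x) q q) hess4E// (pde_vec sF pde) -/q -/r.
  (* That is [u^2 u^2 = u (u^2 u)], read off from [cube_identity] at [z = u]. *)
  have -> : mul x q q = mul x u r.
    have := cube_identity (met x) u u; rewrite -/q -/r (prod_atC sF x r u).
    rewrite -[in LHS](scale1r (mul x u r)) scalerA mulr1 -scalerDl => E.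
    apply/esym/(scalerI (_ : 3 != 0 :> R)); first by rewrite pnatr_eq0.
    by rewrite -E; congr (_ *: _); ring.
  rewrite (form_adj (met x)) -/r; lra.
have T4 : (q *m hess3 F u x *m - (invmx (hess F x) *m hess3 F u x *m invmx (hess F x))
    *m (hessr F u u x)^T) 0 0 = - form (hess F x) r r.
  by rewrite mulmxN mulNmx mxE -rr Er' !mulmxA.
have T5 : (q *m hess3 F u x *m invmx (hess F x) *m (hessr4 F u u u x)^T) 0 0 = 3 / 2 * form (hess F x) r r.
  by rewrite Er tr00 -T1 Er' !mulmxA.
have r0 : form (hess F x) r r = 0.
  rewrite {1}/r (prod_atC sF) (met_inv (met x)) /q (met_inv (met x)).
  have := pw_nil (met x) u n4; rewrite !(pwS (met x)) pw0.
  by rewrite -/q -/r => ->; rewrite (formC _ _ (hess_sym sF x)) /form !mul0mx mxE.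
rewrite !mulmxDl !add00 -/q T2 T1 T3 T4 T5 r0 /GRing.scale /=; lra.
Qed.

End SixthDerivative.

(** * Affine invariants of graphs *)

Section LinearMaps.
Context {R : realType}.

Lemma differentiable_mulmxr (p q : nat) (B : 'M[R]_(p, q)) (x : 'rV[R]_p) :
  differentiable (fun y : 'rV[R]_p => y *m B) x.
Proof.
under eq_fun do rewrite mulmx_sum_row.
elim: (index_enum _) => [|i r IH].
  by under eq_fun do rewrite big_nil; exact: differentiable_cst.
under eq_fun do rewrite big_cons.
have D : differentiable (fun y : 'rV[R]_p => y 0 i *: row i B) x.
  by apply: differentiableZl; exact: differentiable_coord.
exact: (differentiableD D IH).
Qed.

Lemma continuous_mulmxr (p q : nat) (B : 'M[R]_(p, q)) :
  continuous (mulmxr B : 'rV[R]_p -> 'rV[R]_q).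
Proof. by move=> x; exact/differentiable_continuous/differentiable_mulmxr. Qed.

Lemma derive_mulmxr (p q : nat) (B : 'M[R]_(p, q)) (x v : 'rV[R]_p) :
  'D_v (fun y : 'rV[R]_p => y *m B) x = v *m B.
Proof.
rewrite deriveE; last exact: differentiable_mulmxr.
by rewrite (@diff_lin R _ _ (mulmxr B)) //; exact: continuous_mulmxr.
Qed.

Lemma dd_comp_mulmxr (p q : nat) (B : 'M[R]_(p, q)) (F : 'rV[R]_q -> R) v :
  smooth F -> dd v (fun y => F (y *m B)) = fun y => dd (v *m B) F (y *m B).
Proof.
move=> sF; apply/funext => y; rewrite !ddE deriveE; last first.
  apply: differentiable_comp; first exact: differentiable_mulmxr.
  exact: (@smooth_differentiable _ _ R^o).
rewrite (@diff_comp _ _ _ R^o); [|exact: differentiable_mulmxr|exact: (@smooth_differentiable _ _ R^o)].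
rewrite /= deriveE; last exact: (@smooth_differentiable _ _ R^o).
by congr ('d _ _ _); rewrite -deriveE; [exact: derive_mulmxr|exact: differentiable_mulmxr].
Qed.

Lemma smooth_comp_mulmxr (p q : nat) (B : 'M[R]_(p, q)) (F : 'rV[R]_q -> R) :
  smooth F -> smooth (fun y => F (y *m B)).
Proof.
move=> sF s x _.
suff [G sG ->] : exists2 G : 'rV[R]_q -> R, smooth G &
    foldr (fun i g => partial i g) ((fun y => F (y *m B)) : _ -> R^o) s
    = (fun y => G (y *m B)) :> (_ -> R^o).
  apply: (@differentiable_comp _ _ _ R^o); first exact: differentiable_mulmxr.
  exact: (@smooth_differentiable _ _ R^o).
elim: s => [|i s [G sG /= ->]]; first by exists F.
exists (dd (delta_mx 0 i *m B) G); first exact: smooth_dd.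
by rewrite -dd_comp_mulmxr//; apply/funext => y; rewrite /partial ddE.
Qed.

End LinearMaps.

(** * Affine geometry of a graph in terms of its function *)

Section AffineGraph.
Context {R : realType} {n : nat}.
Variables (F : 'rV[R]_n -> R) (A : 'M[R]_(n + 1)) (b : 'rV[R]_(n + 1)).

Local Notation e i := (delta_mx 0 i : 'rV[R]_n).
Local Notation f := (affine_map A b \o graph_map F).
Local Notation w := (dsubmx A).

Lemma affine_graphE : f = fun x => (F x *: w + x *m usubmx A) + b.
Proof.
apply/funext => x; rewrite /= /affine_map /graph_map -{1}[A]vsubmxK mul_row_col.
by rewrite mul_scalar_mx [_ + _ *: _]addrC.
Qed.

Lemma vertical_mul : vertical n *m A = w.
Proof. by rewrite /vertical -{1}[A]vsubmxK mul_row_col mul0mx add0r mul1mx. Qed.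

Hypothesis sF : smooth F.

Lemma is_derive_scalel (G : 'rV[R]_n -> R) (c : 'rV[R]_(n + 1)) v x : smooth G ->
  is_derive x v (fun x => G x *: c) (dd v G x *: c).
Proof.
move=> sG; have sw := smooth_scalel c sG; split.
  exact/diff_derivable/(smooth_differentiable x sw).
rewrite deriveE; last exact: (smooth_differentiable x sw).
rewrite diffZl; last exact: (@smooth_differentiable _ _ R^o).
by rewrite /= ddE deriveE//; exact: (@smooth_differentiable _ _ R^o).
Qed.

Lemma is_derive_affine_graph v x : is_derive x v f (dd v F x *: w + v *m usubmx A).
Proof.
rewrite affine_graphE -[X in is_derive _ _ _ X]addr0.
apply: is_deriveD; apply: is_deriveD; first exact: is_derive_scalel.
split; last exact: derive_mulmxr.
exact/diff_derivable/differentiable_mulmxr.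
Qed.

Lemma partial_affine_graph i :
  partial i f = fun x => dd (e i) F x *: w + row i (usubmx A).
Proof.
apply/funext => x; have [_ D] := is_derive_affine_graph (e i) x.
by rewrite rowE -D.
Qed.

Lemma partial2_affine_graph i j x :
  partial i (partial j f) x = dd (e i) (dd (e j) F) x *: w.
Proof.
rewrite partial_affine_graph.
have D := is_derive_scalel w (e i) x (smooth_dd (e j) sF).
have [_ E] := is_deriveD D (is_derive_cst (row j (usubmx A)) x (e i)).
by rewrite addr0 in E.
Qed.

Lemma differentiable_affine_graph x : differentiable f x.
Proof.
rewrite affine_graphE; apply: differentiableD; last exact: differentiable_cst.
have D1 := smooth_differentiable x (smooth_scalel w sF).
exact: (differentiableD D1 (differentiable_mulmxr (usubmx A) x)).
Qed.

Lemma smooth_affine_graph : smooth_on setT f.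
Proof.
apply: smooth_by_partial => [x|i]; first exact: differentiable_affine_graph.
rewrite partial_affine_graph; apply: smoothD; last exact: smooth_cst.
exact/smooth_scalel/smooth_dd.
Qed.

(** The frame is a unipotent matrix times [A], hence invertible with constant determinant. *)
Lemma frame_affine_graph x :
  frame f w x = block_mx 1%:M (\col_j dd (e j) F x) 0 1%:M *m A.
Proof.
have EA : A = col_mx (usubmx A) w by rewrite vsubmxK.
rewrite [X in _ = _ *m X]EA mul_block_col !mul1mx mul0mx add0r /frame; congr col_mx.
apply/row_matrixP => i; rewrite rowE -deriveEjacobian; last exact: differentiable_affine_graph.
have [_ ->] := is_derive_affine_graph (e i) x.
rewrite linearD /= -rowE addrC; congr (_ + _).
by apply/rowP => j; rewrite !mxE big_ord1 !mxE.
Qed.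

Hypothesis uA : A \in unitmx.

Lemma frame_unit x : frame f w x \in unitmx.
Proof.
by rewrite frame_affine_graph unitmx_mul uA andbT unitmxE det_ublock !det1 mulr1 unitr1.
Qed.

Lemma det_frame x : \det (frame f w x) = \det A.
Proof. by rewrite frame_affine_graph det_mulmx det_ublock !det1 !mul1r. Qed.

Lemma gauss_affine_graph i j x :
  gauss f w i j x = dd (e i) (dd (e j) F) x *: row_mx 0 1%:M.
Proof.
rewrite /gauss partial2_affine_graph -scalemxAl; congr (_ *: _).
have Ew : w = row_mx 0 1%:M *m frame f w x by rewrite mul_row_col mul0mx mul1mx add0r.
rewrite [X in X *m _]Ew.
by rewrite mulmxK// frame_unit.
Qed.

Lemma affine_form_affine_graph x : affine_form f w x = hess F x.
Proof.
by apply/matrixP => i j; rewrite mxE gauss_affine_graph mxE row_mxEr !mxE mulr1.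
Qed.

Lemma induced_conn_affine_graph i j k x : induced_conn f w i j k x = 0.
Proof. by rewrite /induced_conn gauss_affine_graph mxE row_mxEl mxE mulr0. Qed.

Lemma cubic_form_affine_graph i j k x :
  cubic_form f w i j k x = dd (e i) (dd (e j) (dd (e k) F)) x.
Proof.
rewrite /cubic_form !big1 ?subr0 => [|m _|m _]; rewrite ?induced_conn_affine_graph ?mul0r//.
have -> : (fun y => affine_form f w y j k) = dd (e j) (dd (e k) F).
  by apply/funext => y; rewrite affine_form_affine_graph mxE.
by rewrite /partial -ddE.
Qed.

(** The three derivatives of [h] in the Christoffel symbol are one and the same third derivative of
    [F]. One of them survives, with the factor 1/2 that reappears in the equation for the fourth
    derivative. *)
Lemma levi_civita_affine_graph i j k x :
  levi_civita f w i j k x = 2^-1 * prod_at F x (e i) (e j) 0 k.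
Proof.
have E l : (fun y => affine_form f w y l.1 l.2) = dd (e l.1) (dd (e l.2) F).
  by apply/funext => y; rewrite affine_form_affine_graph mxE.
rewrite /levi_civita /prod_at mxE; congr (_ * _); apply: eq_bigr => l _.
rewrite (E (j, l)) (E (i, l)) (E (i, j)) /= /partial -!ddE affine_form_affine_graph.
have sd u : smooth (dd u F) := smooth_dd u sF.
rewrite (ddC (e j) (e i) x (sd _)) (ddCf (e j) (e l) sF) (ddC (e i) (e l) x (sd _)).
rewrite addrK mxE mulrC; congr (_ * _).
have /matrixP/(_ l k) : (invmx (hess F x))^T = invmx (hess F x).
  by rewrite trmx_inv hess_sym.
by rewrite mxE.
Qed.

Hypothesis uH : forall x, hess F x \in unitmx.
Hypothesis par : parallel_cubic_form f w setT.

Lemma parallel_pde x l i j k :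
  dd (e l) (dd (e i) (dd (e j) (dd (e k) F))) x
  = 2^-1 * (form (hess F x) (prod_at F x (e l) (e i)) (prod_at F x (e j) (e k))
          + form (hess F x) (prod_at F x (e l) (e j)) (prod_at F x (e i) (e k))
          + form (hess F x) (prod_at F x (e l) (e k)) (prod_at F x (e i) (e j))).
Proof.
have sd u : smooth (dd u F) := smooth_dd u sF.
have sdd u v : smooth (dd u (dd v F)) := smooth_dd u (sd v).
have C a c d : (fun y => cubic_form f w a c d y) = dd (e a) (dd (e c) (dd (e d) F)).
  by apply/funext => y; exact: cubic_form_affine_graph.
have S a c p q : \sum_(m < n) levi_civita f w a c m x * dd (e m) (dd p (dd q F)) x
    = 2^-1 * form (hess F x) (prod_at F x (e a) (e c)) (prod_at F x p q).
  rewrite (form_prodr sF uH) [in RHS]dd_basis// mulr_sumr; apply: eq_bigr => m _.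
  by rewrite levi_civita_affine_graph mulrA.
have := @par x I l i j k; rewrite /nabla_cubic_form (C i j k) /partial -ddE.
have combine (a s1 s2 s3 t1 t2 t3 : R) : a - s1 - s2 - s3 = 0 -> s1 = 2^-1 * t1 ->
    s2 = 2^-1 * t2 -> s3 = 2^-1 * t3 -> a = 2^-1 * (t1 + t2 + t3).
  by move=> E E1 E2 E3; move: E; rewrite E1 E2 E3 => E; lra.
have S1 : \sum_(m < n) levi_civita f w l i m x * cubic_form f w m j k x
    = 2^-1 * form (hess F x) (prod_at F x (e l) (e i)) (prod_at F x (e j) (e k)).
  by rewrite -S; apply: eq_bigr => m _; rewrite cubic_form_affine_graph.
have S2 : \sum_(m < n) levi_civita f w l j m x * cubic_form f w i m k x
    = 2^-1 * form (hess F x) (prod_at F x (e l) (e j)) (prod_at F x (e i) (e k)).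
  rewrite -S; apply: eq_bigr => m _; rewrite cubic_form_affine_graph.
  by rewrite (ddC (e i) _ x (sd _)).
have S3 : \sum_(m < n) levi_civita f w l k m x * cubic_form f w i j m x
    = 2^-1 * form (hess F x) (prod_at F x (e l) (e k)) (prod_at F x (e i) (e j)).
  rewrite -S; apply: eq_bigr => m _; rewrite cubic_form_affine_graph.
  by rewrite (ddCf (e j) (e m) sF) (ddC (e i) (e m) x (sd _)).
move=> E; exact: (combine _ _ _ _ _ _ _ E S1 S2 S3).
Qed.

End AffineGraph.

Lemma parallel_sphere_normal_form (R : realType) (n : nat) (M : set 'rV[R]_(n + 1))
    (xi : 'rV[R]_(n + 1)) : parallel_improper_affine_sphere M xi ->
  exists (F : 'rV[R]_n -> R) (A : 'M[R]_(n + 1)) (b : 'rV[R]_(n + 1)),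
    [/\ smooth F, A \in unitmx, vertical n *m A = xi,
      M = range (affine_map A b \o graph_map F) &
      [/\ forall x, hess F x \in unitmx,
        forall x, \det (hess F x) ^+ 2 = \det (hess F 0) ^+ 2 &
        forall x (l i j k : 'I_n),
          dd (delta_mx 0 l) (dd (delta_mx 0 i) (dd (delta_mx 0 j) (dd (delta_mx 0 k) F))) x
          = 2^-1 * (form (hess F x) (prod_at F x (delta_mx 0 l) (delta_mx 0 i))
                      (prod_at F x (delta_mx 0 j) (delta_mx 0 k))
                  + form (hess F x) (prod_at F x (delta_mx 0 l) (delta_mx 0 j))
                      (prod_at F x (delta_mx 0 i) (delta_mx 0 k))
                  + form (hess F x) (prod_at F x (delta_mx 0 l) (delta_mx 0 k))
                      (prod_at F x (delta_mx 0 i) (delta_mx 0 j)))]].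
Proof.
move=> [F [A [b /= [[fA _] EA -> [[sf gi] eqdet] par]]]].
have uA : A \in unitmx by rewrite -row_free_unit.
(* Smoothness is given for the immersion only. [F] is recovered from it, up to a constant, as the
   last coordinate after undoing [A]. *)
pose p : 'rV[R]_(n + 1) -> R^o := fun y => (y *m invmx A) 0 (rshift n 0).
have p_lin : linear p by move=> a u v; rewrite /p mulmxDl -scalemxAl !mxE.
pose pL : {linear 'rV[R]_(n + 1) -> R^o} :=
  HB.pack p (GRing.isLinear.Build _ _ _ _ _ p_lin).
have cp : continuous pL.
  move=> y; apply: differentiable_continuous.
  apply: (@differentiable_comp _ _ _ R^o (fun y => y *m invmx A) (fun z => z 0 (rshift n 0))).
    exact: differentiable_mulmxr.
  exact: differentiable_coord.
have EF : F = fun x => (pL \o (affine_map A b \o graph_map F)) x - p b.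
  apply/funext => x; rewrite /= /p /affine_map mulmxDl mulmxK// mxE addrK.
  by rewrite /graph_map row_mxEr mxE eqxx mulr1n.
have sF : smooth F.
  rewrite EF; apply: (@smoothD _ _ R^o); last exact: smooth_cst.
  exact: (smooth_comp_linear cp sf).
have Ew : xi = dsubmx A by rewrite -EA vertical_mul.
rewrite Ew in gi eqdet par *.
have uH x : hess F x \in unitmx by have [_] := gi x I; rewrite affine_form_affine_graph.
exists F, A, b; split => //; first exact: vertical_mul.
have E y : (\det A) ^+ 2 = `|\det (hess F y)|.
  rewrite -(affine_form_affine_graph b sF uA y) -(det_frame A b sF y).
  exact: eqdet.
split=> [||x l i j k]; [exact: uH| |].
  move=> x; rewrite -[LHS](real_normK (num_real _)) -[RHS](real_normK (num_real _)).
  by rewrite -!E.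
exact: (parallel_pde sF uA uH par).
Qed.

(** * Classification of potentials *)

Lemma unitmx_inj (K : fieldType) (n : nat) (P : 'M[K]_n) :
  (forall v : 'rV[K]_n, v *m P = 0 -> v = 0) -> P \in unitmx.
Proof.
move=> H; rewrite -row_free_unit -kermx_eq0; apply/eqP/row_matrixP => i.
by rewrite row0; apply: H; rewrite -row_mul mulmx_ker row0.
Qed.

Section Potential.
Context {R : realType} {n : nat}.
Variables (H : 'M[R]_n) (mul : 'rV[R]_n -> 'rV[R]_n -> 'rV[R]_n).

(* The Taylor coefficients are 1/2!, 1/3!, (3/2)/4! and 3/5!. *)
Definition potential (z : 'rV[R]_n) : R :=
  2^-1 * form H z z + 6^-1 * form H (mul z z) z
  + 16^-1 * form H (mul z z) (mul z z) + 40^-1 * form H (mul z z) (mul z (mul z z)).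

(** The rows of [E1] and [E2] are bases of complementary subspaces: [k + l = n] makes the full
    stacked matrix free as well. *)
Definition splits (f : 'rV[R]_n -> R) : Prop :=
  exists (k l : nat) (E1 : 'M[R]_(k, n)) (E2 : 'M[R]_(l, n)),
    [/\ (0 < k)%N, (0 < l)%N, (k + l = n)%N, row_full (col_mx E1 E2) &
      forall y1 y2, f (y1 *m E1 + y2 *m E2) = f (y1 *m E1) + f (y2 *m E2)].

End Potential.

Section Classification.
Context {R : realType} {m : nat}.
Local Notation n := m.+1.
Variables (H : 'M[R]_n) (mul : 'rV[R]_n -> 'rV[R]_n -> 'rV[R]_n).
Hypothesis M : metrised H mul.
Implicit Types (u v w x y z p q : 'rV[R]_n).

Local Notation "u ** v" := (mul u v) (at level 40, left associativity).
Local Notation "<< u , v >>" := (form H u v).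
Local Notation pw := (pw mul).
Local Notation Phi := (potential H mul).

Lemma orthogonal_kermx u w : (u <= kermx (H *m w^T))%MS = (<<u, w>> == 0).
Proof.
apply/sub_kermxP/eqP; rewrite /form mulmxA; first by move=> ->; rewrite mxE.
by move=> E; apply/matrixP => i j; rewrite !ord1 E mxE.
Qed.

Lemma form_nondeg0 u : (forall p, <<p, u>> = 0) -> u = 0.
Proof.
by move=> E; apply: (form_nondeg M) => p; rewrite E /form trmx0 mulmx0 mxE.
Qed.

(** As [h(z, z) <> 0], the space is the sum of the line of [z] and its orthogonal complement. The
    quadratic part has no cross term, and by invariance the higher parts see only the component in
    the complement. *)
Lemma splits_annihilator z : (0 < m)%N -> (forall w, z ** w = 0) -> <<z, z>> != 0 ->
  splits Phi.
Proof.
move=> m0 az zz; pose E2 := row_base (kermx (H *m z^T)).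
have z0 : z != 0 by apply: contraNneq zz => ->; rewrite /form !mul0mx mxE.
have rz : \rank (kermx (H *m z^T)) = m.
  rewrite mxrank_ker -mxrank_tr trmx_mul trmxK (met_sym M) mxrankMfree.
    by rewrite rank_rV z0 subn1.
  by rewrite row_free_unit (met_unit M).
have az' w : w ** z = 0 by rewrite (prodC M).
exists 1%N, (\rank (kermx (H *m z^T))), z, E2; split=> //.
- by rewrite rz.
- by rewrite rz.
- rewrite -sub1mx -addsmxE; apply/row_subP => i; move: (row i _) => u.
  rewrite -[u](addrNK ((<<u, z>> / <<z, z>>) *: z)) addrC.
  apply: addmx_sub_adds; first exact: scalemx_sub.
  rewrite eq_row_base orthogonal_kermx formDl -scaleNr formZl mulNr divfK//.
  by rewrite subrr.
- move=> y1 y2; rewrite [y1]mx11_scalar mul_scalar_mx; set a := y1 0 0.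
  set w := y2 *m E2.
  have wz : <<w, z>> = 0.
    by apply/eqP; rewrite -orthogonal_kermx -(eq_row_base (kermx (H *m z^T))) submxMl.
  have zw : <<z, w>> = 0 by rewrite (form_sym M).
  rewrite /potential !(prodDl M, prodDr M, prodZl M, prodZr M, az, az', scaler0, add0r, addr0).
  rewrite !(formDl, formDr, formZl, formZr) wz zw (form_adj M _ w w) (form_inv M w w z).

  have f0 u : <<u, 0>> = 0 by rewrite /form trmx0 mulmx0 mxE.
  have f0' u : <<0, u>> = 0 by rewrite /form !mul0mx mxE.
  by rewrite !(f0, f0', az', prod0r M); ring.
Qed.

(** The moments of [s]: by [form_pw] the Gram matrix of the powers is the Hankel matrix with entries
    [tau s (j + k)]. *)
Definition tau s k := << s, pw s k>>.

Lemma form_pw s j k : <<pw s j, pw s k>> = tau s (j + k).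
Proof.
elim: j k => [|j IH] k; first by rewrite pw0.
by rewrite (pwS M) (prodC M) (form_inv M) -(pwS M) IH addSnnS.
Qed.

Lemma tau_eq0 s k : (n <= k)%N -> tau s k = 0.
Proof. by move=> nk; rewrite /tau (pw_nil M)// /form trmx0 mulmx0 mxE. Qed.

(** Multiply a linear relation by [L_s^(m - i)]: the terms after the [i]-th become powers that
    vanish, the earlier ones are gone by induction, and a multiple of [pw s m] remains. *)
Lemma pw_basis s : pw s m != 0 -> \matrix_(i < n) pw s i \in unitmx.
Proof.
move=> sm; apply: unitmx_inj => v; rewrite mulmx_sum_row => E.
suff V k (i : 'I_n) : val i = k -> v 0 i = 0.
  by apply/rowP => i; rewrite (V i) ?mxE.
elim/ltn_ind: k i => k IH i ik.
have := congr1 (mulmx^~ (Lmx mul s ^+ (m - i))) E.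
rewrite /= mul0mx mulmx_suml (bigD1 i)//= big1 ?addr0 => [|j ji]; last first.
  rewrite rowK -scalemxAl /pw -mulmxA mulmxE -exprD -/(pw s (j + (m - i))).
  have [ij|] := ltnP i j.
    by rewrite (pw_nil M) ?scaler0//; have := leq_ord j; have := leq_ord i; lia.
  rewrite leq_eqVlt (inj_eq val_inj) (negbTE ji) /= ik => /IH -> //.
  by rewrite scale0r.
rewrite rowK -scalemxAl /pw -mulmxA mulmxE -exprD subnKC ?leq_ord// => /eqP.
by rewrite scaler_eq0 -/(pw s m) (negbTE sm) orbF => /eqP.
Qed.

(** Otherwise [pw s m] would be orthogonal to every power of [s], that is, to a basis. *)
Lemma tau_neq0 s : pw s m != 0 -> tau s m != 0.
Proof.
move=> sm; have uN := pw_basis sm; apply: contraNneq sm => t0.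
apply/eqP/form_nondeg0 => p; rewrite -[p](mulmxKV uN); set v := p *m _.
rewrite mulmx_sum_row; elim: (index_enum _) => [|i r IH].
  by rewrite big_nil /form !mul0mx mxE.
rewrite big_cons formDl IH addr0 rowK formZl form_pw.
case: i => -[|i] hi /=; first by rewrite add0n t0 mulr0.
by rewrite tau_eq0 ?mulr0// addSn ltnS leq_addl.
Qed.

(** * Truncated polynomials in one element *)

Section Powers.
Hypothesis n4 : (n <= 4)%N.
Variable s : 'rV[R]_n.

Definition comb (x1 x2 x3 x4 : R) :=
  x1 *: pw s 0 + x2 *: pw s 1 + x3 *: pw s 2 + x4 *: pw s 3.

Lemma combM (x1 x2 x3 x4 y1 y2 y3 y4 : R) : comb x1 x2 x3 x4 ** comb y1 y2 y3 y4
  = comb 0 (x1 * y1) (x1 * y2 + x2 * y1) (x1 * y3 + x2 * y2 + x3 * y1).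
Proof.
have z k : pw s (4 + k) = 0 by apply: (pw_nil M); exact: leq_trans n4 (leq_addr _ _).
have [[[z4 z5] z6] z7] := (z 0%N, z 1%N, z 2%N, z 3%N).
rewrite /comb !(prodDl M, prodDr M, prodZl M, prodZr M, pwM M) /= !(add0n, addn0, add1n, addn1, add2n, add3n).
rewrite z4 z5 z6 z7.
by apply/rowP => i; rewrite !mxE; ring.
Qed.

Lemma form_comb (x1 x2 x3 x4 y1 y2 y3 y4 : R) : <<comb x1 x2 x3 x4, comb y1 y2 y3 y4>>
  = x1 * y1 * tau s 0 + (x1 * y2 + x2 * y1) * tau s 1 + (x1 * y3 + x2 * y2 + x3 * y1) * tau s 2
    + (x1 * y4 + x2 * y3 + x3 * y2 + x4 * y1) * tau s 3.
Proof.
have z k : tau s (4 + k) = 0 by apply: tau_eq0; exact: leq_trans n4 (leq_addr _ _).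
have [[z4 z5] z6] := (z 0%N, z 1%N, z 2%N).
rewrite /comb !(formDl, formDr, formZl, formZr, form_pw) !(add0n, addn0, add1n, addn1, add2n, add3n).
rewrite z4 z5 z6; ring.
Qed.

(* Up to a constant, the coefficient of [tau s (n - 1)] is the n-dimensional Cayley
   polynomial for n = 2, 3, 4. *)
Lemma potential_comb (x1 x2 x3 x4 : R) :
  Phi (comb x1 (- 2^-1 * x2) (4^-1 * x3) (- 8^-1 * x4))
  = 2^-1 * x1 ^+ 2 * tau s 0 - 2^-1 * (x1 * x2 - 3^-1 * x1 ^+ 3) * tau s 1
    + 4^-1 * (x1 * x3 + 2^-1 * x2 ^+ 2 - x1 ^+ 2 * x2 + 4^-1 * x1 ^+ 4) * tau s 2
    - 8^-1 * (x1 * x4 + x2 * x3 - x1 ^+ 2 * x3 - x1 * x2 ^+ 2 + x1 ^+ 3 * x2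
              - 5^-1 * x1 ^+ 5) * tau s 3.
Proof. by rewrite /potential !combM !form_comb; field. Qed.

(** The effect on the moments of replacing [s] by [s + p s^2 + q s^3 + r s^4]. *)
Lemma tau_comb (p q r : R) (s' := comb 1 p q r) :
  [/\ tau s' 0 = tau s 0 + 2 * p * tau s 1 + (2 * q + p ^+ 2) * tau s 2
        + (2 * r + 2 * p * q) * tau s 3,
      tau s' 1 = tau s 1 + 3 * p * tau s 2 + 3 * (q + p ^+ 2) * tau s 3,
      tau s' 2 = tau s 2 + 4 * p * tau s 3 & tau s' 3 = tau s 3].
Proof. by split; rewrite {1}/tau ?(pwS M) pw0 /s' ?combM form_comb; ring. Qed.

End Powers.

(** The substitution keeps the top moment. Among the lower ones, taken from the highest down, each
    involves one new coefficient, multiplied by a nonzero multiple of the top moment; so [p], [q],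
    [r] can be solved for in this order to make them vanish. *)
Lemma normalised_power (n4 : (n <= 4)%N) s : pw s m != 0 ->
  exists s', (forall k, (k < m)%N -> tau s' k = 0) /\ pw s' m != 0.
Proof.
move=> sm; have tm := tau_neq0 sm.
have pw_of s' : tau s' m != 0 -> pw s' m != 0.
  by apply: contraNneq; rewrite /tau => ->; rewrite /form trmx0 mulmx0 mxE.
have z k : (m < k)%N -> tau s k = 0 by exact: tau_eq0.
have [m0|m0] := leqP m 0.
  by exists s; split=> // k; rewrite ltnNge (leq_trans m0).
have [m1|m1] := leqP m 1.
  have e : m = 1%N by lia.
  have tk : tau s 1 != 0 by rewrite -[X in tau s X]e.
  have pwk s' : tau s' 1 != 0 -> pw s' m != 0.
    by move=> h; apply: pw_of; rewrite [X in tau s' X]e.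
  have [t2 t3] : tau s 2 = 0 /\ tau s 3 = 0 by split; apply: z; lia.
  have [E0 E1 _ _] := tau_comb n4 s (- tau s 0 / (2 * tau s 1)) 0 0.
  exists (comb s 1 (- tau s 0 / (2 * tau s 1)) 0 0); split.
    move=> k; rewrite [X in (k < X)%N]e; case: k => // _.
    by rewrite E0 t2 t3; field; rewrite tk.
  by apply: pwk; rewrite E1 t2 t3 !mulr0 !addr0.
have [m2|m2] := leqP m 2.
  have e : m = 2%N by lia.
  have tk : tau s 2 != 0 by rewrite -[X in tau s X]e.
  have pwk s' : tau s' 2 != 0 -> pw s' m != 0.
    by move=> h; apply: pw_of; rewrite [X in tau s' X]e.
  have t3 : tau s 3 = 0 by apply: z; lia.
  pose p := - tau s 1 / (3 * tau s 2).
  pose q := - (tau s 0 + 2 * p * tau s 1 + p ^+ 2 * tau s 2) / (2 * tau s 2).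
  have [E0 E1 E2 _] := tau_comb n4 s p q 0.
  exists (comb s 1 p q 0); split.
    move=> k; rewrite [X in (k < X)%N]e; case: k => [_|[_|//]].
      by rewrite E0 t3 /q; field; rewrite tk.
    by rewrite E1 t3 /p; field; rewrite tk.
  by apply: pwk; rewrite E2 t3 !mulr0 !addr0.
have e : m = 3%N by lia.
have tk : tau s 3 != 0 by rewrite -[X in tau s X]e.
have pwk s' : tau s' 3 != 0 -> pw s' m != 0.
  by move=> h; apply: pw_of; rewrite [X in tau s' X]e.
pose p := - tau s 2 / (4 * tau s 3).
pose q := - (tau s 1 + 3 * p * tau s 2 + 3 * p ^+ 2 * tau s 3) / (3 * tau s 3).
pose r := - (tau s 0 + 2 * p * tau s 1 + (2 * q + p ^+ 2) * tau s 2
   + 2 * p * q * tau s 3) / (2 * tau s 3).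
have [E0 E1 E2 E3] := tau_comb n4 s p q r.
exists (comb s 1 p q r); split; last by apply: pwk; rewrite E3.
move=> k; rewrite [X in (k < X)%N]e; case: k => [_|[_|[_|//]]].
- by rewrite E0 /r; field; rewrite tk.
- by rewrite E1 /q; field; rewrite tk.
- by rewrite E2 /p; field; rewrite tk.
Qed.

Lemma scaled_power_basis s : pw s m != 0 ->
  \matrix_(i < n) ((- 2^-1) ^+ i *: pw s i) \in unitmx.
Proof.
move=> /pw_basis uN; apply: unitmx_inj => v; rewrite mulmx_sum_row => E.
have : (\row_i (v 0 i * (- 2^-1) ^+ i)) *m \matrix_(i < n) pw s i = 0.
  rewrite -E mulmx_sum_row; apply: eq_bigr => i _.
  by rewrite !rowK mxE scalerA.
move=> /(congr1 (mulmx^~ (invmx (\matrix_(i < n) pw s i)))).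
rewrite mul0mx mulmxK// => /rowP F; apply/rowP => i; have := F i.
rewrite !mxE => /eqP; rewrite mulf_eq0 expf_eq0 oppr_eq0 invr_eq0 pnatr_eq0 andbF orbF.
by move=> /eqP.
Qed.

End Classification.

Section Classification.
Context {R : realType} {m : nat}.
Local Notation n := m.+1.
Variables (H : 'M[R]_n) (mul : 'rV[R]_n -> 'rV[R]_n -> 'rV[R]_n).
Hypothesis M : metrised H mul.
Hypothesis n4 : (n <= 4)%N.
Hypothesis ann_isotropic : forall z, (forall w, mul z w = 0) -> form H z z = 0.
Implicit Types (u v w x y z p q : 'rV[R]_n).

Local Notation "u ** v" := (mul u v) (at level 40, left associativity).
Local Notation "<< u , v >>" := (form H u v).
Local Notation pw := (pw mul).
Local Notation tau := (tau H mul).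

Lemma form0r u : <<u, 0>> = 0.
Proof. by rewrite /form trmx0 mulmx0 mxE. Qed.

Lemma form0l u : <<0, u>> = 0.
Proof. by rewrite /form !mul0mx mxE. Qed.

Lemma kermx_form_rank u : u != 0 -> \rank (kermx (H *m u^T)) = m.
Proof.
move=> u0; rewrite mxrank_ker -mxrank_tr trmx_mul trmxK (met_sym M) mxrankMfree.
  by rewrite rank_rV u0 subn1.
by rewrite row_free_unit (met_unit M).
Qed.

(** * Dimension four: exclusion of nonzero cubes when all fourth powers vanish *)

Section PowerBasis3.
Variable s : 'rV[R]_n.
Hypothesis m3 : m = 3.
Hypothesis s3 : pw s 3 = 0.
Hypothesis s2 : pw s 2 != 0.

Let a := s.
Let b := pw s 1.
Let c := pw s 2.
Let N : 'M[R]_(3, n) := \matrix_(i < 3) pw s i.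

Lemma pw_ge3 k : (3 <= k)%N -> pw s k = 0.
Proof.
elim: k => [//|k IH]; rewrite leq_eqVlt => /orP[/eqP <- //|].
by rewrite ltnS => /IH E; rewrite (pwS M) E (prod0r M).
Qed.

Lemma pw3_free : row_free N.
Proof.
rewrite -kermx_eq0; apply/eqP/row_matrixP => i; rewrite row0.
have : row i (kermx N) *m N = 0 by rewrite -row_mul mulmx_ker row0.
move: (row _ _) => v; rewrite mulmx_sum_row => E.
suff V k (j : 'I_3) : val j = k -> v 0 j = 0.
  by apply/rowP => j; rewrite (V j) ?mxE.
elim/ltn_ind: k j => k IH j jk.
have := congr1 (mulmx^~ (Lmx mul s ^+ (2 - j))) E.
rewrite /= mul0mx mulmx_suml (bigD1 j)//= big1 ?addr0 => [|l jl]; last first.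
  rewrite rowK -scalemxAl /pw -mulmxA mulmxE -exprD -/(pw s (l + (2 - j))).
  have [ij|] := ltnP j l.
    by rewrite pw_ge3 ?scaler0//; have := ltn_ord l; have := ltn_ord j; lia.
  rewrite leq_eqVlt (inj_eq val_inj) (negbTE jl) /= jk => /IH -> //.
  by rewrite scale0r.
have j2 : (j <= 2)%N by have := ltn_ord j; lia.
rewrite rowK -scalemxAl /pw -mulmxA mulmxE -exprD subnKC// => /eqP.
by rewrite scaler_eq0 -/(pw s 2) (negbTE s2) orbF => /eqP.
Qed.

Lemma span3 z : (z <= N)%MS -> exists x1 x2 x3 : R, z = x1 *: a + x2 *: b + x3 *: c.
Proof.
move=> /submxP[r ->]; rewrite mulmx_sum_row !big_ord_recr big_ord0 /= !rowK /= pw0 add0r.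
by do 3!eexists.
Qed.

Lemma perp3 z : <<z, a>> = 0 -> <<z, b>> = 0 -> <<z, c>> = 0 -> (z <= kermx (H *m N^T))%MS.
Proof.
move=> za zb zc; apply/sub_kermxP/rowP => i; rewrite mulmxA mxE.
transitivity <<z, pw s i>>.
  by rewrite /form [RHS]mxE; apply: eq_bigr => j _; rewrite !mxE.
rewrite mxE; case: i => -[|[|[|//]]] hi /=; by rewrite ?pw0.
Qed.

Lemma perp3_rank : \rank (kermx (H *m N^T)) = 1%N.
Proof.
rewrite mxrank_ker -mxrank_tr trmx_mul trmxK (met_sym M) mxrankMfree.
  by rewrite (eqP pw3_free) m3.
by rewrite row_free_unit (met_unit M).
Qed.

(** The powers [a, b, c] of [s] span a hyperplane, and the Gram matrix is governed by
    [h(a, c) = h(b, b)]. If this is nonzero, the span is non-degenerate and its normal annihilates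
    the algebra without being isotropic. If it is zero, the span is the orthogonal of [c], and some
    multiplication has [c] as eigenvector with nonzero eigenvalue. *)
Lemma no_nilpotency_index3 : False.
Proof.
have aa : a ** a = b by rewrite /b (pwS M) pw0.
have ab : a ** b = c by rewrite /c (pwS M).
have ac : a ** c = 0 by rewrite -(pwS M) s3.
have bb : b ** b = 0 by rewrite (pwM M) s3.
have bc : b ** c = 0 by rewrite (pwM M) pw_ge3.
have cc : c ** c = 0 by rewrite (pwM M) pw_ge3.
have t3 : <<b, c>> = 0 by rewrite -aa (form_inv M) ac form0r.
have t4 : <<c, c>> = 0 by rewrite -{1}ab (form_inv M) bc form0r.
have eac : <<b, b>> = <<a, c>> by rewrite -{1}aa (form_inv M) ab.
have [t2|t2] := eqVneq <<a, c>> 0; last first.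
  pose V := kermx (H *m N^T).
  pose y := nz_row V.
  have V0 : V != 0 by rewrite -mxrank_eq0 perp3_rank.
  have y0 : y != 0 by rewrite nz_row_eq0.
  have yV : (y <= V)%MS := nz_row_sub V.
  have Vy : (V <= y)%MS by rewrite -(geq_leqif (mxrank_leqif_sup yV)) perp3_rank rank_rV y0.
  have yN i : <<y, pw s i>> = 0.
    have [i3|i3] := leqP 3 i; first by rewrite pw_ge3 ?form0r.
    have /sub_kermxP := yV; rewrite mulmxA => /rowP/(_ (Ordinal i3)).
    rewrite [in RHS]mxE => <-; rewrite /form mxE [RHS]mxE; apply: eq_bigr => j _.
    by rewrite !mxE.
  have ya : <<y, a>> = 0 by have := yN 0%N; rewrite pw0.
  have yb : <<y, b>> = 0 by exact: yN 1%N.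
  have yc : <<y, c>> = 0 by exact: yN 2%N.
  have perpy z : <<z, a>> = 0 -> <<z, b>> = 0 -> <<z, c>> = 0 -> exists k, z = k *: y.
    by move=> za zb zc; apply/sub_rVP/(submx_trans _ Vy)/perp3.
  (* A product with [y] orthogonal to the span is a multiple of [y], so [y] is an eigenvector and
     its eigenvalue must vanish. *)
  have zero z : <<z ** y, a>> = 0 -> <<z ** y, b>> = 0 -> <<z ** y, c>> = 0 -> z ** y = 0.
    move=> za zb zc; have [k E] := perpy _ za zb zc.
    by rewrite E (no_eigenvector M n4 E y0) scale0r.
  have fE p q : <<p ** y, q>> = <<y, p ** q>> by rewrite (prodC M) (form_inv M).
  have ay : a ** y = 0 by apply: zero; rewrite fE ?aa ?ab ?ac ?form0r.
  have by0 : b ** y = 0.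
    by apply: zero; rewrite fE ?(prodC M b a) ?ab ?bb ?bc ?form0r.
  have cy : c ** y = 0.
    by apply: zero; rewrite fE ?(prodC M c a) ?(prodC M c b) ?ac ?bc ?cc ?form0r.
  have yann z : y ** z = 0.
    have fz p : <<z ** y, p>> = <<z, p ** y>> by rewrite (form_inv M) (prodC M y).
    by rewrite (prodC M); apply: zero; rewrite fz ?ay ?by0 ?cy form0r.
  have yy := ann_isotropic yann.
  have yN' : (y <= N)%MS.
    have NK : (N <= kermx (H *m y^T))%MS.
      apply/row_subP => i; rewrite rowK orthogonal_kermx.
      by rewrite (form_sym M) yN.
    have KN : (kermx (H *m y^T) <= N)%MS.
      by rewrite -(geq_leqif (mxrank_leqif_sup NK)) kermx_form_rank// (eqP pw3_free) m3.
    by apply: submx_trans KN; rewrite orthogonal_kermx yy.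
  have [x1 [x2 [x3 E]]] := span3 yN'.
  have x10 : x1 = 0.
    apply/eqP; rewrite -(mulIr_eq0 _ (mulIf t2)); move: yc.
    by rewrite E !formDl !formZl t3 t4 !mulr0 !addr0 => ->.
  have x20 : x2 = 0.
    apply/eqP; rewrite -(mulIr_eq0 _ (mulIf t2)); move: yb.
    by rewrite E x10 !formDl !formZl eac (form_sym M c) t3 mul0r mulr0 add0r addr0 => ->.
  have x30 : x3 = 0.
    apply/eqP; rewrite -(mulIr_eq0 _ (mulIf t2)); move: ya.
    by rewrite E x10 x20 !formDl !formZl (form_sym M c) !mul0r !add0r => ->.
  by move: y0; rewrite E x10 x20 x30 !scale0r !addr0 eqxx.
(* Degenerate case: take [y] outside the orthogonal of [c]. Then [a ** y] lies in the span with a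
   nonzero coefficient [x1] on [a], and [cube_identity] gives [c ** y = x1 *: c]. *)
have [y yc] : exists y, <<y, c>> != 0.
  apply: contra_notP (negP s2) => h; apply/eqP/(form_nondeg0 M) => p.
  by apply/eqP; apply: contra_notT h => pc; exists p.
have ayN : (a ** y <= N)%MS.
  have NK : (N <= kermx (H *m c^T))%MS.
    apply/row_subP => i; rewrite rowK orthogonal_kermx.
    by case: i => -[|[|[|//]]] hi /=; rewrite ?pw0 -/b -/c -/a ?t2 ?t3 ?t4.
  have KN : (kermx (H *m c^T) <= N)%MS.
    by rewrite -(geq_leqif (mxrank_leqif_sup NK)) kermx_form_rank// (eqP pw3_free) m3.
  apply: submx_trans KN; rewrite orthogonal_kermx (prodC M) (form_inv M) ac form0r.
  by [].
have [x1 [x2 [x3 E]]] := span3 ayN.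
have x10 : x1 != 0.
  have : <<a ** y, b>> = <<y, c>> by rewrite (prodC M) (form_inv M) ab.
  rewrite E !formDl !formZl eac t2 (form_sym M c) t3 !mulr0 !addr0 => E1.
  by apply: contraNneq yc => x10; rewrite -E1 x10 mul0r.
have aE : a ** (a ** y) = x1 *: b + x2 *: c.
  by rewrite E !(prodDr M) !(prodZr M) aa ab ac scaler0 addr0.
have aaE : a ** (a ** (a ** y)) = x1 *: c.
  by rewrite aE !(prodDr M) !(prodZr M) ab ac scaler0 addr0.
have cy : c ** y = x1 *: c.
  have := cube_identity M a y; rewrite aaE aa ab.
  rewrite E !(prodDr M) !(prodZr M) (prodC M b a) ab bb bc !scaler0 !addr0 => /eqP.
  rewrite -subr_eq0 => /eqP E3; apply/rowP => i; have /rowP/(_ i) := E3.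
  rewrite !mxE; lra.
have := no_eigenvector M n4 (_ : y ** c = x1 *: c) s2.
by rewrite (prodC M) => /(_ cy) x1E; rewrite x1E eqxx in x10.
Qed.

End PowerBasis3.
End Classification.

Lemma sum_ord4 (V : zmodType) (F : 'I_4 -> V) :
  \sum_i F i = F (inord 0) + F (inord 1) + F (inord 2) + F (inord 3).
Proof.
rewrite !big_ord_recr big_ord0 /= add0r.
by congr (F _ + F _ + F _ + F _); apply/val_inj; rewrite /= inordK.
Qed.

Lemma row4P (T : Type) (r s : 'rV[T]_4) :
  r 0 (inord 0) = s 0 (inord 0) -> r 0 (inord 1) = s 0 (inord 1) ->
  r 0 (inord 2) = s 0 (inord 2) -> r 0 (inord 3) = s 0 (inord 3) -> r = s.
Proof.
move=> E0 E1 E2 E3; apply/rowP => i.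
have -> : i = inord i by apply/val_inj; rewrite /= inordK.
by case: i => -[|[|[|[|//]]]].
Qed.

(** * Algebras in which all cubes vanish *)

Section CubeZero.
Context {R : realType} {m : nat}.
Local Notation n := m.+1.
Variables (H : 'M[R]_n) (mul : 'rV[R]_n -> 'rV[R]_n -> 'rV[R]_n).
Hypothesis M : metrised H mul.
Hypothesis n4 : (n <= 4)%N.
Hypothesis cube0 : forall x, mul x (mul x x) = 0.
Implicit Types (u v w x y z p q : 'rV[R]_n).

Local Notation "u ** v" := (mul u v) (at level 40, left associativity).
Local Notation "<< u , v >>" := (form H u v).

(** Linearisation of [x^3 = 0]; the cubes of [x + y] and [x - y] separate the parts [p] and [q] of
    degrees (2, 1) and (1, 2). *)
Lemma cube_polar x y : (x ** x) ** y = - (2 *: (x ** (x ** y))).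
Proof.
pose p := (x ** x) ** y + 2 *: (x ** (x ** y)).
pose q := (y ** y) ** x + 2 *: (y ** (y ** x)).
have E1 : p + q = 0.
  have := cube0 (x + y); rewrite !(prodDl M, prodDr M) !cube0 => E.
  rewrite -E /p /q (prodC M (x ** x) y) (prodC M (y ** y) x) (prodC M y x).
  by apply/rowP => i; rewrite !mxE; ring.
have E2 : q - p = 0.
  have := cube0 (x - y); rewrite !(prodDl M, prodDr M, prodNl M, prodNr M) !cube0 => E.
  rewrite -E /p /q (prodC M (x ** x) y) (prodC M (y ** y) x) (prodC M y x).
  by apply/rowP => i; rewrite !mxE; ring.
apply/eqP; rewrite -addr_eq0; apply/eqP/rowP => i.
have /rowP/(_ i) := E1; have /rowP/(_ i) := E2; rewrite -/p !mxE; lra.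
Qed.

(** [cube_identity] and [cube_polar] give [2 L_x^3 = 3 L_(x^2) L_x = - 6 L_x^3]. *)
Lemma mul_cube0 x z : x ** (x ** (x ** z)) = 0.
Proof.
have := cube_identity M x z; rewrite cube0 (prod0l M) addr0 cube_polar => E.
by apply/rowP => i; have /rowP/(_ i) := E; rewrite !mxE; lra.
Qed.

(** Suppose [u = x (x v)] is nonzero and consider [v], [x v], [u], [x^2]. If they are independent
    they span the space, and expanding [x] in them and multiplying by [x] yields a relation. If they
    are dependent, [u] becomes an eigenvector of [L_v] with nonzero eigenvalue. *)
Lemma mul_square0 x v : x ** (x ** v) = 0.
Proof.
apply/eqP; apply: contraT => u0; set u := x ** (x ** v) in u0.
have xu : x ** u = 0 by exact: mul_cube0.
have xxx : x ** (x ** x) = 0 := cube0 x.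
pose N : 'M[R]_(4, n) := \matrix_(i < 4) nth 0 [:: v; x ** v; u; x ** x] i.
have NE (r : 'rV[R]_4) : r *m N = r 0 (inord 0) *: v + r 0 (inord 1) *: (x ** v)
    + r 0 (inord 2) *: u + r 0 (inord 3) *: (x ** x).
  by rewrite mulmx_sum_row sum_ord4 !rowK !inordK.
have [fN|nfN] := boolP (row_free N).
  have xN : (x <= N)%MS.
    apply: submx_full; rewrite /row_full eqn_leq rank_leq_col /=.
    by rewrite (eqP fN).
  have /submxP[r Er] := xN; rewrite NE in Er.
  have xxE : x ** x = r 0 (inord 0) *: (x ** v) + r 0 (inord 1) *: u.
    by rewrite {2}Er !(prodDr M, prodZr M) xu xxx !scaler0 !addr0.
  pose r' : 'rV[R]_4 := \row_i nth 0 [:: 0; r 0 (inord 0); r 0 (inord 1); -1] i.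
  have : r' *m N = 0 *m N.
    rewrite mul0mx NE !mxE !inordK//= scale0r add0r xxE.
    by apply/rowP => i; rewrite !mxE; ring.
  move=> /(row_free_inj fN)/rowP/(_ (inord 3)); rewrite !mxE inordK//= => /eqP.
  by rewrite oppr_eq0 oner_eq0.
have [r r0 rN] : exists2 r : 'rV[R]_4, r != 0 & r *m N = 0.
  exists (nz_row (kermx N)); first by rewrite nz_row_eq0 kermx_eq0.
  exact/sub_kermxP/nz_row_sub.
rewrite NE in rN.
(* Multiplying the relation twice, then once, by [x] isolates the coefficients of [v] and [x v];
   only [u] and [x^2] remain related. *)
have r00 : r 0 (inord 0) = 0.
  have := congr1 (fun z => x ** (x ** z)) rN.
  rewrite !(prodDr M, prodZr M, prod0r M) -/u xu xxx !(prod0r M) !scaler0 !addr0 => /eqP.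
  by rewrite scaler_eq0 (negbTE u0) orbF => /eqP.
have r01 : r 0 (inord 1) = 0.
  have := congr1 (fun z => x ** z) rN.
  rewrite r00 !(prodDr M, prodZr M, prod0r M) -/u xu xxx !scaler0 !addr0 scale0r add0r => /eqP.
  by rewrite scaler_eq0 (negbTE u0) orbF => /eqP.
rewrite r00 r01 !scale0r !add0r in rN.
have r03 : r 0 (inord 3) != 0.
  apply: contra_neq r0 => r03; move/eqP: rN; rewrite r03 scale0r addr0 scaler_eq0 (negbTE u0) orbF.
  by move=> /eqP r02; apply: row4P; rewrite ?mxE.
have xxv : (x ** x) ** v = - (2 *: u) by exact: cube_polar.
have cuv : r 0 (inord 2) *: (v ** u) = (2 * r 0 (inord 3)) *: u.
  have := congr1 (fun z => v ** z) rN.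
  rewrite !(prodDr M, prodZr M, prod0r M) (prodC M v (x ** x)) xxv => E.
  by apply/rowP => i; have /rowP/(_ i) := E; rewrite !mxE; lra.
have r02 : r 0 (inord 2) != 0.
  apply: contra_neq u0 => r02; apply/eqP; move/esym/eqP: cuv.
  by rewrite r02 scale0r scaler_eq0 mulf_eq0 pnatr_eq0 (negbTE r03) => /eqP ->.
have : v ** u = (2 * r 0 (inord 3) / r 0 (inord 2)) *: u.
  by apply: (scalerI r02); rewrite cuv scalerA mulrCA mulfV// mulr1.
move=> /(no_eigenvector M n4)/(_ u0)/eqP.
by rewrite mulf_eq0 invr_eq0 (negbTE r02) orbF mulf_eq0 pnatr_eq0 (negbTE r03).
Qed.

Lemma square_annihilates x y z : (x ** y) ** z = 0.
Proof.
have sq w : (w ** w) ** z = 0 by rewrite cube_polar mul_square0 scaler0 oppr0.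
have := sq (x + y); rewrite !(prodDl M, prodDr M) !sq (prodC M y x) add0r addr0.
by rewrite -mulr2n -scaler_nat => /eqP; rewrite scaler_eq0 pnatr_eq0 => /eqP.
Qed.

End CubeZero.

(** * Real binary cubic forms *)

Section BinaryCubic.
Variable R : rcfType.

(* The first two forms are those of the cubic models, the third one splits. *)
Definition cubic_normal_form (f : R -> R -> R) : Prop :=
  exists a b c d : R, a * d - b * c != 0 /\
   ((exists2 k, k != 0 &
      (forall x y, f (x * a + y * c) (x * b + y * d) = - 2 * k * (x * y * (x + y)))
      \/ (forall x y, f (x * a + y * c) (x * b + y * d) = - 2 * k * (x * y ^+ 2)))
    \/ exists k l, forall x y, f (x * a + y * c) (x * b + y * d) = k * x ^+ 3 + l * y ^+ 3).

Lemma cubic_normal_form_subst (f : R -> R -> R) (a b c d : R) : a * d - b * c != 0 ->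
  cubic_normal_form (fun x y => f (x * a + y * c) (x * b + y * d)) ->
  cubic_normal_form f.
Proof.
move=> D [a' [b' [c' [d' [D' E]]]]].
exists (a' * a + b' * c), (a' * b + b' * d), (c' * a + d' * c), (c' * b + d' * d).
split.
  rewrite (_ : _ - _ = (a * d - b * c) * (a' * d' - b' * c')) ?mulf_neq0//; ring.
have e x y : f (x * (a' * a + b' * c) + y * (c' * a + d' * c))
    (x * (a' * b + b' * d) + y * (c' * b + d' * d))
  = f ((x * a' + y * c') * a + (x * b' + y * d') * c)
      ((x * a' + y * c') * b + (x * b' + y * d') * d) by congr f; ring.
case: E => [[k k0 [E|E]]|[k [l E]]].
- by left; exists k => //; left=> x y; rewrite e.
- by left; exists k => //; right=> x y; rewrite e.
- by right; exists k, l => x y; rewrite e.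
Qed.

(** The sign of [A * C] counts the real roots: three distinct ones if negative, one if positive, and
    a double root if [C = 0]. *)
Lemma binary_cubic_diag (A C : R) : A != 0 ->
  cubic_normal_form (fun x y => y * (3 * A * x ^+ 2 + C * y ^+ 2)).
Proof.
move=> A0.
have A20 : 0 < A ^+ 2 by rewrite exprn_even_gt0.
case: (ltrgtP (A * C) 0) => AC.
- pose k := Num.sqrt (- C / (3 * A)).
  have rad : 0 < - C / (3 * A).
    rewrite (_ : - C / (3 * A) = (- (A * C)) / (3 * A ^+ 2)); last by field; rewrite A0.
    by rewrite divr_gt0// ?oppr_gt0// mulr_gt0.
  have k0 : 0 < k by rewrite sqrtr_gt0.
  have k2 : k ^+ 2 = - C / (3 * A) by rewrite sqr_sqrtr// ltW.
  have CE : C = - 3 * A * k ^+ 2 by rewrite k2; field; rewrite A0.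
  have kn : k != 0 by rewrite gt_eqF.
  exists 2^-1, (2 * k)^-1, (- 2^-1), (2 * k)^-1; split.
    rewrite (_ : _ - _ = (2 * k)^-1); last by field; rewrite kn.
    by rewrite invr_eq0 mulf_neq0.
  left; exists (3 * A / (4 * k)).
    by rewrite !mulf_neq0// ?invr_eq0 ?mulf_neq0// pnatr_eq0.
  by left=> x y; rewrite CE; field; rewrite kn.
(* With one real root the form is a difference of cubes: [2 k y (3 x^2 + k^2 y^2) = (x + k y)^3 - (x
   - k y)^3]. *)
- pose k := Num.sqrt (C / A).
  have rad : 0 < C / A.
    rewrite (_ : C / A = (A * C) / (A ^+ 2)); last by field; rewrite A0.
    by rewrite divr_gt0.
  have k0 : 0 < k by rewrite sqrtr_gt0.
  have k2 : k ^+ 2 = C / A by rewrite sqr_sqrtr// ltW.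
  have CE : C = A * k ^+ 2 by rewrite k2; field; rewrite A0.
  have kn : k != 0 by rewrite gt_eqF.
  exists 2^-1, (2 * k)^-1, 2^-1, (- (2 * k)^-1); split.
    rewrite (_ : _ - _ = - (2 * k)^-1); last by field; rewrite kn.
    by rewrite oppr_eq0 invr_eq0 mulf_neq0.
  right; exists (A / (2 * k)), (- (A / (2 * k))) => x y.
  by rewrite CE; field; rewrite kn.
- have C0 : C = 0 by apply/eqP; have /eqP := AC; rewrite mulf_eq0 (negbTE A0).
  exists 0, 1, 1, 0; split; first by rewrite mul0r mulr1 sub0r oppr_eq0 oner_eq0.
  left; exists (- (3 * A / 2)).
    by rewrite oppr_eq0 !mulf_neq0// ?invr_eq0 pnatr_eq0.
  by right=> x y; rewrite C0; field.
Qed.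

(** For nonzero [A] a shear in [x] completes the square of the quadratic factor; for [A = 0] the
    root [y = 0] is multiple. *)
Lemma binary_cubic_root (A B C : R) :
  cubic_normal_form (fun x y => y * (3 * A * x ^+ 2 + 3 * B * x * y + C * y ^+ 2)).
Proof.
have [A0|A0] := eqVneq A 0; last first.
  apply: (@cubic_normal_form_subst _ 1 0 (- (B / (2 * A))) 1).
    by rewrite !(mulr1, mul0r, subr0) oner_eq0.
  rewrite (_ : (fun _ _ => _) = fun x y : R =>
    y * (3 * A * x ^+ 2 + (C - 3 * B ^+ 2 / (4 * A)) * y ^+ 2)).
    exact: binary_cubic_diag.
  by apply/funext => x; apply/funext => y; field; rewrite A0.
have [B0|B0] := eqVneq B 0.
  exists 1, 0, 0, 1; split; first by rewrite !(mulr1, mul0r, subr0) oner_eq0.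
  by right; exists 0, C => x y; rewrite A0 B0; ring.
exists (3 * B)^-1, 0, (- (C / (3 * B))), 1; split.
  by rewrite mulr1 mul0r subr0 invr_eq0 mulf_neq0// pnatr_eq0.
left; exists (- 2^-1); first by rewrite oppr_eq0 invr_eq0 pnatr_eq0.
by right=> x y; rewrite A0; field; rewrite B0.
Qed.

(** The form is odd, so it has opposite values at the two ends of a path between antipodal points
    and a zero in between. Rotating this zero to [(1, 0)] makes [y] a factor. *)
Lemma binary_cubic (p0 p1 p2 p3 : R) :
  cubic_normal_form (fun x y =>
    p0 * x ^+ 3 + 3 * p1 * x ^+ 2 * y + 3 * p2 * x * y ^+ 2 + p3 * y ^+ 3).
Proof.
pose f (x y : R) := p0 * x ^+ 3 + 3 * p1 * x ^+ 2 * y + 3 * p2 * x * y ^+ 2 + p3 * y ^+ 3.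
have [s [t [st0 fst0]]] : exists s t, s ^+ 2 + t ^+ 2 != 0 /\ f s t = 0.
  (* The path [x |-> (1 - 2 x, x (1 - x))] joins [(1, 0)] to [(-1, 0)] off the origin. *)
  pose S : {poly R} := 1 - 2 *: 'X; pose T : {poly R} := 'X * (1 - 'X).
  pose h := p0 *: S ^+ 3 + (3 * p1) *: (S ^+ 2 * T) + (3 * p2) *: (S * T ^+ 2) + p3 *: T ^+ 3.
  have hE x : h.[x] = f (1 - 2 * x) (x * (1 - x)).
    by rewrite /h /S /T /f !(hornerE, horner_exp); ring.
  have [x rx] : exists x, root h x.
    have h0 : h.[0] = p0 by rewrite hE /f; ring.
    have h1 : h.[1] = - p0 by rewrite hE /f; ring.
    have [p00|p00] := lerP p0 0.
      have [|x _ rx] := @poly_ivt _ h 0 1 ler01; last by exists x.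
      by rewrite h0 h1 p00 oppr_ge0 p00.
    have [|x _ rx] := @poly_ivt _ (- h) 0 1 ler01; last by exists x; rewrite -rootN.
    by rewrite !hornerN h0 h1 opprK oppr_le0 ltW.
  exists (1 - 2 * x), (x * (1 - x)); split; last by rewrite -hE; exact/rootP.
  apply/negP; rewrite paddr_eq0 ?sqr_ge0// !expf_eq0 /= => /andP[/eqP a0 /eqP q0].
  have : (1 - 2 * x) ^+ 2 = 1 - 4 * (x * (1 - x)) by ring.
  by rewrite a0 q0; lra.
apply: (@cubic_normal_form_subst _ s t (- t) s).
  by rewrite (_ : _ - _ = s ^+ 2 + t ^+ 2)//; ring.
(* The coefficients of the form in the basis [(s, t)], [(- t, s)]: [3 A] and [3 B] are the mixed
   ones, and that of [x^3] is [f s t = 0]. *)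
pose A := p0 * (- (s ^+ 2 * t)) + p1 * (s ^+ 3 - 2 * s * t ^+ 2)
  + p2 * (2 * s ^+ 2 * t - t ^+ 3) + p3 * (s * t ^+ 2).
pose B := p0 * (s * t ^+ 2) + p1 * (t ^+ 3 - 2 * s ^+ 2 * t)
  + p2 * (s ^+ 3 - 2 * s * t ^+ 2) + p3 * (s ^+ 2 * t).
pose C := f (- t) s.
rewrite (_ : (fun _ _ => _) = fun x y : R => y * (3 * A * x ^+ 2 + 3 * B * x * y + C * y ^+ 2)).
  exact: binary_cubic_root.
apply/funext => x; apply/funext => y.
rewrite -[RHS](addr0) -[X in _ = _ + X](mulr0 (x ^+ 3)) -fst0 /A /B /C /f; ring.
Qed.

End BinaryCubic.

(** * The Lagrangian annihilator and the cubic models *)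

Section CubicCase.
Context {R : realType} {m : nat}.
Local Notation n := m.+1.
Variables (H : 'M[R]_n) (mul : 'rV[R]_n -> 'rV[R]_n -> 'rV[R]_n).
Hypothesis M : metrised H mul.
Hypothesis n4 : (n <= 4)%N.
Hypothesis cube0 : forall x, mul x (mul x x) = 0.
Hypothesis ann_isotropic : forall z, (forall w, mul z w = 0) -> form H z z = 0.
Implicit Types (u v w x y z p q : 'rV[R]_n).

Local Notation "u ** v" := (mul u v) (at level 40, left associativity).
Local Notation "<< u , v >>" := (form H u v).
Local Notation Phi := (potential H mul).

Definition annihilator : 'M[R]_n := (\bigcap_i kermx (Lmx mul (delta_mx 0 i)))%MS.

Lemma annihilatorP z : reflect (forall w, z ** w = 0) (z <= annihilator)%MS.
Proof.
apply: (iffP sub_bigcapmxP) => [E w|E i _].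
  rewrite [w]row_sum_delta (big_morph _ (prodDr M z) (prod0r M z)).
  rewrite big1// => i _; have /sub_kermxP := E i isT.
  by rewrite (mul_Lmx M) (prodC M) (prodZr M) => ->; rewrite scaler0.
by apply/sub_kermxP; rewrite (mul_Lmx M) (prodC M).
Qed.

Lemma annihilator_isotropic z w : (z <= annihilator)%MS -> (w <= annihilator)%MS ->
  <<z, w>> = 0.
Proof.
move=> /annihilatorP az /annihilatorP aw.
have : <<z + w, z + w>> = 0.
  by apply: ann_isotropic => p; rewrite (prodDl M) az aw addr0.
rewrite formDl !formDr !ann_isotropic// (form_sym M w z) add0r addr0; lra.
Qed.

(** All products lie in the annihilator, so a [z] orthogonal to it satisfies
    [h(z w, p) = h(z, w p) = 0]. The converse inclusion is isotropy. *)
Lemma perp_annihilator :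
  (kermx (H *m annihilator^T) == annihilator)%MS.
Proof.
apply/andP; split; last first.
  apply/sub_kermxP/matrixP => i j; rewrite mulmxA [RHS]mxE.
  rewrite -[RHS](@annihilator_isotropic (row i annihilator) (row j annihilator)) ?row_sub//.
  rewrite /form -row_mul mxE [RHS]mxE; apply: eq_bigr => k _.
  by rewrite !mxE.
apply/row_subP => i; apply/annihilatorP => w; move: (row_sub i (kermx (H *m annihilator^T))).
move: (row i _) => z /sub_kermxP zE.
apply: (form_nondeg0 M) => p; rewrite (form_sym M) (form_inv M).
have : (w ** p <= annihilator)%MS.
  by apply/annihilatorP => q; exact: (square_annihilates M n4 cube0).
move=> /submxP[r ->]; rewrite /form trmx_mul mulmxA -(mulmxA z) zE mul0mx mxE.
by [].
Qed.

(** A subspace equal to its orthogonal has half the dimension. This gives rank 2 for n = 4 and rules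
    out n = 3. *)
Lemma annihilator_rank : n = (2 * \rank annihilator)%N.
Proof.
have := eqmx_rank perp_annihilator.
rewrite mxrank_ker -mxrank_tr trmx_mul trmxK (met_sym M) mxrankMfree; last first.
  by rewrite row_free_unit (met_unit M).
have := rank_leq_row annihilator; lia.
Qed.

Definition quad_basis (u1 k1 u2 k2 : 'rV[R]_n) : 'M[R]_(4, n) :=
  \matrix_(i < 4) nth 0 [:: u1; k1; u2; k2] i.

Lemma quad_basisE (r : 'rV[R]_4) u1 k1 u2 k2 : r *m quad_basis u1 k1 u2 k2
  = r 0 (inord 0) *: u1 + r 0 (inord 1) *: k1 + r 0 (inord 2) *: u2 + r 0 (inord 3) *: k2.
Proof. by rewrite mulmx_sum_row sum_ord4 !rowK !inordK. Qed.

(** A Witt basis adapted to the Lagrangian annihilator. The scale [k] allows the quadratic part to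
    carry the same factor as the cubic normal form. *)
Definition hyperbolic (k : R) (u1 k1 u2 k2 : 'rV[R]_n) : Prop :=
  [/\ (k1 <= annihilator)%MS, (k2 <= annihilator)%MS,
    [/\ <<u1, u1>> = 0, <<u1, u2>> = 0 & <<u2, u2>> = 0] &
    [/\ <<u1, k1>> = k, <<u1, k2>> = 0, <<u2, k1>> = 0 & <<u2, k2>> = k]].

Lemma hyperbolic_free k u1 k1 u2 k2 : k != 0 -> hyperbolic k u1 k1 u2 k2 ->
  row_free (quad_basis u1 k1 u2 k2).
Proof.
move=> k0 [a1 a2 [u11 u12 u22] [d11 d12 d21 d22]].
have i11 := annihilator_isotropic a1 a1; have i12 := annihilator_isotropic a1 a2.
have i22 := annihilator_isotropic a2 a2.
rewrite -kermx_eq0; apply/eqP/row_matrixP => i; rewrite row0.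
have : row i (kermx (quad_basis u1 k1 u2 k2)) *m quad_basis u1 k1 u2 k2 = 0.
  by rewrite -row_mul mulmx_ker row0.
move: (row i _) => r; rewrite quad_basisE => E.
have c (p : 'rV[R]_n) (a : R) : << r 0 (inord 0) *: u1 + r 0 (inord 1) *: k1
    + r 0 (inord 2) *: u2 + r 0 (inord 3) *: k2, p>> = a * k -> a = 0.
  by rewrite E form0l => /esym/eqP; rewrite mulf_eq0 (negbTE k0) orbF => /eqP.
apply: row4P; rewrite [RHS]mxE; apply: c; [instantiate (1 := k1)|instantiate (1 := u1)
  |instantiate (1 := k2)|instantiate (1 := u2)];
  rewrite !formDl !formZl ?(form_sym M k1) ?(form_sym M k2) ?(form_sym M u2 u1).
all: rewrite ?u11 ?u12 ?u22 ?d11 ?d12 ?d21 ?d22 ?i11 ?i12 ?i22.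
all: by rewrite !mulr0 !(addr0, add0r).
Qed.

Lemma potential_hyperbolic k u1 k1 u2 k2 (r : 'rV[R]_4) : hyperbolic k u1 k1 u2 k2 ->
  let u := r 0 (inord 0) *: u1 + r 0 (inord 2) *: u2 in
  Phi (r *m quad_basis u1 k1 u2 k2)
  = k * (r 0 (inord 0) * r 0 (inord 1) + r 0 (inord 2) * r 0 (inord 3))
    + 6^-1 * <<u ** u, u>>.
Proof.
move=> [a1 a2 [u11 u12 u22] [d11 d12 d21 d22]] u.
have i11 := annihilator_isotropic a1 a1; have i12 := annihilator_isotropic a1 a2.
have i22 := annihilator_isotropic a2 a2.
pose a := r 0 (inord 1) *: k1 + r 0 (inord 3) *: k2.
have aa w : a ** w = 0.
  by apply/annihilatorP; rewrite /a addmx_sub// scalemx_sub.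
have -> : r *m quad_basis u1 k1 u2 k2 = u + a.
  by rewrite quad_basisE /u /a; apply/rowP => i; rewrite !mxE; ring.
have uu w : (u ** u) ** w = 0 := square_annihilates M n4 cube0 _ _ _.
have sq : (u + a) ** (u + a) = u ** u.
  by rewrite (prodDl M) !aa addr0 (prodDr M) (prodC M u a) aa addr0.
rewrite /potential sq (prodC M _ (u ** u)) uu form0r (form_inv M u u (u ** u)).
rewrite (prodC M u (u ** u)) uu form0r !mulr0 !addr0; congr (_ + _ * _).
  rewrite /u /a !(formDl, formDr, formZl, formZr).
  rewrite ?(form_sym M k1) ?(form_sym M k2) ?(form_sym M u2 u1).
  by rewrite ?u11 ?u12 ?u22 ?d11 ?d12 ?d21 ?d22 ?i11 ?i12 ?i22; by field.
by rewrite formDr (form_inv M u u a) (prodC M u a) aa form0r addr0.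
Qed.

Lemma hyperbolic_exists : m = 3 -> exists u1 k1 u2 k2, hyperbolic 1 u1 k1 u2 k2.
Proof.
move=> m3; have r2 : \rank annihilator = 2 by have := annihilator_rank; lia.
have [K [fK sK]] : exists K : 'M[R]_(2, n), row_free K /\ (K <= annihilator)%MS.
  suff h r : \rank annihilator = r ->
      exists K : 'M[R]_(r, n), row_free K /\ (K <= annihilator)%MS by exact: h.
  move=> <-; exists (row_base annihilator).
  by rewrite row_base_free eq_row_base.
(* A right inverse of [K], twisted by the inverse form, has as rows vectors dual to the basis [K] of
   the annihilator. *)
have [B KB] := row_freeP fK.
pose V : 'M[R]_(2, n) := (invmx H *m B)^T.
have kv (i j : 'I_2) : <<row j V, row i K>> = (j == i)%:R.
  have VHK : V *m H *m K^T = 1%:M.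
    apply: trmx_inj; rewrite !trmx_mul !trmxK (met_sym M) trmx1.
    by rewrite mulKVmx ?(met_unit M).
  have /matrixP/(_ j i) := VHK; rewrite [RHS]mxE => <-.
  rewrite /form -row_mul mxE [RHS]mxE; apply: eq_bigr => k _.
  by rewrite !mxE.
pose v1 := row 0 V; pose v2 := row 1 V; pose k1 := row 0 K; pose k2 := row 1 K.
have [e11 [e12 [e21 e22]]] : <<v1, k1>> = 1 /\ <<v1, k2>> = 0 /\ <<v2, k1>> = 0 /\ <<v2, k2>> = 1.
  by rewrite !kv.
have a1 : (k1 <= annihilator)%MS := submx_trans (row_sub _ _) sK.
have a2 : (k2 <= annihilator)%MS := submx_trans (row_sub _ _) sK.
have i11 := annihilator_isotropic a1 a1; have i12 := annihilator_isotropic a1 a2.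
have i22 := annihilator_isotropic a2 a2.
(* Subtracting half the Gram matrix of the [v_i] along the dual isotropic [k_i] makes their span
   isotropic and keeps the duality. *)
exists (v1 + (- 2^-1 * <<v1, v1>>) *: k1 + (- 2^-1 * <<v1, v2>>) *: k2), k1,
  (v2 + (- 2^-1 * <<v1, v2>>) *: k1 + (- 2^-1 * <<v2, v2>>) *: k2), k2.
split=> //; split; rewrite !(formDl, formDr, formZl, formZr);
  rewrite ?(form_sym M k1 v1) ?(form_sym M k1 v2) ?(form_sym M k2 v1) ?(form_sym M k2 v2);
  rewrite ?(form_sym M v2 v1) ?(form_sym M k2 k1) ?e11 ?e12 ?e21 ?e22 ?i11 ?i12 ?i22; by field.
Qed.

(** Any change of basis of the plane of the [u_i] extends: the [k_i] transform contragrediently,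
    whence the division by [D], and are rescaled by [k]. *)
Lemma hyperbolic_subst (k a b c d : R) u1 k1 u2 k2 (D := a * d - b * c) :
  D != 0 -> hyperbolic 1 u1 k1 u2 k2 ->
  hyperbolic k (a *: u1 + b *: u2) ((k / D) *: (d *: k1 + (- c) *: k2))
    (c *: u1 + d *: u2) ((k / D) *: (a *: k2 + (- b) *: k1)).
Proof.
move=> D0 [a1 a2 [u11 u12 u22] [d11 d12 d21 d22]].
split; [by rewrite scalemx_sub// addmx_sub ?scalemx_sub
       |by rewrite scalemx_sub// addmx_sub ?scalemx_sub| |]; split.
all: rewrite !(formDl, formDr, formZl, formZr) ?(form_sym M u2 u1).
all: rewrite ?u11 ?u12 ?u22 ?d11 ?d12 ?d21 ?d22.
all: by move: D0; rewrite /D => D0; field; rewrite ?D0.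
Qed.

Lemma cubic_classification : m = 3 ->
  splits Phi \/ exists (E : 'M[R]_(4, n)) (k : R) (i : 'I_3),
    [/\ row_free E, k != 0 & forall r, Phi (r *m E) = k * model4 i r].
Proof.
move=> m3; have [u1 [k1 [u2 [k2 hyp]]]] := hyperbolic_exists m3.
pose f (s t : R) := <<(s *: u1 + t *: u2) ** (s *: u1 + t *: u2), s *: u1 + t *: u2>>.
have fE : f = fun s t => <<u1 ** u1, u1>> * s ^+ 3 + 3 * <<u1 ** u1, u2>> * s ^+ 2 * t
    + 3 * <<u2 ** u2, u1>> * s * t ^+ 2 + <<u2 ** u2, u2>> * t ^+ 3.
  apply/funext => s; apply/funext => t.
  rewrite /f !(prodDl M, prodDr M, prodZl M, prodZr M, formDl, formDr, formZl, formZr).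
  have E1 : <<u1 ** u2, u1>> = <<u1 ** u1, u2>> by rewrite !(form_inv M) (prodC M u2).
  have E2 : <<u1 ** u2, u2>> = <<u2 ** u2, u1>>.
    by rewrite (prodC M u1) !(form_inv M) (prodC M u2).
  by rewrite (prodC M u2 u1) E1 E2; ring.
have : cubic_normal_form f by rewrite fE; exact: binary_cubic.
have Ef (a b c d k : R) : a * d - b * c != 0 ->
    exists2 E : 'M[R]_(4, n), (k != 0 -> row_free E) &
    forall r, Phi (r *m E) = k * (r 0 (inord 0) * r 0 (inord 1) + r 0 (inord 2) * r 0 (inord 3))
      + 6^-1 * f (r 0 (inord 0) * a + r 0 (inord 2) * c) (r 0 (inord 0) * b + r 0 (inord 2) * d).
  move=> D0; have h := hyperbolic_subst k D0 hyp.
  exists (quad_basis (a *: u1 + b *: u2) ((k / (a * d - b * c)) *: (d *: k1 + (- c) *: k2))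
    (c *: u1 + d *: u2) ((k / (a * d - b * c)) *: (a *: k2 + (- b) *: k1))).
    by move=> k0; apply: hyperbolic_free h.
  move=> r'; rewrite (potential_hyperbolic r' h) /f.
  suff -> : (r' 0 (inord 0) * a + r' 0 (inord 2) * c) *: u1
      + (r' 0 (inord 0) * b + r' 0 (inord 2) * d) *: u2
    = r' 0 (inord 0) *: (a *: u1 + b *: u2) + r' 0 (inord 2) *: (c *: u1 + d *: u2) by [].
  by apply/rowP => i; rewrite !mxE; ring.
move=> [a [b [c [d [D0 [[k k0 [E|E]]|[k [l E]]]]]]]].
- right; have [B fB PB] := Ef a b c d k D0.
  exists B, k, 0; split => // [|r]; first exact: fB.
  (* The coefficient [- 2 * k] of the normal form times the Taylor factor 1/6 is [- 3^-1 * k], as in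
     the model. *)
  by rewrite PB E /model4 /=; field.
- right; have [B fB PB] := Ef a b c d k D0.
  exists B, k, 1; split => // [|r]; first exact: fB.
  by rewrite PB E /model4 /=; field.
(* A sum of two cubes has no mixed term, so the planes spanned by the first two and the last two
   basis vectors split the potential. *)
left; have [B fB PB] := Ef a b c d 1 D0.
pose E1 : 'M[R]_(2, n) := \matrix_(i < 2) row (inord i) B.
pose E2 : 'M[R]_(2, n) := \matrix_(i < 2) row (inord i.+2) B.
have split_sum (y1 y2 : 'rV[R]_2) : y1 *m E1 + y2 *m E2
    = (\row_(i < 4) nth 0 [:: y1 0 0; y1 0 1; y2 0 0; y2 0 1] i) *m B.
  rewrite [RHS]mulmx_sum_row sum_ord4 !mxE !inordK//=.
  have l1 : lift ord0 ord0 = 1 :> 'I_2 by apply/val_inj.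
  by rewrite !mulmx_sum_row !big_ord_recl !big_ord0 !rowK l1 /= !addr0 addrA.
exists 2%N, 2%N, E1, E2; split => //; first by rewrite m3.
  have fullB : (1%:M <= B)%MS.
    rewrite sub1mx /row_full eqn_leq rank_leq_col /=.
    by rewrite (eqP (fB (oner_neq0 _))).
  rewrite -sub1mx; apply: (submx_trans fullB).
  apply/row_subP => i; rewrite -addsmxE.
  have -> : i = inord i by apply/val_inj; rewrite /= inordK.
  have R1 (j : 'I_2) : (row (inord j) B <= E1 + E2)%MS.
    by apply: submx_trans (addsmxSl _ _); rewrite -(rowK (fun i : 'I_2 => row (inord i) B)) row_sub.
  have R2 (j : 'I_2) : (row (inord j.+2) B <= E1 + E2)%MS.
    by apply: submx_trans (addsmxSr _ _); rewrite -(rowK (fun i : 'I_2 => row (inord i.+2) B)) row_sub.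
  case: i => -[|[|[|[|//]]]] hi /=.
  - exact: (R1 0).
  - exact: (R1 1).
  - exact: (R2 0).
  - exact: (R2 1).
move=> y1 y2.
have s1 : y1 *m E1 = y1 *m E1 + 0 *m E2 by rewrite mul0mx addr0.
have s2 : y2 *m E2 = 0 *m E1 + y2 *m E2 by rewrite mul0mx add0r.
rewrite [in RHS]s1 [in RHS]s2 !split_sum !PB !E !mxE !inordK//=; ring.
Qed.

End CubicCase.

(** * The Cayley polynomials in two and three variables *)

Section CayleyPolynomial.
Context {R : realType}.

(* The inner sums are coefficients of powers of the generating polynomial. *)
Lemma cayley_coef (n : nat) (x : 'rV[R]_n) :
  cayley x = \sum_(2 <= d < n.+2) (-1) ^+ d / d%:R *
    ((\sum_(i < n) x 0 i *: 'X^(i.+1)) ^+ d)`_n.+1.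
Proof.
rewrite /cayley; apply: eq_bigr => d _; congr (_ * _).
rewrite -[d in _ ^+ d]card_ord -prodr_const bigA_distr_bigA /= coef_sum big_mkcond.
apply: eq_bigr => f _.
rewrite scaler_prod -(big_morph (fun k => 'X^k) (exprD _) (expr0 _)).
rewrite coefZ coefXn eq_sym; case: eqP => _; first by rewrite mulr1.
by rewrite mulr0.
Qed.

Lemma cayley2E (x : 'rV[R]_2) : let y k := x 0 (inord k) in
  cayley x = y 0%N * y 1%N - 3^-1 * y 0%N ^+ 3.
Proof.
move=> y; rewrite cayley_coef.
set q := \sum_(i < 2) _.
have qE : q = (y 0%N)%:P * 'X + (y 1%N)%:P * 'X^2.
  rewrite /q !big_ord_recr big_ord0 /= add0r -!mul_polyC.
  by congr (_%:P * _ + _%:P * _); congr (x 0 _); apply/val_inj; rewrite /= inordK.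
have qM (p : {poly R}) k : (q * p)`_k.+2 = y 0%N * p`_k.+1 + y 1%N * p`_k.
  by rewrite qE mulrDl -!mulrA coefD !coefCM !coefXM /=.
have qM1 (p : {poly R}) : (q * p)`_1 = y 0%N * p`_0.
  by rewrite qE mulrDl -!mulrA coefD !coefCM !coefXM /= mulr0 addr0.
have qM0 (p : {poly R}) : (q * p)`_0 = 0.
  by rewrite qE mulrDl -!mulrA coefD !coefCM !coefXM /= !mulr0 addr0.
rewrite 2?big_ltn// big_geq// addr0 !(exprS q) !expr0 !(qM, qM1, qM0) !coef1 /=; by field.
Qed.

Lemma cayley3E (x : 'rV[R]_3) : let y k := x 0 (inord k) in
  cayley x = y 0%N * y 2%N + 2^-1 * y 1%N ^+ 2 - y 0%N ^+ 2 * y 1%N + 4^-1 * y 0%N ^+ 4.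
Proof.
move=> y; rewrite cayley_coef.
set q := \sum_(i < 3) _.
have qE : q = (y 0%N)%:P * 'X + (y 1%N)%:P * 'X^2 + (y 2%N)%:P * 'X^3.
  rewrite /q !big_ord_recr big_ord0 /= add0r -!mul_polyC.
  by congr (_%:P * _ + _%:P * _ + _%:P * _); congr (x 0 _); apply/val_inj; rewrite /= inordK.
have qM (p : {poly R}) k :
    (q * p)`_k.+3 = y 0%N * p`_k.+2 + y 1%N * p`_k.+1 + y 2%N * p`_k.
  by rewrite qE !mulrDl -!mulrA !coefD !coefCM !coefXM /=.
have qM2 (p : {poly R}) : (q * p)`_2 = y 0%N * p`_1 + y 1%N * p`_0.
  by rewrite qE !mulrDl -!mulrA !coefD !coefCM !coefXM /= mulr0 addr0.
have qM1 (p : {poly R}) : (q * p)`_1 = y 0%N * p`_0.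
  by rewrite qE !mulrDl -!mulrA !coefD !coefCM !coefXM /= !mulr0 !addr0.
have qM0 (p : {poly R}) : (q * p)`_0 = 0.
  by rewrite qE !mulrDl -!mulrA !coefD !coefCM !coefXM /= !mulr0 !addr0.
rewrite 3?big_ltn// big_geq// addr0 !(exprS q) !expr0 !(qM, qM1, qM2, qM0) !coef1 /=; by field.
Qed.

End CayleyPolynomial.

(** * Normal forms of potentials that do not split *)

Section NormalForms.
Context {R : realType}.

Lemma isotropic_annihilator (m : nat) (H : 'M[R]_m.+1) mul : metrised H mul ->
  (0 < m)%N -> ~ splits (potential H mul) ->
  forall z, (forall w, mul z w = 0) -> form H z z = 0.
Proof.
move=> M m0 nsplit z az; apply/eqP; apply: contraPT nsplit => zz ns.
exact/ns/(splits_annihilator M m0 az zz).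
Qed.

(** If all squares vanished, so would all products; every vector would then be annihilating, hence
    isotropic, and the form would be zero. *)
Lemma product_neq0 (m : nat) (H : 'M[R]_m.+1) mul : metrised H mul ->
  (forall z, (forall w, mul z w = 0) -> form H z z = 0) ->
  exists x, mul x x != 0.
Proof.
move=> M iso; apply: contrapT => ne.
have sq x : mul x x = 0.
  by apply/eqP; apply: contrapT => /negP h; apply: ne; exists x.
have pr x y : mul x y = 0.
  have := sq (x + y); rewrite (prodDl M) !(prodDr M) !sq (prodC M y x) add0r addr0.
  by rewrite -mulr2n -scaler_nat => /eqP; rewrite scaler_eq0 pnatr_eq0 => /eqP.
have f0 z w : form H z w = 0.
  have := iso (z + w) (pr _).
  rewrite formDl !formDr (iso z (pr z)) (iso w (pr w)) (form_sym M w z); lra.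
have := form_nondeg0 M (fun p => f0 p (delta_mx 0 0)) => /rowP/(_ 0).
by rewrite !mxE !eqxx => /eqP; rewrite oner_eq0.
Qed.

(** The weights [(- 2^-1) ^+ i] are those of [potential_comb]; with them the potential acquires the
    coefficients of the Cayley polynomial. *)
Definition power_basis (m : nat) (mul : 'rV[R]_m.+1 -> 'rV[R]_m.+1 -> 'rV[R]_m.+1) s :
  'M[R]_m.+1 := \matrix_(i < m.+1) ((- 2^-1) ^+ i *: pw mul s i).

(** Missing coordinates default to 0, so the formula for four powers serves every dimension up to
    four. *)
Lemma power_basis_comb (m : nat) (mul : 'rV[R]_m.+1 -> 'rV[R]_m.+1 -> 'rV[R]_m.+1) (s x : 'rV[R]_m.+1)
    (y := fun k => if (k < m.+1)%N then x 0 (inord k) else 0) : (m <= 3)%N ->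
  x *m power_basis mul s
  = comb mul s (y 0%N) (- 2^-1 * y 1%N) (4^-1 * y 2%N) (- 8^-1 * y 3%N).
Proof.
move=> m3; rewrite mulmx_sum_row /comb.
have -> : \sum_i x 0 i *: row i (power_basis mul s)
    = \sum_(0 <= i < m.+1) (y i * (- 2^-1) ^+ i) *: pw mul s i.
  rewrite big_mkord; apply: eq_bigr => i _.
  by rewrite rowK scalerA /y ltn_ord inord_val.
have c2 : (- 2^-1) ^+ 2 = 4^-1 :> R by field.
have c3 : (- 2^-1) ^+ 3 = - 8^-1 :> R by field.
have z k : (m < k)%N -> y k = 0 by move=> mk; rewrite /y ltnNge mk.
have -> : \sum_(0 <= i < m.+1) (y i * (- 2^-1) ^+ i) *: pw mul s i
    = \sum_(0 <= i < 4) (y i * (- 2^-1) ^+ i) *: pw mul s i.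
  rewrite [RHS](big_cat_nat _ (n := m.+1))//= [X in _ = _ + X]big_nat_cond.
  rewrite [X in _ = _ + X]big1 ?addr0// => i /andP[/andP[mi _] _].
  by rewrite z// mul0r scale0r.
do 4!rewrite big_ltn//; rewrite big_geq// addr0 expr0 expr1 mulr1 c2 c3.
rewrite (mulrC (y 1%N)) (mulrC (y 2)) (mulrC (y 3)).
by rewrite !addrA.
Qed.

Lemma cayley_potential (m : nat) (H : 'M[R]_m.+1) mul s : metrised H mul ->
  (m = 1 \/ m = 2)%N -> pw mul s m != 0 ->
  exists (P : 'M[R]_m.+1) (k : R),
    [/\ P \in unitmx, k != 0 & forall x, potential H mul (x *m P) = k * cayley x].
Proof.
move=> M m12 sm.
have n4 : (m.+1 <= 4)%N by lia.
have [s' [t0 sm']] := normalised_power M n4 sm.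
have tm := tau_neq0 M sm'.
have th k : (m < k)%N -> tau H mul s' k = 0 by exact: tau_eq0.
have uP := scaled_power_basis M sm'.
case: m12 => e; subst m.
  exists (power_basis mul s'), (- 2^-1 * tau H mul s' 1).
  split=> // [|x]; first by rewrite mulf_neq0// oppr_eq0 invr_eq0 pnatr_eq0.
  rewrite power_basis_comb// (potential_comb M n4) (t0 0%N)// (th 2)// (th 3)//.
  by rewrite cayley2E /=; field.
exists (power_basis mul s'), (4^-1 * tau H mul s' 2).
split=> // [|x]; first by rewrite mulf_neq0// invr_eq0 pnatr_eq0.
rewrite power_basis_comb// (potential_comb M n4) (t0 0%N)// (t0 1%N)// (th 3)//.
by rewrite cayley3E /=; field.
Qed.

Lemma classification23 (m : nat) (H : 'M[R]_m.+1) mul : metrised H mul ->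
  (m = 1 \/ m = 2)%N -> ~ splits (potential H mul) ->
  exists (P : 'M[R]_m.+1) (k : R),
    [/\ P \in unitmx, k != 0 & forall x, potential H mul (x *m P) = k * cayley x].
Proof.
move=> M m12 ns.
have n4 : (m.+1 <= 4)%N by lia.
have m0 : (0 < m)%N by lia.
have iso := isotropic_annihilator M m0 ns.
have [s sm] : exists s, pw mul s m != 0.
  apply: contrapT => ne.
  have pm s : pw mul s m = 0.
    by apply/eqP; apply: contrapT => /negP h; apply: ne; exists s.
  have [x xx] := product_neq0 M iso.
  have [e|e] := m12.
    have := pm x; rewrite [X in pw mul x X]e (pwS M) pw0 => xx0.
    by rewrite xx0 eqxx in xx.
  (* For n = 3 the vanishing of all cubes would make the dimension twice the rank of the
     annihilator, which is impossible for an odd number. *)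
  have cube0 y : mul y (mul y y) = 0.
    by have := pm y; rewrite [X in pw mul y X]e !(pwS M) pw0.
  have := annihilator_rank M n4 cube0 iso; lia.
exact: cayley_potential sm.
Qed.

Lemma classification4 (H : 'M[R]_4) mul : metrised H mul ->
  ~ splits (potential H mul) ->
  exists (P : 'M[R]_4) (k : R) (i : 'I_3),
    [/\ P \in unitmx, k != 0 & forall x, potential H mul (x *m P) = k * model4 i x].
Proof.
move=> M ns; have n4 : (4 <= 4)%N by [].
have iso := isotropic_annihilator M (isT : (0 < 3)%N) ns.
have [[s s3]|no3] := pselect (exists s, pw mul s 3 != 0).
  have [s' [t0 sm']] := normalised_power M n4 s3.
  have tm := tau_neq0 M sm'.
  exists (power_basis mul s'), (- 8^-1 * tau H mul s' 3), (inord 2).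
  split=> [||x]; first exact: (scaled_power_basis M sm').
    by rewrite mulf_neq0// oppr_eq0 invr_eq0 pnatr_eq0.
  rewrite power_basis_comb// (potential_comb M n4) (t0 0%N)// (t0 1%N)// (t0 2)//.
  by rewrite /model4 inordK//=; field.
have p3 s : pw mul s 3 = 0.
  by apply/eqP; apply: contrapT => /negP h; apply: no3; exists s.
have [[s s2]|no2] := pselect (exists s, pw mul s 2 != 0).
  by have := no_nilpotency_index3 M n4 iso erefl (p3 s) s2.
have cube0 y : mul y (mul y y) = 0.
  rewrite -[mul y y](pw0 mul) -[X in mul X _](pw0 mul).
  apply/eqP; apply: contrapT => /negP h; apply: no2; exists y.
  by move: h; rewrite !(pwS M) !pw0.
have [//|[E [k [i [fE k0 PE]]]]] := cubic_classification M n4 cube0 iso erefl.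
by exists E, k, i; split=> //; rewrite -row_free_unit.
Qed.

End NormalForms.

(** * Decomposable graphs *)

Section SplitGraph.
Context {R : realType} {n : nat}.
Variable F : 'rV[R]_n -> R.
Hypothesis sF : smooth F.
Hypothesis uH : forall x, hess F x \in unitmx.

Lemma connected_rV (k : nat) : connected [set: 'rV[R]_k].
Proof.
have -> : [set: 'rV[R]_k] = \bigcup_(v in [set: 'rV[R]_k]) ((fun t : R => t *: v) @` setT).
  apply/seteqP; split=> // v _; exists v => //.
  by exists 1 => //; rewrite scale1r.
apply: bigcup_connected.
  by exists 0 => v _ /=; exists 0 => //; rewrite scale0r.
move=> v _; apply: connected_continuous_connected.
  by apply/connected_intervalP => ? ? ? ?.
apply: continuous_subspaceT => t; exact: scalel_continuous.
Qed.

(** Moving along the second summand changes [F] by an amount independent of the point of the first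
    one. A derivative in such a direction is therefore constant on the first summand. *)
Lemma cross_derivative_eq0 (k l : nat) (E1 : 'M[R]_(k, n)) (E2 : 'M[R]_(l, n)) :
  (forall y1 y2, F (y1 *m E1 + y2 *m E2) = F (y1 *m E1) + F (y2 *m E2) - F 0) ->
  forall y u v, dd (u *m E1) (dd (v *m E2) F) (y *m E1) = 0.
Proof.
move=> split y u v.
have C z : dd (v *m E2) F (z *m E1) = dd (v *m E2) F 0.
  have [_ E] := smooth_line (v *m E2) (z *m E1) sF 0.
  have [_ E'] := is_deriveD (smooth_line (v *m E2) 0 sF 0)
    (is_derive_cst (F (z *m E1) - F 0) 0 (1 : R)).
  rewrite scale0r addr0 in E; rewrite scale0r !addr0 in E'.
  rewrite -E -E'; congr (derive _ _ _); apply/funext => t /=.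
  rewrite -[RHS]/(F (0 + t *: (v *m E2)) + (F (z *m E1) - F 0)).
  by rewrite add0r scalemxAl split; ring.
have := dd_comp_mulmxr E1 u (smooth_dd (v *m E2) sF).
move=> /(congr1 (fun f => f y)) <-.
have -> : (fun y0 => dd (v *m E2) F (y0 *m E1)) = cst (dd (v *m E2) F 0).
  by apply/funext => z; rewrite C.
by rewrite ddE derive_cst.
Qed.

Lemma hess_comp_mulmxr (k : nat) (E : 'M[R]_(k, n)) (c : R) (y u v : 'rV[R]_k) :
  form (hess (fun y => F (y *m E) + c) y) u v = form (hess F (y *m E)) (u *m E) (v *m E).
Proof.
have sFE := smooth_comp_mulmxr E sF.
have sFc : smooth (fun y => F (y *m E) + c).
  by apply: (@smoothD _ _ R^o _ _ sFE); exact: (@smooth_cst _ _ R^o).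
have dc w : dd w (fun y => F (y *m E) + c) = dd w (fun y => F (y *m E)).
  apply/funext => z.
  have [_ e] := is_deriveD (smooth_is_derive w z sFE) (is_derive_cst (c : R^o) z w).
  by rewrite ddE e addr0.
by rewrite !hessE// dc !dd_comp_mulmxr//; exact: smooth_dd.
Qed.

(** Since cross derivatives vanish, a null vector of the Hessian of a factor is a null vector of the
    full Hessian. *)
Lemma hess_split_unit (k l : nat) (E1 : 'M[R]_(k, n)) (E2 : 'M[R]_(l, n)) (c : R) :
  row_full (col_mx E1 E2) -> row_free E1 ->
  (forall y1 y2, F (y1 *m E1 + y2 *m E2) = F (y1 *m E1) + F (y2 *m E2) - F 0) ->
  forall y, hess (fun y => F (y *m E1) + c) y \in unitmx.
Proof.
move=> full free split y; apply: unitmx_inj => v v0.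
apply: (row_free_inj free); rewrite /= mul0mx.
have sH : (hess F (y *m E1))^T = hess F (y *m E1) := hess_sym sF _.
have z w : form (hess F (y *m E1)) (v *m E1) w = 0.
  have /submxP[r ->] : (w <= col_mx E1 E2)%MS by exact: submx_full.
  rewrite -[r]hsubmxK mul_row_col formDr -(hess_comp_mulmxr E1 c).
  rewrite (_ : form _ v _ = 0); last by rewrite /form v0 mul0mx mxE.
  by rewrite add0r hessE// cross_derivative_eq0.
have : v *m E1 *m hess F (y *m E1) = 0.
  apply/rowP => i; rewrite [RHS]mxE -(z (delta_mx 0 i)) /form trmx_delta -colE.
  by rewrite [RHS]mxE.
by move=> /(congr1 (mulmx^~ (invmx (hess F (y *m E1))))); rewrite mul0mx mulmxK.
Qed.

End SplitGraph.

Lemma row_free_col_mx (K : fieldType) (k l n : nat) (E1 : 'M[K]_(k, n)) (E2 : 'M[K]_(l, n)) :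
  row_free (col_mx E1 E2) -> row_free E1 /\ row_free E2.
Proof.
move=> free.
have inj v1 v2 : v1 *m E1 + v2 *m E2 = 0 -> v1 = 0 :> 'rV_k /\ v2 = 0 :> 'rV_l.
  rewrite -mul_row_col => E.
  have : row_mx v1 v2 *m col_mx E1 E2 = 0 *m col_mx E1 E2 by rewrite E mul0mx.
  move=> /(row_free_inj free); rewrite -(row_mx0 _ _ _ _) => /eq_row_mx[-> ->].
  by [].
split; rewrite -kermx_eq0; apply/eqP/row_matrixP => i; rewrite row0.
  apply: (inj _ 0 _).1; by rewrite -row_mul mulmx_ker row0 mul0mx addr0.
apply: (inj 0 _ _).2; by rewrite -row_mul mulmx_ker row0 mul0mx add0r.
Qed.

Section Decomposable.
Context {R : realType} {n : nat}.
Variables (F : 'rV[R]_n -> R) (A : 'M[R]_(n + 1)) (b : 'rV[R]_(n + 1)).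
Hypothesis sF : smooth F.
Hypothesis uH : forall x, hess F x \in unitmx.
Hypothesis uA : A \in unitmx.

Lemma graph_immersion_graph_map (k : nat) (G : 'rV[R]_k -> R) : smooth G ->
  (forall x, hess G x \in unitmx) -> graph_immersion (graph_map G) (vertical k) setT.
Proof.
move=> sG uG.
have Eg : graph_map G = affine_map 1%:M 0 \o graph_map G.
  by apply/funext => x; rewrite /= /affine_map mulmx1 addr0.
have Ev : vertical k = dsubmx (1%:M : 'M[R]_(k + 1)) by rewrite -vertical_mul mulmx1.
rewrite Eg Ev; split; first exact: smooth_affine_graph.
move=> x _; split; first exact: (frame_unit _ sG (unitmx1 _ _)).
by rewrite (affine_form_affine_graph _ sG (unitmx1 _ _)).
Qed.

Lemma split_locally_decomposable (k l : nat) (E1 : 'M[R]_(k, n)) (E2 : 'M[R]_(l, n)) :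
  (0 < k)%N -> (0 < l)%N -> (k + l = n)%N -> row_full (col_mx E1 E2) ->
  (forall y1 y2, F (y1 *m E1 + y2 *m E2) = F (y1 *m E1) + F (y2 *m E2) - F 0) ->
  locally_decomposable (range (affine_map A b \o graph_map F)) (vertical n *m A).
Proof.
move=> k0 l0 kln full split p _; exists setT; split=> //; first exact: openT.
have free : row_free (col_mx E1 E2).
  by have := full; rewrite /row_full /row_free => /eqP ->; rewrite kln.
have [free1 free2] := row_free_col_mx free.
have split' y1 y2 : F (y1 *m E2 + y2 *m E1) = F (y1 *m E2) + F (y2 *m E1) - F 0.
  by rewrite addrC split addrAC addrC addrA.
have full' : row_full (col_mx E2 E1).
  by rewrite -sub1mx -addsmxE addsmxC addsmxE sub1mx.
pose q (i : 'I_2) := if val i == 0%N then k else l.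
pose E (i : 'I_2) : 'M[R]_(q i, n) :=
  if val i == 0%N as t return 'M[R]_(if t then k else l, n) then E1 else E2.
(* The sum of the two restrictions counts [F 0] twice; the second factor absorbs the excess. *)
pose c (i : 'I_2) := if val i == 0%N then 0 else - F 0.
pose G (i : 'I_2) (y : 'rV[R]_(q i)) := F (y *m E i) + c i.
pose P := \mxcol_i E i.
have PE (x : 'rV[R]_(\sum_i q i)) : x *m P = submxrow x ord0 *m E1 + submxrow x ord_max *m E2.
  rewrite -{1}[x]submxrowK mul_mxrow_mxcol (bigD1 ord0)//= (bigD1 ord_max)//=.
  by rewrite big1 ?addr0// => -[[|[|//]] hi].
have GE (x : 'rV[R]_(\sum_i q i)) : product_fun G x = F (x *m P).
  rewrite /product_fun (bigD1 ord0)//= (bigD1 ord_max)//= big1 ?addr0; last first.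
    by move=> -[[|[|//]] hi].
  by rewrite PE split /G /c /= addr0 addrA.
have sumq : (\sum_i q i = n)%N by rewrite big_ord_recr big_ord1 /= /q /= kln.
have fullP : row_full P.
  rewrite -sub1mx; apply/row_subP => i; move: (row i _) => u.
  have /submxP[r ->] : (u <= col_mx E1 E2)%MS by exact: submx_full.
  pose y (i : 'I_2) : 'rV[R]_(q i) :=
    if val i == 0%N as t return 'rV[R]_(if t then k else l) then lsubmx r else rsubmx r.
  have -> : r *m col_mx E1 E2 = (\mxrow_i y i) *m P.
    by rewrite PE !mxrowK -{1}[r]hsubmxK mul_row_col.
  exact: submxMl.
have freeP : row_free P.
  by move: fullP; rewrite /row_full /row_free => /eqP ->; rewrite sumq.
have [Q PQ] := row_freeP freeP.
have QP : Q *m P = 1%:M.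
  have [Q' Q'P] := row_fullP fullP.
  have <- : Q' = Q by rewrite -[Q']mulmx1 -PQ mulmxA Q'P mul1mx.
  exact: Q'P.
exists 2%N, q, (fun=> setT), G; split => //.
- by case=> -[|[|//]] hi; rewrite /q.
- by move=> i; split; [exact: openT|exact: connected_rV|exists 0].
- have sG (d : nat) (B : 'M[R]_(d, n)) (a : R) : smooth (fun y => F (y *m B) + a).
    apply: (@smoothD _ _ R^o (fun y => F (y *m B)) (fun=> a)).
      exact: smooth_comp_mulmxr.
    exact: (@smooth_cst _ _ R^o).
  case=> -[|[|//]] hi; apply: graph_immersion_graph_map; rewrite /G /c /E /q /=.
  + exact: sG.
  + exact: (hess_split_unit sF uH 0 full free1 split).
  + exact: sG.
  + exact: (hess_split_unit sF uH (- F 0) full' free2 split').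
(* [P] acts on the base and the identity on the vertical direction, so the transversal field is
   preserved. *)
pose A' := block_mx P 0 0 (1%:M : 'M[R]_1) *m A.
exists A', b; split.
- split.
    apply/row_freeP; exists (invmx A *m block_mx Q 0 0 1%:M).
    rewrite /A' mulmxA mulmxK// mulmx_block PQ !(mulmx0, mul0mx, mulmx1, addr0, add0r).
    by rewrite -scalar_mx_block.
  apply/row_fullP; exists (invmx A *m block_mx Q 0 0 1%:M).
  rewrite /A' -mulmxA (mulmxA (block_mx Q _ _ _)) mulmx_block QP.
  rewrite !(mulmx0, mul0mx, mulmx1, addr0, add0r) -scalar_mx_block mul1mx.
  by rewrite mulVmx.
- rewrite /A' mulmxA /vertical mul_row_block.
  by rewrite !(mulmx0, mul0mx, mulmx1, addr0, add0r).
have AE x : (affine_map A' b \o graph_map (product_fun G)) x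
    = (affine_map A b \o graph_map F) (x *m P).
  rewrite /= /affine_map /A' mulmxA /graph_map mul_row_block GE.
  by rewrite !(mulmx0, mul0mx, mulmx1, addr0, add0r).
rewrite setIT; apply/seteqP; split=> [_ [x _ <-]|_ [x _ <-]].
  by exists (x *m Q) => //; rewrite AE -mulmxA QP mulmx1.
by rewrite AE; exists (x *m P).
Qed.

End Decomposable.

(** * Inequivalence of the models *)

Section Models.
Context {R : realType}.

Definition quad (a b c d : R) : 'rV[R]_4 := \row_(i < 4) nth 0 [:: a; b; c; d] i.

Lemma quadE a b c d : [/\ quad a b c d 0 (inord 0) = a, quad a b c d 0 (inord 1) = b,
  quad a b c d 0 (inord 2) = c & quad a b c d 0 (inord 3) = d].
Proof. by split; rewrite mxE inordK. Qed.

Lemma quad_eta (x : 'rV[R]_4) :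
  x = quad (x 0 (inord 0)) (x 0 (inord 1)) (x 0 (inord 2)) (x 0 (inord 3)).
Proof.
apply/rowP => i; rewrite mxE.
by case: i => -[|[|[|[|//]]]] hi /=; congr (x 0 _); apply/val_inj; rewrite /= inordK.
Qed.

Definition model4_poly (k : 'I_3) (a b c d : R) : R :=
  nth 0 [:: a * b + c * d - 3^-1 * a * c * (a + c); a * b + c * d - 3^-1 * a * c ^+ 2;
            a * d + b * c - a ^+ 2 * c - a * b ^+ 2 + a ^+ 3 * b - 5^-1 * a ^+ 5] k.

Lemma model4E k (x : 'rV[R]_4) : model4 k x
  = model4_poly k (x 0 (inord 0)) (x 0 (inord 1)) (x 0 (inord 2)) (x 0 (inord 3)).
Proof. by []. Qed.

Lemma quadD a b c d a' b' c' d' :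
  quad a b c d + quad a' b' c' d' = quad (a + a') (b + b') (c + c') (d + d').
Proof.
by rewrite [LHS]quad_eta ![in LHS]mxE !inordK.
Qed.

Lemma model4_quad k a b c d : model4 k (quad a b c d) = model4_poly k a b c d.
Proof. by have [E0 E1 E2 E3] := quadE a b c d; rewrite model4E E0 E1 E2 E3. Qed.

(** Every coordinate has a partner in the quadratic part. Moving [z] along the partner of a nonzero
    entry of [p] makes the increment affine with that entry as slope; the entries are tried in an
    order for which the nonlinear terms add only a constant. *)
Lemma model4_increment (k : 'I_3) (p : 'rV[R]_4) (t : R) : p != 0 ->
  exists z, model4 k (z + p) - model4 k z = t.
Proof.
rewrite [p]quad_eta; move: (p 0 (inord 0)) (p 0 (inord 1)) (p 0 (inord 2)) (p 0 (inord 3)) => a b c d p0.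
suff [u [v [w [y E]]]] : exists u v w y,
    model4_poly k (u + a) (v + b) (w + c) (y + d) - model4_poly k u v w y = t.
  by exists (quad u v w y); rewrite quadD !model4_quad.
have nz : [|| a != 0, b != 0, c != 0 | d != 0].
  apply: contraNT p0; rewrite !negb_or !negbK => /and4P[/eqP-> /eqP-> /eqP-> /eqP->].
  by apply/eqP/rowP => i; rewrite !mxE; case: i => -[|[|[|[|//]]]] hi.
case: k => -[|[|[|//]]] hk; rewrite /model4_poly /=.
- have [a0|a0] := eqVneq a 0; last first.
    exists 0, ((t - c * d + 3^-1 * a * c * (a + c)) / a - b), 0, 0.
    by field; rewrite a0.
  have [c0|c0] := eqVneq c 0; last first.
    exists 0, 0, 0, (t / c - d); rewrite a0; by field; rewrite c0.
  have [b0|b0] := eqVneq b 0; last first.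
    exists (t / b), 0, 0, 0; rewrite a0 c0; by field; rewrite b0.
  have d0 : d != 0 by move: nz; rewrite a0 b0 c0 eqxx.
  exists 0, 0, (t / d), 0; rewrite a0 b0 c0; by field; rewrite d0.
- have [a0|a0] := eqVneq a 0; last first.
    exists 0, ((t - c * d + 3^-1 * a * c ^+ 2) / a - b), 0, 0.
    by field; rewrite a0.
  have [c0|c0] := eqVneq c 0; last first.
    exists 0, 0, 0, (t / c - d); rewrite a0; by field; rewrite c0.
  have [b0|b0] := eqVneq b 0; last first.
    exists (t / b), 0, 0, 0; rewrite a0 c0; by field; rewrite b0.
  have d0 : d != 0 by move: nz; rewrite a0 b0 c0 eqxx.
  exists 0, 0, (t / d), 0; rewrite a0 b0 c0; by field; rewrite d0.
- have [a0|a0] := eqVneq a 0; last first.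
    exists 0, 0, 0, ((t - (b * c - a ^+ 2 * c - a * b ^+ 2 + a ^+ 3 * b - 5^-1 * a ^+ 5)) / a - d).
    by field; rewrite a0.
  have [b0|b0] := eqVneq b 0; last first.
    exists 0, 0, (t / b - c), 0; rewrite a0; by field; rewrite b0.
  have [c0|c0] := eqVneq c 0; last first.
    exists 0, (t / c), 0, 0; rewrite a0 b0; by field; rewrite c0.
  have d0 : d != 0 by move: nz; rewrite a0 b0 c0 eqxx.
  exists (t / d), 0, 0, 0; rewrite a0 b0 c0; by field; rewrite d0.
Qed.

Definition carries_graph (i j : 'I_3) (C : 'M[R]_(4 + 1)) (e : 'rV[R]_(4 + 1)) : Prop :=
  C \in unitmx /\ forall z, graph (model4 i) z <-> graph (model4 j) (z *m C + e).

Lemma graphE (n : nat) (F : 'rV[R]_n -> R) (x : 'rV[R]_n) (t : R) :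
  graph F (row_mx x t%:M) <-> t = F x.
Proof.
split=> [[y _]|->]; last by exists x.
move=> /eq_row_mx[-> /matrixP/(_ 0 0)]; by rewrite !mxE eqxx !mulr1n.
Qed.

Lemma carries_graph_sym i j C e : carries_graph i j C e -> exists C' e', carries_graph j i C' e'.
Proof.
move=> [uC E]; exists (invmx C), (- (e *m invmx C)); split; first by rewrite unitmx_inv.
by move=> z; rewrite E mulmxDl mulNmx !mulmxKV// subrK.
Qed.

(* A vertical line meets the graph once, while every other direction is the
   difference of two points of a model graph; hence [C] preserves verticality. *)
Lemma carries_graph_vertical i j C e : carries_graph i j C e -> dlsubmx C = 0.
Proof.
move=> [uC E]; apply/eqP; apply: contraT => p0.
pose k := (drsubmx C) 0 0.
have [z zE] := model4_increment j k p0.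
have V : row_mx 0 1%:M *m C = row_mx (dlsubmx C) k%:M.
  rewrite -{1}[C]submxK mul_row_block !mul0mx !mul1mx !add0r; congr row_mx.
  by rewrite [LHS]mx11_scalar.
have G0 : graph (model4 j) (row_mx z (model4 j z)%:M) by apply/graphE.
have G1 : graph (model4 j) (row_mx (z + dlsubmx C) (model4 j z + k)%:M).
  by apply/graphE; rewrite -zE addrC subrK.
pose y := (row_mx z (model4 j z)%:M - e) *m invmx C.
have Y0 : graph (model4 i) y by apply/E; rewrite mulmxKV// subrK.
have Y1 : graph (model4 i) (y + row_mx 0 1%:M).
  apply/E; rewrite mulmxDl mulmxKV// V addrAC subrK add_row_mx.
  by rewrite -raddfD.
move: Y0 Y1; rewrite -[y]hsubmxK [rsubmx y]mx11_scalar add_row_mx addr0 -raddfD /=.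
move=> /graphE -> /graphE /eqP; rewrite eq_sym -subr_eq0 opprD addNKr.
by rewrite oppr_eq0 oner_eq0.
Qed.

Lemma carries_graph_affine i j C e : carries_graph i j C e ->
  exists (P : 'M[R]_4) (b : 'rV[R]_4) (q : 'cV[R]_4) (k c : R),
    [/\ P \in unitmx, k != 0 &
      forall x, model4 j (x *m P + b) = (x *m q) 0 0 + k * model4 i x + c].
Proof.
move=> CE; have dl := carries_graph_vertical CE; have [uC E] := CE.
have CB : C = block_mx (ulsubmx C) (ursubmx C) 0 (drsubmx C) by rewrite -dl submxK.
have dC : \det C = \det (ulsubmx C) * (drsubmx C) 0 0.
  by rewrite {1}CB det_ublock [X in _ * \det X]mx11_scalar det_scalar1.
have : \det C != 0 by move: uC; rewrite unitmxE unitfE.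
rewrite dC mulf_eq0 negb_or => /andP[P0 k0].
exists (ulsubmx C), (lsubmx e), (ursubmx C), ((drsubmx C) 0 0), (rsubmx e 0 0).
split=> // [|x]; first by rewrite unitmxE unitfE.
have /E : graph (model4 i) (row_mx x (model4 i x)%:M) by apply/graphE.
rewrite {1}CB mul_row_block mulmx0 addr0 -{1}[e]hsubmxK add_row_mx.
rewrite [X in row_mx _ X]mx11_scalar => /graphE <-.
rewrite [LHS]mxE [X in X + _]mxE mul_scalar_mx [X in _ + X + _]mxE.
by rewrite (mulrC (drsubmx C 0 0)).
Qed.

(* On the first coordinate axis the last model is of degree 5. *)
Lemma cubic_models_degree (j : 'I_3) C e : j != 2 -> ~ carries_graph 2 j C e.
Proof.
move=> j2 /carries_graph_affine[P [b [q [k [c [uP k0 E]]]]]].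
pose v := quad 1 0 0 0 *m P.
have f t : model4 j (t *: v + b) = t * (quad 1 0 0 0 *m q) 0 0 - k * (5^-1 * t ^+ 5) + c.
  have := E (t *: quad 1 0 0 0); rewrite -!scalemxAl => ->.
  have -> : t *: quad 1 0 0 0 = quad t 0 0 0 :> 'rV[R]_4.
    by rewrite [LHS]quad_eta ![in LHS]mxE !inordK//= !mulr0 mulr1.
  by rewrite model4_quad [X in X + _ + _]mxE /model4_poly /=; ring.
(* The fourth difference over these five values kills the cubic on the left and the affine part on
   the right, but sends [t ^+ 5] to 240; hence [k = 0]. *)
have := f 4; have := f 3; have := f 2; have := f 1; have := f 0.
have g t : model4 j (t *: v + b) = model4_poly j (t * v 0 (inord 0) + b 0 (inord 0))
   (t * v 0 (inord 1) + b 0 (inord 1)) (t * v 0 (inord 2) + b 0 (inord 2))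
   (t * v 0 (inord 3) + b 0 (inord 3)) by rewrite model4E !mxE.
rewrite !g; move: (v 0 _) (v 0 _) (v 0 _) (v 0 _) (b 0 _) (b 0 _) (b 0 _) (b 0 _)
  ((_ *m q) 0 0) => v0 v1 v2 v3 b0 b1 b2 b3 w.
move=> E0 E1 E2 E3 E4; have : k = 0; last by move=> kk; rewrite kk eqxx in k0.
case: j j2 {f g E} E0 E1 E2 E3 E4 => -[|[|[|//]]] hj j2; rewrite /model4_poly /=; [| |by []].
all: move=> E0 E1 E2 E3 E4.
all: lra.
Qed.

(** Comparison of the coefficients of [t ^+ 3] at [t *: x]: the translation [b] and the affine
    correction affect lower degrees only. *)
Lemma cubic_part (C : 'M[R]_(4 + 1)) (e : 'rV[R]_(4 + 1)) : carries_graph 1 0 C e ->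
  exists (P : 'M[R]_4) (k : R), P \in unitmx /\
    forall x : 'rV[R]_4, (x *m P) 0 (inord 0) * (x *m P) 0 (inord 2)
                * ((x *m P) 0 (inord 0) + (x *m P) 0 (inord 2))
              = k * (x 0 (inord 0) * x 0 (inord 2) ^+ 2).
Proof.
move=> /carries_graph_affine[P [b [q [k [c [uP _ E]]]]]].
exists P, k; split=> // x.
have f (t : R) : model4_poly 0 (t * (x *m P) 0 (inord 0) + b 0 (inord 0))
    (t * (x *m P) 0 (inord 1) + b 0 (inord 1)) (t * (x *m P) 0 (inord 2) + b 0 (inord 2))
    (t * (x *m P) 0 (inord 3) + b 0 (inord 3))
  = t * (x *m q) 0 0 + k * model4_poly 1 (t * x 0 (inord 0)) (t * x 0 (inord 1))
      (t * x 0 (inord 2)) (t * x 0 (inord 3)) + c.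
  have := E (t *: x); rewrite -!scalemxAl !model4E.
  have s (n : nat) (r : 'rV[R]_n) i : (t *: r) 0 i = t * r 0 i by rewrite mxE.
  have a (r r' : 'rV[R]_4) i : (r + r') 0 i = r 0 i + r' 0 i by rewrite mxE.
  by rewrite !(a, s).
(* The combination [f 2 - f (-2) - 2 (f 1 - f (-1))] isolates twelve times the cubic coefficient. *)
have := f 2; have := f 1; have := f (-1); have := f (-2).
move: ((x *m P) 0 (inord 0)) ((x *m P) 0 (inord 1)) ((x *m P) 0 (inord 2))
  ((x *m P) 0 (inord 3)) ((x *m q) 0 0) (x 0 (inord 0)) (x 0 (inord 1)) (x 0 (inord 2))
  (x 0 (inord 3)) (b 0 (inord 0)) (b 0 (inord 1)) (b 0 (inord 2)) (b 0 (inord 3)).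
move=> y0 y1 y2 y3 w x0 x1 x2 x3 b0 b1 b2 b3; rewrite /model4_poly /=.
by move=> E1 E2 E3 E4; lra.
Qed.

(* On the hyperplane of its double root, the form x z^2 vanishes to second order, and
   x z (x + z) does so only where x = z = 0. *)
Lemma cubic_models_roots (C : 'M[R]_(4 + 1)) e : ~ carries_graph 1 0 C e.
Proof.
move=> /cubic_part[P [k [uP E]]].
have D (x : 'rV[R]_4) (w : 'rV[R]_4) : x 0 (inord 2) = 0 ->
    let y := x *m P in let v := w *m invmx P in
    forall s : R, (y 0 (inord 0) + s * w 0 (inord 0)) * (y 0 (inord 2) + s * w 0 (inord 2))
      * (y 0 (inord 0) + s * w 0 (inord 0) + (y 0 (inord 2) + s * w 0 (inord 2)))
    = k * ((x 0 (inord 0) + s * v 0 (inord 0)) * (s * v 0 (inord 2)) ^+ 2).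
  move=> x2 y v s; have := E (x + s *: v).
  rewrite mulmxDl -scalemxAl mulmxKV// -/y.
  have sc (r : 'rV[R]_4) i : (s *: r) 0 i = s * r 0 i by rewrite mxE.
  have a (r r' : 'rV[R]_4) i : (r + r') 0 i = r 0 i + r' 0 i by rewrite mxE.
  by rewrite !(a, sc) x2 add0r.
have Z (x : 'rV[R]_4) : x 0 (inord 2) = 0 ->
    (x *m P) 0 (inord 0) = 0 /\ (x *m P) 0 (inord 2) = 0.
  move=> x2; have [q0 _ q2 _] := quadE 1 0 0 0; have [r0 _ r2 _] := quadE 0 0 1 0.
  have := D x (quad 1 0 0 0) x2; rewrite /= q0 q2 => f.
  have := D x (quad 0 0 1 0) x2; rewrite /= r0 r2 => g.
  have := f 1; have := f (-1); have := f 2; have := f (-2).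
  have := g 1; have := g (-1); have := g 2; have := g (-2).
  move: {f g} ((x *m P) 0 (inord 0)) ((x *m P) 0 (inord 2)) => y0 y2.
  move: (x 0 (inord 0)) ((quad 1 0 0 0 *m invmx P) 0 (inord 0))
    ((quad 1 0 0 0 *m invmx P) 0 (inord 2)) ((quad 0 0 1 0 *m invmx P) 0 (inord 0))
    ((quad 0 0 1 0 *m invmx P) 0 (inord 2)) => x0 v0 v2 w0 w2.
  move=> g1 g2 g3 g4 f1 f2 f3 f4.
  (* The four samples of each of [f] and [g] isolate the coefficient linear in [s]. It is absent on
     the right, and on the left it is a partial derivative of [y0 y2 (y0 + y2)]. *)
  have e1 : y2 * (2 * y0 + y2) = 0 by lra.
  have e2 : y0 * (y0 + 2 * y2) = 0 by lra.
  move/eqP: e1; rewrite mulf_eq0 => /orP[/eqP y20|/eqP y20].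
    split=> //; move/eqP: e2; rewrite y20 mulr0 addr0 mulf_eq0 orbb => /eqP //.
  have y2E : y2 = - 2 * y0 by lra.
  have : y0 ^+ 2 = 0 by move: e2; rewrite y2E; lra.
  by move=> /eqP; rewrite expf_eq0 /= => /eqP y00; rewrite y2E y00 mulr0.
pose a := (quad 0 0 1 0 *m P) 0 (inord 0); pose d := (quad 0 0 1 0 *m P) 0 (inord 2).
have L (x : 'rV[R]_4) : (x *m P) 0 (inord 0) = x 0 (inord 2) * a
    /\ (x *m P) 0 (inord 2) = x 0 (inord 2) * d.
  have -> : x = quad (x 0 (inord 0)) (x 0 (inord 1)) 0 (x 0 (inord 3))
      + x 0 (inord 2) *: quad 0 0 1 0.
    by rewrite [LHS]quad_eta; apply/rowP => i; rewrite !mxE; case: i => -[|[|[|[|//]]]] hi /=; ring.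
  set y := quad _ _ _ _; have [_ _ q2 _] := quadE 0 0 1 0.
  have [_ _ y2 _] := quadE (x 0 (inord 0)) (x 0 (inord 1)) 0 (x 0 (inord 3)).
  have [z0 z2] := Z y y2.
  have sc (t : R) (r : 'rV[R]_4) i : (t *: r) 0 i = t * r 0 i by rewrite mxE.
  have ad (r r' : 'rV[R]_4) i : (r + r') 0 i = r 0 i + r' 0 i by rewrite mxE.
  by rewrite mulmxDl -scalemxAl !(ad, sc) y2 q2 z0 z2 !add0r mulr1.
(* By [L] the coordinates 0 and 2 of [x *m P] are multiples of the single number [x 0 (inord 2)],
   yet invertibility of [P] lets them take the values (1, 0) and (0, 1). *)
have [s0 _] := L (quad 1 0 0 0 *m invmx P); have [t0 t2] := L (quad 0 0 1 0 *m invmx P).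
rewrite mulmxKV// in s0; rewrite mulmxKV// in t0; rewrite mulmxKV// in t2.
have [q0 _ _ _] := quadE 1 0 0 0; have [r0 _ r2 _] := quadE 0 0 1 0.
rewrite q0 in s0; rewrite r0 in t0; rewrite r2 in t2.
move/esym/eqP: t0; rewrite mulf_eq0 => /orP[/eqP t00|/eqP a0].
  by move/eqP: t2; rewrite t00 mul0r oner_eq0.
by move/eqP: s0; rewrite a0 mulr0 oner_eq0.
Qed.

Lemma carries_graph_inj i j C e : carries_graph i j C e -> i = j.
Proof.
have main (i' j' : 'I_3) C' e' : (j' < i')%N -> ~ carries_graph i' j' C' e'.
  case: i' => -[//|[|[|//]]] hi; case: j' => -[|[|[|//]]] hj // _ CE.
  - have e1 : Ordinal hi = 1 by apply/val_inj.
    have e0 : Ordinal hj = 0 by apply/val_inj.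
    rewrite e1 e0 in CE; exact: (cubic_models_roots CE).
  - have e2 : Ordinal hi = 2 by apply/val_inj.
    rewrite e2 in CE; exact: (cubic_models_degree _ CE).
  - have e2 : Ordinal hi = 2 by apply/val_inj.
    rewrite e2 in CE; exact: (cubic_models_degree _ CE).
move=> CE; have [ji|ij|ij] := ltngtP i j; last exact: val_inj.
  by have [C' [e' /main]] := carries_graph_sym CE; rewrite ji => /(_ isT).
by case: (main _ _ _ _ ij CE).
Qed.

End Models.

(** * The classification theorem *)

Section Equivalence.
Context {R : realType}.

Lemma linear_iso_unit (n : nat) (A : 'M[R]_n) : A \in unitmx -> linear_iso A.
Proof. by move=> uA; split; rewrite ?row_free_unit ?row_full_unit. Qed.

Lemma affine_graph_equivalent (n : nat) (F G Phi : 'rV[R]_n -> R) (A : 'M[R]_(n + 1)) b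
    (P : 'M[R]_n) (g : 'cV[R]_n) (k : R) :
  A \in unitmx -> P \in unitmx -> k != 0 ->
  (forall u, F u = F 0 + (u *m g) 0 0 + Phi u) ->
  (forall x, Phi (x *m P) = k * G x) ->
  affinely_equivalent (range (affine_map A b \o graph_map F)) (graph G).
Proof.
move=> uA uP k0 EF EP.
(* On pairs [(u, t)] this sends [t] to [k^-1 (t - F 0 - u g)] and [u] to [u P^-1]: the affine part
   of [F] is sheared away and the scale normalised. *)
pose C : 'M[R]_(n + 1) := block_mx (invmx P) (- k^-1 *: g) 0 (k^-1)%:M.
pose e : 'rV[R]_(n + 1) := row_mx 0 (- k^-1 * F 0)%:M.
have uC : C \in unitmx.
  rewrite unitmxE det_ublock det_scalar1 unitfE mulf_neq0 ?invr_eq0//.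
  by rewrite -unitfE -unitmxE unitmx_inv.
have CE u : graph_map F u *m C + e = graph_map G (u *m invmx P).
  rewrite /graph_map /C mul_row_block mulmx0 addr0 add_row_mx addr0; congr row_mx.
  apply/matrixP => i j; rewrite !ord1 -scalar_mxM -scalemxAr.
  rewrite 2!mxE [X in X + _ + _]mxE.
  rewrite ![_%:M 0 0]mxE eqxx !mulr1n EF.
  rewrite -[in Phi u](mulmxKV uP u) EP.
  by field; rewrite k0.
exists (invmx A *m C), (e - b *m (invmx A *m C)); split.
  by apply: linear_iso_unit; rewrite unitmx_mul unitmx_inv uA.
have ME u : affine_map (invmx A *m C) (e - b *m (invmx A *m C))
    ((affine_map A b \o graph_map F) u) = graph_map G (u *m invmx P).
  rewrite /= /affine_map mulmxDl addrACA subrr addr0.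
  by rewrite mulmxA mulmxK// CE.
apply/seteqP; split=> [_ [x _ <-]|_ [_ [u _ <-] <-]].
  exists ((affine_map A b \o graph_map F) (x *m P)); first by exists (x *m P).
  by rewrite ME mulmxK.
by rewrite ME; exists (u *m invmx P).
Qed.

Lemma affine_graph_quadric (n : nat) (F : 'rV[R]_n -> R) (A : 'M[R]_(n + 1)) b
    (H : 'M[R]_n) (g : 'cV[R]_n) :
  A \in unitmx -> H^T = H -> H != 0 ->
  (forall u, F u = F 0 + (u *m g) 0 0 + 2^-1 * (u *m H *m u^T) 0 0) ->
  quadric (range (affine_map A b \o graph_map F)).
Proof.
move=> uA sH H0 EF; pose B := invmx A.
(* [Q0] and [l0] encode [t - F u + F 0] in graph coordinates. Pulling back along
   [y |-> (y - b) A^-1] produces the linear term [- 2 Q b^T] and the constants below. *)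
pose Q0 : 'M[R]_(n + 1) := block_mx (- 2^-1 *: H) 0 0 0.
pose l0 : 'cV[R]_(n + 1) := col_mx (- g) 1%:M.
pose Q := B *m Q0 *m B^T.
have uB : B \in unitmx by rewrite unitmx_inv.
have sQ : Q^T = Q.
  rewrite /Q !trmx_mul trmxK /Q0 tr_block_mx !trmx0 linearZ /= sH.
  by rewrite mulmxA.
exists Q, (B *m l0 - 2 *: (Q *m b^T)), ((b *m Q *m b^T) 0 0 - (b *m (B *m l0)) 0 0 - F 0).
split=> //.
  apply: contra_neq H0 => Q0'.
  have : Q0 = 0.
    have : invmx B *m Q *m invmx B^T = 0 by rewrite Q0' mulmx0 mul0mx.
    by rewrite /Q -!mulmxA mulmxV ?unitmx_tr// mulmx1 mulKmx.
  rewrite /Q0 -(block_mx0 _ _ _ _) => /eq_block_mx[/eqP].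
  by rewrite scaler_eq0 oppr_eq0 invr_eq0 pnatr_eq0 => /eqP.
have tr00 (M1 : 'M[R]_1) : M1^T 0 0 = M1 0 0 by rewrite mxE.
have add00 (M1 M2 : 'M[R]_1) : (M1 + M2) 0 0 = M1 0 0 + M2 0 0 by rewrite mxE.
have opp00 (M1 : 'M[R]_1) : (- M1) 0 0 = - M1 0 0 by rewrite mxE.
have scale00 a (M1 : 'M[R]_1) : (a *: M1) 0 0 = a * M1 0 0 by rewrite mxE.
have key y : ((y *m Q *m y^T + y *m (B *m l0 - 2 *: (Q *m b^T))) 0 0
      + ((b *m Q *m b^T) 0 0 - (b *m (B *m l0)) 0 0 - F 0))
    = (((y - b) *m B) *m Q0 *m ((y - b) *m B)^T + ((y - b) *m B) *m l0) 0 0 - F 0.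
  have -> : ((y - b) *m B) *m Q0 *m ((y - b) *m B)^T = (y - b) *m Q *m (y - b)^T.
    by rewrite trmx_mul /Q !mulmxA.
  clearbody Q.
  have bQy : (b *m Q *m y^T) 0 0 = (y *m Q *m b^T) 0 0.
    by rewrite -tr00 trmx_mul (trmx_mul b Q) trmxK sQ mulmxA.
  rewrite [(y - b)^T]linearB /= !(mulmxBl, mulmxBr) -!scalemxAr !mulmxA.
  by rewrite !(add00, opp00, scale00) bQy; ring.
have eqn u t : (row_mx u t%:M *m Q0 *m (row_mx u t%:M)^T + row_mx u t%:M *m l0) 0 0 - F 0
    = t - F u.
  rewrite /Q0 /l0 mul_row_block mul_row_col tr_row_mx mul_row_col.
  rewrite !mulmx0 !addr0 mul0mx addr0 mulmx1 -scalemxAr -scalemxAl mulmxN (EF u).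
  by rewrite !(add00, opp00, scale00) [t%:M 0 0]mxE eqxx mulr1n; ring.
apply/seteqP; split=> [_ [u _ <-] /=|y /=].
  rewrite key /affine_map addrK mulmxK// /graph_map eqn subrr.
  by [].
rewrite key; set z := (y - b) *m B.
rewrite -[z]hsubmxK [rsubmx z]mx11_scalar eqn => /eqP; rewrite subr_eq0 => /eqP E.
exists (lsubmx z) => //; rewrite /= /graph_map -E -mx11_scalar hsubmxK.
by rewrite /affine_map /z mulmxKV// subrK.
Qed.

End Equivalence.

Section TaylorPolynomial.
Context {R : realType} {m : nat}.
Local Notation n := m.+1.
Local Notation e i := (delta_mx 0 i : 'rV[R]_n).
Variable F : 'rV[R]_n -> R.
Hypothesis sF : smooth F.
Hypothesis uH : forall x, hess F x \in unitmx.
Hypothesis pde : forall x l i j k,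
  dd (e l) (dd (e i) (dd (e j) (dd (e k) F))) x
  = 2^-1 * (form (hess F x) (prod_at F x (e l) (e i)) (prod_at F x (e j) (e k))
          + form (hess F x) (prod_at F x (e l) (e j)) (prod_at F x (e i) (e k))
          + form (hess F x) (prod_at F x (e l) (e k)) (prod_at F x (e i) (e j))).
Hypothesis hdet : forall x, \det (hess F x) ^+ 2 = \det (hess F 0) ^+ 2.
Hypothesis n4 : (n <= 4)%N.

Lemma taylor_potential u : F u = F 0 + (u *m \col_i dd (e i) F 0) 0 0
  + potential (hess F 0) (prod_at F 0) u.
Proof.
have T := taylor_smooth (k := 6) 0 sF (fun y => dd6_diag sF uH pde hdet n4 y u).
rewrite add0r !big_ord_recl big_ord0 /= /bump /= in T.
rewrite T (dd5_diag sF uH pde) (dd4_diag sF pde) -(form_prod sF uH) -(hessE sF).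
have -> : (u *m \col_i dd (e i) F 0) 0 0 = dd u F 0.
  rewrite (dd_basis u 0 sF) mxE; apply: eq_bigr => i _.
  by rewrite mxE.
rewrite /potential /factorial /=.
by field.
Qed.

End TaylorPolynomial.

Lemma model4_unique (R : realType) (M : set 'rV[R]_(4 + 1)) (i j : 'I_3) :
  affinely_equivalent M (graph (@model4 R i)) ->
  affinely_equivalent M (graph (@model4 R j)) -> i = j.
Proof.
move=> [A1 [b1 [[f1 _] E1]]] [A2 [b2 [[f2 _] E2]]].
rewrite !row_free_unit in f1 f2.
apply: (@carries_graph_inj _ i j (invmx A1 *m A2) (b2 - b1 *m (invmx A1 *m A2))).
split=> [|z]; first by rewrite unitmx_mul unitmx_inv f1.
have Ez y : affine_map A1 b1 y *m (invmx A1 *m A2) + (b2 - b1 *m (invmx A1 *m A2))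
    = affine_map A2 b2 y.
  rewrite /affine_map mulmxDl; set c := b1 *m _.
  by rewrite mulmxA mulmxK// -addrA [c + _]addrC subrK.
rewrite E1 E2; split=> [[y My <-]|[y My Ey]]; exists y => //.
rewrite -Ez in Ey; move/addIr: Ey => /(congr1 (mulmx^~ (invmx (invmx A1 *m A2)))).
by rewrite !mulmxK// unitmx_mul unitmx_inv f1.
Qed.

(** In dimension one a trace-free operator is zero. *)
Lemma metrised1_prod (R : realType) (H : 'M[R]_1) mul : metrised H mul ->
  forall u v, mul u v = 0.
Proof.
move=> M u v; have := Lmx_trace M u.
rewrite [Lmx mul u]mx11_scalar mxtrace_scalar mulr1n => L0.
by rewrite -(mul_Lmx M) [Lmx mul u]mx11_scalar L0 mul_mx_scalar scale0r.
Qed.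

Theorem theorem5p13 (R : realType) (n : nat) (n_gt0 : (0 < n)%N)
    (n_le4 : (n <= 4)%N) (M : set 'rV[R]_(n + 1)) (xi : 'rV[R]_(n + 1))
    (HM : parallel_improper_affine_sphere M xi)
    (irrM : irreducible_hypersurface M xi) :
  [/\ n = 1%N -> quadric M,
      n = 2%N \/ n = 3%N -> affinely_equivalent M (graph (@cayley R n)) &
      n = 4%N -> exists! k : 'I_3,
        affinely_equivalent M (graph (@model4 R k))].
Proof.
case: n n_gt0 n_le4 M xi HM irrM => [//|m] _ n4 M xi HM irrM.
have [F [A [b [sF uA Exi EM [uH hdet pde]]]]] := parallel_sphere_normal_form HM.
have met := metrised_prod_at sF uH pde hdet 0.
have T := taylor_potential sF uH pde hdet n4.
set g := \col_i _ in T.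
set H := hess F 0 in T met; set mul := prod_at F 0 in T met.
have nsplit : ~ splits (potential H mul).
  (* The potential differs from [F] by an affine function, so a splitting of it splits [F] up to the
     constant [F 0]. *)
  move=> [k [l [E1 [E2 [k0 l0 kl full split]]]]]; apply: irrM.
  rewrite EM -Exi.
  apply: (split_locally_decomposable sF uH uA k0 l0 kl full) => y1 y2.
  rewrite T split [F (y1 *m E1)]T [F (y2 *m E2)]T mulmxDl.
  have -> : (y1 *m E1 *m g + y2 *m E2 *m g) 0 0
    = (y1 *m E1 *m g) 0 0 + (y2 *m E2 *m g) 0 0 by rewrite mxE.
  by ring.
rewrite EM; split.
- move=> [m0]; subst m.
  have prod0 u v : mul u v = 0 := metrised1_prod met u v.
  apply: (@affine_graph_quadric _ _ _ _ _ H g uA).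
  + exact: met_sym met.
  + by apply: contraTneq (uH 0) => E; rewrite -/H E unitmxE det0 unitr0.
  move=> u; rewrite [LHS]T /potential !prod0 !form0l /form.
  by ring.
- move=> m12; have m12' : (m = 1 \/ m = 2)%N by lia.
  have [P [k [uP k0 E]]] := classification23 met m12' nsplit.
  exact: (affine_graph_equivalent b uA uP k0 T E).
move=> [m3]; subst m.
have [P [k [i [uP k0 E]]]] := classification4 met nsplit.
exists i; split; first exact: (affine_graph_equivalent b uA uP k0 T E).
move=> j; apply: model4_unique.
exact: (affine_graph_equivalent b uA uP k0 T E).
Qed.
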